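(* Assume that conditions (A1)–(A4) stated in the context hold, and let $\mu_*$ be the unique Borel probability measure on $(0,1)$ for which the chain $(X_n^{\mu_*})$ is stationary. Then for every $x\in(0,1)$ and every bounded continuous function $\varphi:(0,1)\to\mathbb{R}$, $$\frac{\varphi(X^x_1)+\ldots+\varphi(X^x_n)}{n}\xrightarrow[n\to\infty]{}\int_{(0,1)}\varphi\,d\mu_*\qquad\text{almost surely.}$$
   Context: Let $x_0,y_0$ be real numbers, $a_0=\frac{y_0}{x_0}$, $a_1=\frac{1-y_0}{1-x_0}$. Define homeomorphisms $f_0,f_1:[0,1]\to[0,1]$ by $f_0(x)=a_0x$ for $x\le x_0$, $f_0(x)=a_1(x-1)+1$ for $x>x_0$, and $f_1(x)=1-f_0(1-x)$. Let $p_0,p_1:[0,1]\to\mathbb{R}$ be positive functions with $p_0(x)+p_1(x)=1$ for all $x$. Put $\Lambda_0=p_0(0)\log a_0+p_1(0)\log a_1$ and $\Lambda_1=p_0(1)\log a_1+p_1(1)\log a_0$. Conditions: (A1) $\frac12<x_0<1$ and $\frac12\le y_0<x_0$; (A2) $p_0,p_1$ are Dini continuous, i.e. with the modulus of continuity $\beta(t)=\max_{i=0,1}\sup\{|p_i(x)-p_i(x+h)|: x\in(0,1),\ |h|\le t,\ x+h\in[0,1]\}$ one has $\sum_n\beta(Ct^n)<\infty$ for every $C\ge0$ and $0\le t<1$; (A3) $0<p_i(x)<1$ for $x\in[0,1]$, $i=0,1$; (A4) $\Lambda_0>0$ and $\Lambda_1>0$. For a Borel probability measure $\mu$ on $(0,1)$,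 $(X^\mu_n)_{n\ge0}$ denotes the Markov chain with state space the open interval $(0,1)$, initial distribution $\mu$ and transition probabilities $p(x,\cdot)=p_0(x)\delta_{f_0(x)}+p_1(x)\delta_{f_1(x)}$, $x\in(0,1)$. For $x\in(0,1)$, $(X^x_n)$ denotes this chain with initial distribution $\delta_x$. Under (A1)–(A4) there is exactly one Borel probability measure $\mu_*$ on $(0,1)$ making $(X_n^{\mu_*})$ stationary. *)

(* Defs.v *)
From HB Require Import structures.
From mathcomp Require Import all_boot all_order all_algebra.
From mathcomp Require Import all_classical all_reals all_analysis.

Set Implicit Arguments.
Unset Strict Implicit.
Unset Printing Implicit Defensive.

Import Order.TTheory GRing.Theory Num.Theory.
Import numFieldNormedType.Exports.

Local Open Scope classical_set_scope.
Local Open Scope ring_scope.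

(* Functions on [0,1] or ]0,1[ are represented by
   functions on R whose values outside that interval are never used; Borel
   probability measures on ]0,1[ by Borel probability measures on R giving
   mass 1 to ]0,1[. *)

Section Maps.
Context {R : realType}.
Variables x0 y0 : R.

Definition a0 : R := y0 / x0.
Definition a1 : R := (1 - y0) / (1 - x0).

Definition f0 (x : R) : R := if x <= x0 then a0 * x else a1 * (x - 1) + 1.
Definition f1 (x : R) : R := 1 - f0 (1 - x).

End Maps.

Section Conditions.
Context {R : realType}.
Variables (x0 y0 : R) (p0 p1 : R -> R).

Definition positive_probabilities : Prop :=
  forall x, x \in `[0, 1] -> [/\ 0 < p0 x, 0 < p1 x & p0 x + p1 x = 1].

Definition Lambda0 : R := p0 0 * ln (a0 x0 y0) + p1 0 * ln (a1 x0 y0).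
Definition Lambda1 : R := p0 1 * ln (a1 x0 y0) + p1 1 * ln (a0 x0 y0).

Definition osc (p : R -> R) (t : R) : \bar R :=
  ereal_sup [set e | exists x h, [/\ x \in `]0, 1[, `|h| <= t,
    x + h \in `[0, 1] & e = `|p x - p (x + h)|%:E]].

Definition modulus (t : R) : \bar R := maxe (osc p0 t) (osc p1 t).

Definition condA1 : Prop := 2^-1 < x0 < 1 /\ 2^-1 <= y0 < x0.

Definition condA2 : Prop := forall C t : R, 0 <= C -> 0 <= t < 1 ->
  (\sum_(0 <= n <oo) modulus (C * t ^+ n) < +oo)%E.

Definition condA3 : Prop :=
  forall x, x \in `[0, 1] -> 0 < p0 x < 1 /\ 0 < p1 x < 1.

Definition condA4 : Prop := 0 < Lambda0 /\ 0 < Lambda1.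

End Conditions.

Section Chains.
Context {R : realType}.

Definition transition (x0 y0 : R) (p0 p1 : R -> R) (x : R) (B : set R)
    : \bar R :=
  ((p0 x)%:E * \d_(f0 x0 y0 x) B + (p1 x)%:E * \d_(f1 x0 y0 x) B)%E.

Section Process.
Context {d : measure_display} {Omega : measurableType d}.
Context {P : probability Omega R}.

(* The sigma-algebra generated by X_0, ..., X_n. *)
Definition past (X : nat -> {RV P >-> R}) (n : nat) : set (set Omega) :=
  <<s [set E | exists i (A : set R),
         [/\ (i <= n)%N, measurable A & E = X i @^-1` A]] >>.

(* The last clause says that K (X_n) B is a version of the conditional
   probability of {X_(n+1) \in B} given the past up to time n. *)
Definition markov_chain (S : set R) (K : R -> set R -> \bar R)
    (mu : {measure set R -> \bar R})
    (X : nat -> {RV P >-> R}) : Prop :=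
  [/\ forall n w, S (X n w),
      forall A : set R, measurable A -> P (X 0%N @^-1` A) = mu A &
      forall n (E : set Omega) (B : set R), past X n E -> measurable B ->
        P (E `&` X n.+1 @^-1` B) = (\int[P]_(w in E) K (X n w) B)%E].

Definition stationary_process (X : nat -> {RV P >-> R}) : Prop :=
  forall (k m : nat) (A : nat -> set R), (forall i, measurable (A i)) ->
    P (\bigcap_(i in `I_m) X (k + i)%N @^-1` A i)
    = P (\bigcap_(i in `I_m) X i @^-1` A i).

End Process.

(* All chains with the same initial law and transition probabilities have the
   same finite-dimensional distributions, so that it does not matter which
   realization of the chain is considered. *)
Definition makes_chain_stationary (S : set R) (K : R -> set R -> \bar R)
    (mu : {measure set R -> \bar R}) : Prop :=
  exists (d : measure_display) (Omega : measurableType d)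
    (P : probability Omega R) (X : nat -> {RV P >-> R}),
    markov_chain S K mu X /\ stationary_process X.

End Chains.

(* Main.v *)
Require Import Defs.
From HB Require Import structures.
From mathcomp Require Import all_boot all_order all_algebra finmap.
From mathcomp Require Import all_classical all_reals all_analysis.
From mathcomp Require Import measurable_realfun ring lra.

Set Implicit Arguments.
Unset Strict Implicit.
Unset Printing Implicit Defensive.

Import Order.TTheory GRing.Theory Num.Theory.
Import numFieldNormedType.Exports.

Local Open Scope classical_set_scope.
Local Open Scope ring_scope.

(** Write P for the transition operator, u(z) = ln (2z) for z <= 1/2 and
    u(z) = - ln (2(1 - z)) for z >= 1/2.  In the coordinate u both maps are
    non-expanding (this uses y0 >= 1/2) and translations far from 0, and from
    every point some sequence of moves leads into a window on which one of
    them contracts.  By (A4), |u| has a negative drift at infinity; correcting it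
    by the number of steps needed to reach the window and exponentiating gives
    V >= 1 with P V <= lambda V + b for which |u x - u y| V(x) contracts in mean
    when two nearby chains make the same moves.
    Hence two close chains separate with probability at most a convergent Dini
    sum, so the functions P^n phi are equicontinuous; a Lyapunov function for
    pairs of independent chains then brings any two points close, and
    |P^m phi x - P^m phi y| <= e (V x + V y) for large m.  Integrating in y,
    |P^m phi - mu_* phi| <= e V.  Finally, the differences
    psi(X_{k+1}) - P psi(X_k) are orthogonal and bounded in L^2 whenever
    |psi| <= M V, so their averages tend to 0 almost surely: the averages of phi
    and of P^m phi along the chain agree in the limit, and those of V stay
    bounded. *)

(** * Averages over two moves and Lyapunov functions *)

(** In the Euclidean metric each map has a branch of slope [a1 > 1], and [p i] is only Dini
    continuous, so neither non-expansion nor a Lipschitz estimate for the choice of moves is at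
    hand. The metric [|u x - u y|] removes the expansion, but its contraction is guaranteed on the
    window only. Weighted by [V x] it decreases in mean for every close pair: on the window the
    distance shrinks by more than [V] may grow, off the window [V] itself decreases. Making the same
    moves costs [|p false x - p false y|] at each step, which is affordable only when the points are
    already close; distant pairs therefore choose independently, where no such error arises and a
    prescribed common move still has probability at least [pm ^+ 2]. Neither integrability of [V]
    under the stationary measure nor uniform continuity of phi on ]0, 1[ is given; both are
    circumvented by truncating at a level of [V]. *)

Section TwoPointAverage.
Context {R : realType}.
Implicit Types (q g h : bool -> R).

Definition avg2 q g := q false * g false + q true * g true.

Lemma ler_avg2 q g h : (forall i, 0 <= q i) -> (forall i, g i <= h i) ->
  avg2 q g <= avg2 q h.
Proof. by move=> q0 gh; rewrite lerD// ler_wpM2l. Qed.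

Lemma avg2D q g h : avg2 q (fun i => g i + h i) = avg2 q g + avg2 q h.
Proof. rewrite /avg2; ring. Qed.

Lemma avg2B q g h : avg2 q (fun i => g i - h i) = avg2 q g - avg2 q h.
Proof. rewrite /avg2; ring. Qed.

Lemma avg2Ml q g (a : R) : avg2 q (fun i => a * g i) = a * avg2 q g.
Proof. rewrite /avg2; ring. Qed.

Lemma avg2_const q (a : R) : q false + q true = 1 -> avg2 q (fun=> a) = a.
Proof. by rewrite /avg2 -mulrDl => ->; rewrite mul1r. Qed.

Lemma avg2_ge_term q g i : (forall j, 0 <= q j) -> (forall j, 0 <= g j) ->
  q i * g i <= avg2 q g.
Proof.
move=> q0 g0; rewrite /avg2.
by case: i; rewrite ?lerDl ?lerDr mulr_ge0.
Qed.

Lemma ler_norm_avg2 q g : (forall i, 0 <= q i) ->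
  `|avg2 q g| <= avg2 q (fun i => `|g i|).
Proof.
move=> q0; rewrite (le_trans (ler_normD _ _))// /avg2 !normrM.
by rewrite (ger0_norm (q0 false)) (ger0_norm (q0 true)).
Qed.

(** From [1 - s <= expR (- s)] one has [expR s <= 1 / (1 - s)], and the quadratic times [1 - s]
    equals [1 + s ^+ 2 * (1 - 2 * s) >= 1]. *)
Lemma expR_le_quad (s : R) : s <= 2^-1 -> expR s <= 1 + s + 2 * s ^+ 2.
Proof.
move=> s2; have s1 : 0 < 1 - s by lra.
have := expR_ge1Dx (- s); rewrite expRN => h.
have : expR s <= (1 - s)^-1.
  by rewrite -[leLHS]invrK lef_pV2 ?posrE ?invr_gt0 ?expR_gt0.
move=> /le_trans; apply.
rewrite -[leLHS]mul1r ler_pdivrMr//.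
have : 0 <= s ^+ 2 by rewrite sqr_ge0.
have -> : (1 + s + 2 * s ^+ 2) * (1 - s) = 1 + s ^+ 2 * (1 - 2 * s) by ring.
nra.
Qed.

(* an additive drift becomes a multiplicative one after exponentiating with a
   small parameter *)
Lemma avg2_expR q g (a C c : R) : (forall i, 0 <= q i) ->
  q false + q true = 1 ->
  (forall i, `|g i| <= C) -> avg2 q g <= - c ->
  0 <= a -> a * C <= 2^-1 -> a * C ^+ 2 <= c / 4 ->
  avg2 q (fun i => expR (a * g i)) <= 1 - a * c / 2.
Proof.
move=> q0 q1 gC gc a0 aC aC2.
have C0 : 0 <= C by exact: le_trans (normr_ge0 _) (gC true).
(* The quadratic remainder [2 * (a * C) ^+ 2] uses up at most half of the linear gain [a * c],
   because [a * C ^+ 2 <= c / 4]. *)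
have H i : expR (a * g i) <= 1 + a * g i + a * c / 2.
  have := gC i; rewrite ler_norml => /andP[g1 g2].
  have h1 : a * g i <= 2^-1 by nra.
  have := expR_le_quad h1.
  have : (a * g i) ^+ 2 <= (a * C) ^+ 2.
    by rewrite !exprMn ler_wpM2l ?sqr_ge0//; nra.
  have -> : (a * C) ^+ 2 = a * (a * C ^+ 2) by ring.
  nra.
apply: le_trans (ler_avg2 q0 H) _.
rewrite !avg2D !avg2_const// avg2Ml; nra.
Qed.

Lemma avg2_le_gain q g (m r s : R) i : 0 <= m -> (forall j, m <= q j) ->
  q false + q true = 1 -> 0 <= s -> (forall j, g j <= r) -> g i <= r - s ->
  avg2 q g <= r - m * s.
Proof.
move=> m0 qm q1 s0 gr gi.
have q0 j : 0 <= q j by exact: le_trans (qm j).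
have hj j : q j * g j <= q j * r by rewrite ler_wpM2l.
have hi : q i * g i <= q i * r - m * s.
  apply: (@le_trans _ _ (q i * (r - s))); first by rewrite ler_wpM2l.
  by rewrite mulrBr lerB// ler_wpM2r.
have -> : r - m * s = (q false * r + q true * r) - m * s by rewrite -mulrDl q1
  mul1r.
rewrite /avg2; case: i hi {gi} => hi; first by rewrite -addrA lerD.
by rewrite addrAC lerD.
Qed.

(* one exponent that suits the Lyapunov function, its square, and its product
   with the distance *)
Lemma small_exponent (C c k : R) : 1 <= C -> 0 < c <= 1 -> 0 < k <= 1 ->
  exists a lambda : R,
  [/\ 0 < a, 0 < lambda < 1, a * C <= 2^-1 & 2 * a * C <= 2^-1] /\
  [/\ a * C ^+ 2 <= c / 4, 2 * a * C ^+ 2 <= c / 4, 1 - a * c / 2 <= lambda,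
      1 - 2 * a * c / 2 <= lambda & (1 - k) * expR (a * C) <= lambda].
Proof.
move=> C_ge1 /andP[c0 c1] /andP[k0 k1].
pose m := Num.min k c.
have m_gt0 : 0 < m by rewrite lt_min k0.
have m_lek : m <= k by rewrite ge_min lexx.
have m_lec : m <= c by rewrite ge_min lexx orbT.
have C2_ge1 : 1 <= C ^+ 2 by rewrite exprn_ege1.
pose a := m / (8 * C ^+ 2).
have a_gt0 : 0 < a by rewrite divr_gt0//; lra.
have aC2 : a * C ^+ 2 = m / 8 by rewrite /a; field; apply/eqP => C0; lra.
have a_le1 : a <= 1 by rewrite /a ler_pdivrMr; lra.
have aC : a * C <= m / 8 by rewrite -aC2 ler_pM2l// expr2 ler_peMr//; lra.
have aC_ge0 : 0 <= a * C by rewrite mulr_ge0 ?(ltW a_gt0)//; lra.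
have am : 0 < a * m by rewrite mulr_gt0.
have am1 : a * m <= m by rewrite ler_piMl// ltW.
have amc : a * m <= a * c by rewrite ler_pM2l.
have H : expR (a * C) <= 1 + 2 * (a * C).
  apply: (le_trans (expR_le_quad _)); first lra.
  nra.
(* For the last bound, [(1 - k) * (1 + k / 4) <= 1 - k / 2], which is at most the chosen rate since
   [a <= 1] and [m <= k]. *)
exists a, (1 - a * m / 2); split; split=> //.
- by apply/andP; split; lra.
- lra.
- lra.
- lra.
- by rewrite -(mulrA 2) aC2; lra.
- lra.
- lra.
- have h1 : 1 + 2 * (a * C) <= 1 + k / 4 by lra.
  have := ler_wpM2l (_ : 0 <= 1 - k) (le_trans H h1).
  by rewrite subr_ge0 => /(_ k1); nra.
Qed.

End TwoPointAverage.

Section Lyapunov.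
Context {R : realType} {T : Type}.
Variables (S J : T -> Prop) (F : bool -> T -> T) (p : bool -> T -> R).
Variables (u t : T -> R) (pm B L c k1 k2 sigma eps : R).
Hypothesis p_sum : forall x, S x -> p false x + p true x = 1.
Hypothesis pm_gt0 : 0 < pm.
Hypothesis p_ge : forall i x, S x -> pm <= p i x.
Hypothesis u_step : forall i x, S x -> `|u (F i x) - u x| <= B.
Hypothesis L_ge0 : 0 <= L.
Hypothesis c_gt0 : 0 < c.
Hypothesis drift : forall x, S x -> L <= `|u x| ->
  avg2 (p^~ x) (fun i => `|u (F i x)|) <= `|u x| - c.
Hypothesis t_ge0 : forall x, 0 <= t x.
Hypothesis k2_ge0 : 0 <= k2.
Hypothesis t_le : forall x, t x <= k1 + k2 * `|u x|.
Hypothesis steer : forall x, S x -> ~ J x -> exists i, t (F i x) <= t x - 1.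
Hypothesis J_bnd : forall x, J x -> `|u x| <= L.
Hypothesis u_nonexp : forall i x y, S x -> S y ->
  `|u (F i x) - u (F i y)| <= `|u x - u y|.
Hypothesis sigma_bnd : 0 < sigma <= 1.
Hypothesis J_contr : forall x, S x -> J x -> exists i, forall y, S y ->
  `|u (F i x) - u (F i y)| <=
  `|u x - u y| - sigma * Num.min `|u x - u y| eps.

(* [t x] bounds the number of moves from [x] to the window [J]; the bounded
   correction makes the drift of [`|u x|] negative everywhere outside [J] *)
Definition lyapunov (a N K : R) (x : T) :=
  expR (a * (`|u x| + N * (1 - expR (- (K * t x))))).

Let p_ge0 x : S x -> forall i, 0 <= p i x.
Proof. by move=> Sx i; apply: le_trans (p_ge i Sx); exact: ltW. Qed.

Lemma pm_le_half x : S x -> pm <= 2^-1.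
Proof.
move=> Sx; have := p_ge true Sx; have := p_ge false Sx; have := p_sum Sx; lra.
Qed.

(* [e^{-Kt}] at least doubles in mean wherever a good move is available *)
Lemma steer_gain (q : bool -> R) (e : R) (g : bool -> R) (pq K : R) i :
  0 < pq -> (forall j, pq <= q j) -> 2 <= pq * expR K -> g i <= e - 1 ->
  0 <= K ->
  2 * expR (- (K * e)) <= avg2 q (fun j => expR (- (K * g j))).
Proof.
move=> pq0 pq_le Kge gi K0.
have q0 j : 0 <= q j by apply: le_trans (pq_le j); exact: ltW.
have h : expR K * expR (- (K * e)) <= expR (- (K * g i)).
  by rewrite -expRD ler_expR; nra.
have hi : 2 * expR (- (K * e)) <= q i * expR (- (K * g i)).
  have := pq_le i; have := expR_gt0 (- (K * e)); have := expR_gt0 K.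
  move=> ? ? ?; apply: (@le_trans _ _ (pq * (expR K * expR (- (K * e))))).
    by rewrite mulrA ler_wpM2r// ltW.
  by apply: ler_pM => //; rewrite ?mulr_ge0 ?expR_ge0 ?ltW.
apply: le_trans hi _; rewrite -/((fun j => expR (- (K * g j))) i).
by apply: avg2_ge_term => // j; exact: expR_ge0.
Qed.

(** Outside [J] the exponent [w] drifts down by [c']: beyond [L] by the drift of [|u|], since the
    correction does not rise in mean, and below [L] because the correction falls by more than [|u|]
    can rise. On [J] everything is bounded. For the weighted distance, off [J] the drift of [V]
    suffices as the distance does not grow; on [J] the contraction beats the growth of [V]. *)
Lemma lyapunov_exists x1 : S x1 -> exists a N K lambda bb C RJ : R,
  [/\ 0 < a, 0 <= N, 0 < K & 0 < lambda < 1] /\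
  let V := lyapunov a N K in
  [/\ forall x, S x -> avg2 (p^~ x) (fun i => V (F i x)) <= lambda * V x + bb,
      forall x, S x -> avg2 (p^~ x) (fun i => V (F i x) ^+ 2) <=
                       lambda * V x ^+ 2 + bb,
      forall i x, S x -> V (F i x) <= C * V x,
      forall x, J x -> V x <= RJ &
      forall x y, S x -> S y -> `|u x - u y| <= eps ->
        avg2 (p^~ x) (fun i => `|u (F i x) - u (F i y)| * V (F i x)) <=
        lambda * (`|u x - u y| * V x)].
Proof.
move=> Sx1; have pm2 := pm_le_half Sx1; have pm1 : pm <= 1 by lra.
have B0 : 0 <= B by exact: le_trans (normr_ge0 _) (u_step true Sx1).
(* With this [K], a single move of probability at least [pm] that lowers [t] by 1 already doubles
   the mean of [expR (- (K * t))]. *)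
pose K := ln (2 / pm).
have pm2gt : 1 < 2 / pm by rewrite ltr_pdivlMr//; lra.
have K_gt0 : 0 < K by rewrite ln_gt0.
have eK : pm * expR K = 2.
  by rewrite lnK ?posrE ?divr_gt0// mulrCA divff ?mulr1 ?gt_eqF.
(* [e0] bounds [expR (- (K * t x))] from below where [|u x| <= L]. There the correction falls in
   mean by at least [N * e0 = B + 1], one more than the largest rise [B] of [|u|]. *)
pose e0 := expR (- (K * (k1 + k2 * L))).
pose N := (B + 1) / e0.
have e0_gt0 : 0 < e0 by exact: expR_gt0.
have N_ge0 : 0 <= N by rewrite divr_ge0 ?ltW//; lra.
pose w x := `|u x| + N * (1 - expR (- (K * t x))).
pose C := B + N + 1.
have C_ge1 : 1 <= C by rewrite /C; lra.
pose c' := Num.min c 1.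
have c'_gt0 : 0 < c' by rewrite lt_min c_gt0 ltr01.
have c'_le1 : c' <= 1 by rewrite ge_min lexx orbT.
have c'_le : c' <= c by rewrite ge_min lexx.
have e1 x : expR (- (K * t x)) <= 1 by rewrite expR_le1 oppr_le0 mulr_ge0// ltW.
have w_ge x : `|u x| <= w x.
  by rewrite /w; have := e1 x; nra.
have w_le x : w x <= `|u x| + N.
  by rewrite /w; have := expR_gt0 (- (K * t x)); nra.
have w_step i x : S x -> `|w (F i x) - w x| <= C.
  move=> Sx; have h1 := u_step i Sx.
  have h2 := lerB_dist (u (F i x)) (u x); have h3 :=
    lerB_dist (u x) (u (F i x)).
  rewrite (distrC (u x)) in h3.
  have := e1 x; have := expR_gt0 (- (K * t x)).
  have := e1 (F i x); have := expR_gt0 (- (K * t (F i x))).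
  move=> *; rewrite /w /C ler_norml; apply/andP; split; nra.
have w_drift x : S x -> ~ J x -> avg2 (p^~ x) (fun i =>
  w (F i x) - w x) <= - c'.
  move=> Sx Jx; rewrite avg2B avg2_const; last exact: p_sum.
  rewrite /w avg2D avg2Ml avg2B avg2_const; last exact: p_sum.
  have [i ti] := steer Sx Jx.
  have := @steer_gain (p^~ x) (t x) (fun j => t (F j x)) pm K i pm_gt0.
  move=> /(_ (fun j => p_ge j Sx)); rewrite eK => /(_ (lexx _) ti (ltW K_gt0)).
  set E := avg2 _ _; set U := avg2 _ _ => hE.
  have e_gt0 := expR_gt0 (- (K * t x)).
  have hNE : N * (1 - E) <= N * (1 - expR (- (K * t x))) - N * expR (- (K * t
    x)).
    nra.
  suff : U - `|u x| - N * expR (- (K * t x)) <= - c' by lra.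
  have [h|h] := leP L `|u x|; first by have := drift Sx h; rewrite -/U; nra.
  have hU : U <= `|u x| + B.
    rewrite -[leRHS](@avg2_const _ (p^~ x) _ (p_sum Sx)); apply: ler_avg2;
      first exact: p_ge0.
    by move=> j; have := u_step j Sx; have := lerB_dist (u (F j x)) (u x); lra.
  have : e0 <= expR (- (K * t x)).
    rewrite ler_expR lerN2 ler_pM2l//; apply: le_trans (t_le _) _.
    by rewrite lerD2l ler_wpM2l// ltW.
  have : N * e0 = B + 1 by rewrite /N divfK// gt_eqF.
  nra.
(* From a point of [J] the mean distance shrinks by the factor [1 - q] while [V] grows at most by
   [expR (a * C)]; the exponent is chosen to keep the product of the two below [lambda]. *)
pose q := pm * sigma.
have q01 : 0 < q <= 1.
  case/andP: sigma_bnd => s0 s1; rewrite mulr_gt0//=.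
  by apply: mulr_ile1 => //; exact: ltW.
have c'01 : 0 < c' <= 1 by rewrite c'_gt0.
have [a [lambda [[a_gt0 l01 aC a2C] [aC2 a2C2 la la2 lq]]]] :=
  small_exponent C_ge1 c'01 q01.
pose V := lyapunov a N K.
have VE x : V x = expR (a * w x) by [].
have V_gt0 x : 0 < V x by exact: expR_gt0.
have Vstep i x : V (F i x) = V x * expR (a * (w (F i x) - w x)).
  by rewrite !VE -expRD; congr expR; ring.
have avgV x : S x -> ~ J x -> avg2 (p^~ x) (fun i => V (F i x)) <= lambda * V x.
  move=> Sx Jx; have -> : (fun i => V (F i x)) =
      (fun i => V x * expR (a * (w (F i x) - w x))).
    by apply/funext => i; exact: Vstep.
  rewrite avg2Ml mulrC ler_pM2r//.
  have := avg2_expR (q := p^~ x) (p_ge0 Sx) (p_sum Sx) (fun i => w_step i x Sx)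
    (w_drift _ Sx Jx) (ltW a_gt0).
  by move=> /(_ aC aC2)/le_trans; apply.
have avgV2 x : S x -> ~ J x ->
    avg2 (p^~ x) (fun i => V (F i x) ^+ 2) <= lambda * V x ^+ 2.
  move=> Sx Jx.
  have -> : (fun i => V (F i x) ^+ 2) =
      (fun i => V x ^+ 2 * expR ((2 * a) * (w (F i x) - w x))).
    apply/funext => i; rewrite Vstep exprMn -mulrA; congr (_ * _).
    by rewrite -expRM_natl.
  rewrite avg2Ml mulrC ler_pM2r ?exprn_gt0//.
  have := avg2_expR (q := p^~ x) (a := 2 * a) (p_ge0 Sx) (p_sum Sx) (fun i =>
    w_step i x Sx)
    (w_drift _ Sx Jx) (mulr_ge0 (ler0n _ 2) (ltW a_gt0)).
  by move=> /(_ a2C a2C2)/le_trans; apply.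
have VC i x : S x -> V (F i x) <= expR (a * C) * V x.
  move=> Sx; rewrite Vstep mulrC ler_pM2r// ler_expR ler_pM2l//.
  exact: le_trans (ler_norm _) (w_step _ _ Sx).
pose RJ := expR (a * (L + N)).
have VJ x : J x -> V x <= RJ.
  move=> Jx; rewrite ler_expR ler_pM2l//; apply: le_trans (w_le x) _.
  by rewrite lerD2r J_bnd.
have RJ_ge1 : 1 <= RJ.
  by rewrite -expR0 ler_expR mulr_ge0 ?(ltW a_gt0)// addr_ge0.
have eaC_ge1 : 1 <= expR (a * C).
  by rewrite -expR0 ler_expR mulr_ge0 ?(ltW a_gt0)//; lra.
(* One additive constant serves [V] and [V ^+ 2]: a step from [J] leads to values of [V] at most
   [expR (a * C) * RJ], a number at least 1 and hence at most its square. *)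
exists a, N, K, lambda, ((expR (a * C) * RJ) ^+ 2), (expR (a * C)), RJ.
split=> //; split => //.
- move=> x Sx; have [Jx|Jx] := pselect (J x); last first.
    by rewrite (le_trans (avgV _ Sx Jx))// lerDl sqr_ge0.
  apply: (@le_trans _ _ (expR (a * C) * RJ)).
    rewrite -[leRHS](@avg2_const _ (p^~ x) _ (p_sum Sx)); apply: ler_avg2;
      first exact: p_ge0.
    move=> i; apply: le_trans (VC i x Sx) _.
    by rewrite ler_pM2l ?expR_gt0//; exact: VJ.
  rewrite -[leLHS]add0r lerD//.
    by case/andP: l01 => *; rewrite mulr_ge0 ?ltW.
  by rewrite expr2 ler_peMr ?mulr_ge0 ?expR_ge0//; nra.
- move=> x Sx; have [Jx|Jx] := pselect (J x); last first.
    by rewrite (le_trans (avgV2 _ Sx Jx))// lerDl sqr_ge0.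
  apply: (@le_trans _ _ ((expR (a * C) * RJ) ^+ 2)).
    rewrite -[leRHS](@avg2_const _ (p^~ x) _ (p_sum Sx)); apply: ler_avg2;
      first exact: p_ge0.
    move=> i; have h : V (F i x) <= expR (a * C) * RJ.
      apply: le_trans (VC i x Sx) _.
      by rewrite ler_pM2l ?expR_gt0//; exact: VJ.
    by rewrite ler_sqr ?nnegrE ?(ltW (V_gt0 _))// mulr_ge0 ?expR_ge0.
  rewrite lerDr.
  by case/andP: l01 => *; rewrite mulr_ge0 ?sqr_ge0 ?ltW.
- move=> x y Sx Sy xy.
  set r := `|u x - u y|.
  have r_ge0 : 0 <= r by exact: normr_ge0.
  have [Jx|Jx] := pselect (J x); last first.
    apply: (@le_trans _ _ (avg2 (p^~ x) (fun i => r * V (F i x)))).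
      apply: ler_avg2; first exact: p_ge0.
      by move=> i; rewrite ler_pM2r// u_nonexp.
    by rewrite avg2Ml mulrCA ler_wpM2l// avgV.
  have [i /(_ y Sy)] := J_contr Sx Jx.
  rewrite min_l// -/r => hi.
  have rE j : `|u (F j x) - u (F j y)| <= r by exact: u_nonexp.
  pose W := expR (a * C) * V x.
  have W0 : 0 < W by rewrite mulr_gt0 ?expR_gt0.
  apply: (@le_trans _ _ (avg2 (p^~ x) (fun j => `|u (F j x) - u (F j y)| * W))).
    apply: ler_avg2; first exact: p_ge0.
    by move=> j; rewrite ler_wpM2l//; exact: VC.
  have h : avg2 (p^~ x) (fun j =>
    `|u (F j x) - u (F j y)|) <= r - pm * (sigma * r).
    apply: (avg2_le_gain (i := i) (ltW pm_gt0) (fun j =>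
      p_ge j Sx) (p_sum Sx)) => //.
    by case/andP: sigma_bnd => s0 _; rewrite mulr_ge0// ltW.
  have -> : avg2 (p^~ x) (fun j => `|u (F j x) - u (F j y)| * W) =
    avg2 (p^~ x) (fun j => `|u (F j x) - u (F j y)|) * W by rewrite /avg2; ring.
  apply: (@le_trans _ _ ((r - pm * (sigma * r)) * W));
    first by rewrite ler_pM2r.
  have -> : (r - pm * (sigma * r)) * W = (1 - q) * expR (a * C) * (r * V x).
    by rewrite /W /q; ring.
  by rewrite ler_wpM2r// mulr_ge0// ltW.
Qed.

End Lyapunov.

(** * Equicontinuity and coupling *)

Section MarkovOperator.
Context {R : realType} {T : Type}.
Variables (S : T -> Prop) (F : bool -> T -> T) (p : bool -> T -> R).
Hypothesis FS : forall i x, S x -> S (F i x).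
Hypothesis p_sum : forall x, S x -> p false x + p true x = 1.
Hypothesis p_ge0 : forall x, S x -> forall i, 0 <= p i x.

Definition markov_op (psi : T -> R) (x : T) : R :=
  avg2 (p^~ x) (fun i => psi (F i x)).

Lemma markov_op_bounded psi (M : R) x : (forall y, S y -> `|psi y| <= M) ->
  S x ->
  `|markov_op psi x| <= M.
Proof.
move=> psiM Sx; apply: le_trans (ler_norm_avg2 _ (p_ge0 Sx)) _.
rewrite -[leRHS](@avg2_const _ (p^~ x) _ (p_sum Sx)).
by apply: ler_avg2 => [|i]; [exact: p_ge0|exact/psiM/FS].
Qed.

Lemma iter_markov_op_bounded psi (M : R) n x :
  (forall y, S y -> `|psi y| <= M) -> S x -> `|iter n markov_op psi x| <= M.
Proof.
elim: n x => [|n IH] x psiM Sx; first exact: psiM.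
by rewrite iterS; apply: markov_op_bounded => // y Sy; exact: IH.
Qed.

(* the two chains make the same choice except on an event of probability
   [|p false x - p false y|] *)
Lemma markov_op_synchronous psi (M : R) x y : (forall z, S z ->
  `|psi z| <= M) ->
  S x -> S y ->
  `|markov_op psi x - markov_op psi y| <=
  avg2 (p^~ x) (fun i => `|psi (F i x) - psi (F i y)|)
  + 2 * M * `|p false x - p false y|.
Proof.
move=> psiM Sx Sy.
have -> : markov_op psi x - markov_op psi y =
    avg2 (p^~ x) (fun i => psi (F i x) - psi (F i y)) +
    (p false x - p false y) * (psi (F false y) - psi (F true y)).
  have hx : p true x = 1 - p false x by rewrite -(p_sum Sx); ring.
  have hy : p true y = 1 - p false y by rewrite -(p_sum Sy); ring.
  rewrite /markov_op /avg2 hx hy; ring.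
apply: le_trans (ler_normD _ _) _; apply: lerD.
  exact: (ler_norm_avg2 _ (p_ge0 Sx)).
rewrite normrM mulrC ler_wpM2r//.
apply: le_trans (ler_normB _ _) _.
by rewrite mulrDl mul1r lerD// psiM//; exact: FS.
Qed.

(** The weights [p i x * p j y] have the right marginals, so no error term appears, however far
    apart [x] and [y] are. *)
Lemma markov_op_independent psi x y : S x -> S y ->
  `|markov_op psi x - markov_op psi y| <=
  avg2 (p^~ x) (fun i => avg2 (p^~ y) (fun j => `|psi (F i x) - psi (F j y)|)).
Proof.
move=> Sx Sy.
have -> : markov_op psi x - markov_op psi y =
    avg2 (p^~ x) (fun i => avg2 (p^~ y) (fun j => psi (F i x) - psi (F j y))).
  have hx : p true x = 1 - p false x by rewrite -(p_sum Sx); ring.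
  have hy : p true y = 1 - p false y by rewrite -(p_sum Sy); ring.
  rewrite /markov_op /avg2 hx hy; ring.
apply: le_trans (ler_norm_avg2 _ (p_ge0 Sx)) _.
apply: ler_avg2; first exact: p_ge0.
by move=> i; exact: (ler_norm_avg2 _ (p_ge0 Sy)).
Qed.

End MarkovOperator.

Section Equicontinuity.
Context {R : realType} {T : Type}.
Variables (S : T -> Prop) (F : bool -> T -> T) (p : bool -> T -> R).
Variables (u V : T -> R) (b : R -> R) (lambda eps : R).
Hypothesis FS : forall i x, S x -> S (F i x).
Hypothesis p_sum : forall x, S x -> p false x + p true x = 1.
Hypothesis p_ge0 : forall x, S x -> forall i, 0 <= p i x.
Hypothesis b_ge0 : forall s, 0 <= s -> 0 <= b s.
Hypothesis b_le1 : forall s, 0 <= s -> b s <= 1.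
Hypothesis b_mono : forall s t : R, 0 <= s <= t -> b s <= b t.
Hypothesis b_dini : forall t : R, 0 < t < 1 ->
  exists M : R, forall n, \sum_(k < n) b (t ^+ k) <= M.
Hypothesis p_lip : forall x y, S x -> S y ->
  `|p false x - p false y| <= b `|u x - u y|.
Hypothesis u_nonexp : forall i x y, S x -> S y ->
  `|u (F i x) - u (F i y)| <= `|u x - u y|.
Hypothesis eps_gt0 : 0 < eps.
Hypothesis lambda_bnd : 0 < lambda < 1.
Hypothesis V_ge1 : forall x, 1 <= V x.
Hypothesis contraction : forall x y, S x -> S y -> `|u x - u y| <= eps ->
  avg2 (p^~ x) (fun i => `|u (F i x) - u (F i y)| * V (F i x)) <=
  lambda * (`|u x - u y| * V x).

Local Notation P := (markov_op F p).

(** Scaling by [r = t ^+ j] shifts the series, so the sums are pieces of a tail of a series with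
    bounded partial sums. *)
Lemma dini_tail (t e : R) : 0 < t < 1 -> 0 < e ->
  exists2 r : R, 0 < r & forall n, \sum_(k < n) b (r * t ^+ k) <= e.
Proof.
move=> t01 e0; have [M bM] := b_dini t01.
pose s n := \sum_(k < n) b (t ^+ k).
have hs : has_sup (range s).
  by split; [exists (s 0%N), 0%N|exists M => _ [n _ <-]; exact: bM].
have [_ [j _ <-] hj] := sup_adherent e0 hs.
exists (t ^+ j); first by rewrite exprn_gt0//; case/andP: t01.
move=> n; have : s (j + n)%N <= sup (range s).
  by apply: sup_upper_bound => //; exists (j + n)%N.
rewrite /s big_split_ord /=.
under [X in _ + X <= _]eq_bigr do rewrite exprD.
rewrite -/(s j); lra.
Qed.

(** The thresholds [r k] are free. At time [k] the two chains choose differently with probability at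
    most [b (r k)] if their distance is below [r k]; the probability that it is not is at most
    [lambda ^+ k * |u x - u y| * V x / r k], by Markov's inequality and the contraction. Each
    separation costs at most [2 * M]. The induction shifts [r]. *)
Lemma iter_markov_op_modulus (phi : T -> R) (M e eta : R) :
  (forall x, S x -> `|phi x| <= M) -> eta <= eps ->
  (forall x y, S x -> S y -> `|u x - u y| <= eta -> `|phi x - phi y| <= e) ->
  forall n (r : nat -> R) x y, (forall k, 0 < r k) -> S x -> S y ->
    `|u x - u y| <= eta ->
  `|iter n P phi x - iter n P phi y| <= e +
    2 * M * (\sum_(k < n) b (r k) +
             (\sum_(k < n) lambda ^+ k / r k) * (`|u x - u y| * V x)).
Proof.
move=> phiM etae phi_e; elim=> [|n IH] r x y r_gt0 Sx Sy xy.
  by rewrite !big_ord0 mul0r addr0 mulr0 addr0 phi_e.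
have M_ge0 : 0 <= M by exact: le_trans (normr_ge0 _) (phiM x Sx).
set Z := `|u x - u y| * V x.
rewrite iterS.
have bnd z : S z -> `|iter n P phi z| <= M.
  by move=> Sz; exact: iter_markov_op_bounded phiM Sz.
have := markov_op_synchronous FS p_sum p_ge0 bnd Sx Sy.
move=> /le_trans; apply.
pose Sb := \sum_(k < n) b (r k.+1).
pose Sl := \sum_(k < n) lambda ^+ k / r k.+1.
have lam0 : 0 <= lambda by case/andP: lambda_bnd => /ltW.
have Sl_ge0 : 0 <= Sl.
  by apply: sumr_ge0 => k _; rewrite divr_ge0 ?exprn_ge0// ltW.
pose Zi i := `|u (F i x) - u (F i y)| * V (F i x).
have h1 : avg2 (p^~ x) (fun i => `|iter n P phi (F i x) - iter n P phi (F i y)|)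
    <= e + 2 * M * (Sb + Sl * (lambda * Z)).
  apply: (@le_trans _ _ (avg2 (p^~ x) (fun i => e + 2 * M * (Sb + Sl * Zi i)))).
    apply: ler_avg2; first exact: p_ge0.
    move=> i; apply: (IH (fun k => r k.+1)) => //; [exact: FS|exact: FS|].
    exact: le_trans (u_nonexp _ Sx Sy) xy.
  rewrite avg2D avg2Ml avg2D avg2Ml !(@avg2_const _ (p^~ x) _ (p_sum Sx)).
  rewrite lerD2l ler_wpM2l ?mulr_ge0// lerD2l ler_wpM2l//.
  by apply: contraction => //; exact: le_trans etae.
have h2 : `|p false x - p false y| <= b (r 0%N) + Z / r 0%N.
  apply: le_trans (p_lip Sx Sy) _.
  have Zge : `|u x - u y| <= Z by rewrite ler_peMr.
  have [h|h] := leP `|u x - u y| (r 0%N).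
    apply: (@le_trans _ _ (b (r 0%N))); first by rewrite b_mono// normr_ge0.
    by rewrite lerDl divr_ge0 ?(ltW (r_gt0 _))//; exact: le_trans Zge.
  apply: (@le_trans _ _ 1); first exact: b_le1.
  rewrite -[leLHS]add0r lerD ?b_ge0 ?(ltW (r_gt0 _))//.
  rewrite ler_pdivlMr// mul1r; lra.
apply: (le_trans (lerD h1 (ler_wpM2l _ h2))); first by rewrite mulr_ge0.
rewrite !big_ord_recl /= expr0 mul1r -/Sb.
have -> : \sum_(i < n) lambda ^+ bump 0 i / r (bump 0 i) = lambda * Sl.
  by rewrite mulr_sumr; apply: eq_bigr => k _;
    rewrite /bump/= add1n exprS mulrA.
rewrite le_eqVlt; apply/orP; left; apply/eqP.
rewrite -/Z; ring.
Qed.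

Lemma iter_markov_op_equicontinuous (phi : T -> R) (M : R) :
  (forall x, S x -> `|phi x| <= M) ->
  (forall e : R, 0 < e -> exists2 eta : R, 0 < eta &
    forall x y, S x -> S y -> `|u x - u y| <= eta -> `|phi x - phi y| <= e) ->
  forall e : R, 0 < e -> exists2 zeta : R, 0 < zeta &
    forall n x y, S x -> S y -> `|u x - u y| * V x <= zeta ->
    `|iter n P phi x - iter n P phi y| <= e.
Proof.
move=> phiM phi_uc e e_gt0.
have e2_gt0 : 0 < e / 2 by rewrite divr_gt0.
have [eta eta_gt0 phi_e] := phi_uc _ e2_gt0.
have [l0 l1] := andP lambda_bnd.
(* With [r k = r * t ^+ k] both sums are under control: the first is a Dini sum, and the terms
   [lambda ^+ k / r k = t ^+ k / r] of the second are geometric. *)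
pose t := Num.sqrt lambda.
have t_gt0 : 0 < t by rewrite sqrtr_gt0.
have tt : t ^+ 2 = lambda by rewrite sqr_sqrtr// ltW.
have t_lt1 : t < 1 by rewrite -[ltRHS]sqrtr1 ltr_sqrt.
pose M' := `|M| + 1.
have M'_gt0 : 0 < M' by rewrite ltr_wpDl.
have phiM' x : S x -> `|phi x| <= M'.
  by move=> /phiM/le_trans; apply; rewrite /M'; have := ler_norm M; lra.
pose d := e / (8 * M').
have d_gt0 : 0 < d by rewrite divr_gt0// mulr_gt0.
have [|r r_gt0 br] := @dini_tail t d _ d_gt0; first by rewrite t_gt0.
(* The last entry makes the geometric part at most [d]. With the Dini part also at most [d], the
   total is [2 * M' * (2 * d) = e / 2]. *)
pose zeta := Num.min (Num.min eta eps) (d * r * (1 - t)).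
have zeta_gt0 : 0 < zeta.
  rewrite !lt_min eta_gt0 eps_gt0 /=; apply: mulr_gt0; first exact: mulr_gt0.
  by rewrite subr_gt0.
exists zeta => // n x y Sx Sy Zle.
have xyZ : `|u x - u y| <= `|u x - u y| * V x by rewrite ler_peMr.
have := @iter_markov_op_modulus phi M' (e / 2) (Num.min eta eps) phiM'.
rewrite ge_min lexx orbT => /(_ isT).
have H : forall x y, S x -> S y -> `|u x - u y| <= Num.min eta eps ->
  `|phi x - phi y| <= e / 2.
  by move=> a c Sa Sc; rewrite le_min => /andP[h _]; exact: phi_e.
move=> /(_ H n (fun k => r * t ^+ k) x y).
have rt k : 0 < r * t ^+ k by rewrite mulr_gt0// exprn_gt0.
move=> /(_ rt Sx Sy) H1.
apply: le_trans (H1 _) _.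
  by apply: (le_trans xyZ); apply: (le_trans Zle); rewrite /zeta ge_min lexx.
have geo : \sum_(k < n) lambda ^+ k / (r * t ^+ k) <= (r * (1 - t))^-1.
  have -> : \sum_(k < n) lambda ^+ k / (r * t ^+ k) = r^-1 * \sum_(k < n) t ^+
    k.
    rewrite mulr_sumr; apply: eq_bigr => k _.
    rewrite -tt -exprM mulnC muln2 -addnn exprD; field.
    by rewrite !gt_eqF// exprn_gt0.
  rewrite invfM ler_pM2l ?invr_gt0//.
  rewrite -[leRHS]mul1r ler_pdivlMr ?subr_gt0//.
  have := subrX1 t n; have : 0 <= t ^+ n by rewrite exprn_ge0// ltW.
  lra.
have Z0 : 0 <= `|u x - u y| * V x by rewrite mulr_ge0//; exact:
  le_trans (V_ge1 x).
have h2 : (\sum_(k < n) lambda ^+ k / (r * t ^+ k)) * (`|u x - u y| * V x) <= d.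
  apply: (@le_trans _ _ ((r * (1 - t))^-1 * (d * r * (1 - t)))).
    apply: ler_pM => //.
      by apply: sumr_ge0 => k _; rewrite divr_ge0 ?exprn_ge0// ltW.
    by apply: (le_trans Zle); rewrite /zeta ge_min lexx orbT.
  rewrite -mulrA mulrCA mulVf ?mulr1// gt_eqF// mulr_gt0// subr_gt0//.
have h3 := br n.
have : 2 * M' * (2 * d) = e / 2.
  by rewrite /d; field; rewrite gt_eqF.
nra.
Qed.

End Equicontinuity.

(* far from the origin the first term of the drift is decisive, elsewhere the
   gain [N * g] of the steering move is *)
Lemma pair_drift_arith {R : realType} (lambda bb N d R0 g0 W g E : R) :
  0 <= bb -> 0 <= N -> 0 <= d -> d <= (1 - lambda) / 2 -> d * N <= 1 ->
  0 <= W -> 0 <= g -> 2 * g <= E -> lambda < 1 ->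
  (1 - lambda) * R0 = 2 * (2 * bb + 1) -> N * g0 = 2 * bb + 1 ->
  R0 <= W \/ g0 <= g ->
  lambda * W + 2 * bb + N * (1 - E) <= (1 - d) * (W + N * (1 - g)).
Proof.
move=> bb0 N0 d0 dl dN W0 g_ge0 gE l1 hR hg H.
have h1 : N * (2 * g) <= N * E by rewrite ler_wpM2l.
have h2 : 0 <= d * (N * g) by rewrite !mulr_ge0.
have h3 : (1 - lambda) / 2 * W <= (1 - d - lambda) * W by rewrite ler_wpM2r//;
  lra.
have h4 : 0 <= N * g by rewrite mulr_ge0.
have h5 : 0 <= (1 - lambda) * W by rewrite mulr_ge0//; lra.
suff h6 : 2 * bb + 1 <= (1 - lambda) / 2 * W + N * g by nra.
case: H => H.
  have : (1 - lambda) * R0 <= (1 - lambda) * W by rewrite ler_wpM2l//; lra.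
  lra.
have : N * g0 <= N * g by rewrite ler_wpM2l.
lra.
Qed.

(** * Bringing two independent chains together *)

Section Coupling.
Context {R : realType} {T : Type}.
Variables (S J : T -> Prop) (F : bool -> T -> T) (p : bool -> T -> R).
Variables (u t V : T -> R) (pm B L k1 k2 sigma eps lambda bb kV RJ : R).
Hypothesis FS : forall i x, S x -> S (F i x).
Hypothesis p_sum : forall x, S x -> p false x + p true x = 1.
Hypothesis pm_gt0 : 0 < pm.
Hypothesis p_ge : forall i x, S x -> pm <= p i x.
Hypothesis u_nonexp : forall i x y, S x -> S y ->
  `|u (F i x) - u (F i y)| <= `|u x - u y|.
Hypothesis u_step : forall i x, S x -> `|u (F i x) - u x| <= B.
Hypothesis t_ge0 : forall x, 0 <= t x.
Hypothesis k2_ge0 : 0 <= k2.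
Hypothesis t_le : forall x, t x <= k1 + k2 * `|u x|.
Hypothesis steer : forall x, S x -> ~ J x -> exists i, t (F i x) <= t x - 1.
Hypothesis J_bnd : forall x, J x -> `|u x| <= L.
Hypothesis eps_gt0 : 0 < eps.
Hypothesis sigma_gt0 : 0 < sigma.
Hypothesis J_contr : forall x, S x -> J x -> exists i, forall y, S y ->
  `|u (F i x) - u (F i y)| <=
  `|u x - u y| - sigma * Num.min `|u x - u y| eps.
Hypothesis lambda_bnd : 0 < lambda < 1.
Hypothesis V_ge1 : forall x, 1 <= V x.
Hypothesis V_drift : forall x, S x ->
  avg2 (p^~ x) (fun i => V (F i x)) <= lambda * V x + bb.
Hypothesis V_J : forall x, J x -> V x <= RJ.
Hypothesis u_le_V : forall x, `|u x| <= kV * V x.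

Local Notation P := (markov_op F p).

Let p_ge0 x : S x -> forall i, 0 <= p i x.
Proof. by move=> Sx i; apply: le_trans (p_ge i Sx); exact: ltW. Qed.

(* the potential bounds the number of synchronous moves that bring the pair to
   [`|u x - u y| * V x <= zeta] *)
Lemma pair_steering zeta : 0 < zeta -> exists2 N3 : R, 0 <= N3 &
  forall x y, S x -> S y -> zeta < `|u x - u y| * V x -> exists i,
    t (F i x) + N3 * `|u (F i x) - u (F i y)| <= t x + N3 * `|u x - u y| - 1.
Proof.
move=> zeta_gt0.
pose RJ' := Num.max RJ 1.
have RJ'_gt0 : 0 < RJ' by rewrite lt_max ltr01 orbT.
(* On [J] the bound [V <= RJ'] turns [zeta < |u x - u y| * V x] into a lower bound [zeta / RJ'] for
   the distance, so a contracting move gains at least [sigma * e2]. *)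
pose e2 := Num.min (zeta / RJ') eps.
have e2_gt0 : 0 < e2 by rewrite lt_min eps_gt0 divr_gt0.
pose T0 := Num.max (k1 + k2 * (L + B)) 0.
have T0_ge0 : 0 <= T0 by rewrite le_max lexx orbT.
(* A contracting move from [J] may raise [t], but to at most [T0]; the gain
   [N3 * (sigma * e2) = T0 + 1] in the distance term pays for that and for the required unit. *)
pose N3 := (T0 + 1) / (sigma * e2).
have se_gt0 : 0 < sigma * e2 by rewrite mulr_gt0.
have N3_ge0 : 0 <= N3 by rewrite divr_ge0// ?ltW//; lra.
exists N3 => // x y Sx Sy h.
have [Jx|Jx] := pselect (J x); last first.
  have [i hi] := steer Sx Jx; exists i.
  have := ler_wpM2l N3_ge0 (u_nonexp i Sx Sy); lra.
have [i /(_ y Sy) hi] := J_contr Sx Jx; exists i.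
have hti : t (F i x) <= T0.
  apply: le_trans (t_le _) _; rewrite /T0 le_max; apply/orP; left.
  rewrite lerD2l ler_wpM2l//.
  have := u_step i Sx; have := lerB_dist (u (F i x)) (u x); have := J_bnd Jx;
    lra.
have he2 : e2 <= Num.min `|u x - u y| eps.
  rewrite le_min; apply/andP; split; last by rewrite ge_min lexx orbT.
  rewrite ge_min ler_pdivrMr//; apply/orP; left; apply: le_trans (ltW h) _.
  by rewrite ler_wpM2l// (le_trans (V_J Jx))// le_max lexx.
have hs : `|u (F i x) - u (F i y)| <= `|u x - u y| - sigma * e2.
  by apply: le_trans hi _; rewrite lerB// ler_pM2l.
have := ler_wpM2l N3_ge0 hs.
have : N3 * (sigma * e2) = T0 + 1 by rewrite /N3 divfK// gt_eqF.
have := t_ge0 x; nra.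
Qed.

(** The chains run independently until the pair is close, when [phi_close] takes over for all
    remaining times. Until then [Psi] decreases in mean by the factor [1 - d], and since [Psi >= 1],
    the probability of not having met yet is at most [(1 - d) ^+ n * Psi x y]. *)
Lemma coupling_decay (phi : T -> R) (M e zeta : R) :
  (forall x, S x -> `|phi x| <= M) -> 0 <= e -> 0 < zeta ->
  (forall n x y, S x -> S y -> `|u x - u y| * V x <= zeta ->
    `|iter n P phi x - iter n P phi y| <= e) ->
  exists l N : R, [/\ 0 <= l < 1, 0 <= N & forall n x y, S x -> S y ->
    `|iter n P phi x - iter n P phi y| <=
      e + 2 * M * l ^+ n * (V x + V y + N)].
Proof.
move=> phiM e_ge0 zeta_gt0 phi_close.
have [N3 N3_ge0 steer2] := pair_steering zeta_gt0.
have [[x1 Sx1]|noS] := pselect (exists x, S x); last first.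
  exists 0, 0; split; [by rewrite lexx ltr01|by []|move=> n x y Sx].
  by exfalso; apply: noS; exists x.
have M_ge0 : 0 <= M by exact: le_trans (normr_ge0 _) (phiM x1 Sx1).
have pm2 : pm <= 1.
  have := p_ge true Sx1; have := p_ge false Sx1; have := p_sum Sx1; lra.
have kV_ge0 : 0 <= kV.
  have := u_le_V x1; have := V_ge1 x1; have := normr_ge0 (u x1); nra.
have [l0 l1] := andP lambda_bnd.
pose bb' := Num.max bb 0.
have bb'_ge0 : 0 <= bb' by rewrite le_max lexx orbT.
have bb'_ge : bb <= bb' by rewrite le_max lexx.
pose G x y := t x + N3 * `|u x - u y|.
have G_ge0 x y : 0 <= G x y by rewrite addr_ge0// mulr_ge0.
(* Two independent choices agree with the prescribed move with probability at least [pm ^+ 2]. *)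
pose K := ln (2 / pm ^+ 2).
have pm2_gt0 : 0 < pm ^+ 2 by rewrite exprn_gt0.
have pm2_le1 : pm ^+ 2 <= 1 by rewrite exprn_ile1// ltW.
have K_gt0 : 0 < K by rewrite ln_gt0// ltr_pdivlMr//; lra.
have eK : pm ^+ 2 * expR K = 2.
  by rewrite lnK ?posrE ?divr_gt0// mulrCA divff ?mulr1 ?gt_eqF.
(* Either [V x + V y >= R0] and its own drift suffices, or [G x y <= k3], so that
   [expR (- (K * G x y)) >= g0] and the gain [N * g0] does. *)
pose R0 := 2 * (2 * bb' + 1) / (1 - lambda).
pose k3 := k1 + (k2 + N3) * kV * R0.
pose g0 := expR (- (K * k3)).
have g0_gt0 : 0 < g0 by exact: expR_gt0.
pose N := (2 * bb' + 1) / g0.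
have N_ge0 : 0 <= N by rewrite divr_ge0 ?ltW//; lra.
pose Psi x y := V x + V y + N * (1 - expR (- (K * G x y))).
have V_ge0 x : 0 <= V x by exact: le_trans (V_ge1 x).
have eG1 x y : expR (- (K * G x y)) <= 1.
  by rewrite expR_le1 oppr_le0 mulr_ge0// ltW.
have Psi_ge1 x y : 1 <= Psi x y.
  rewrite /Psi -addrA (le_trans (V_ge1 x))// lerDl addr_ge0// mulr_ge0//
    subr_ge0.
  exact: eG1.
(* The two entries are the conditions [d <= (1 - lambda) / 2] and [d * N <= 1] of
   [pair_drift_arith]. *)
pose d := Num.min ((1 - lambda) / 2) (1 / (N + 1)).
have d_gt0 : 0 < d by rewrite lt_min !divr_gt0//; lra.
have d_le1 : d <= (1 - lambda) / 2 by rewrite ge_min lexx.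
have dN : d * N <= 1.
  have N1 : 0 < N + 1 by rewrite ltr_wpDl.
  have : d <= 1 / (N + 1) by rewrite ge_min lexx orbT.
  by rewrite ler_pdivlMr// mulrDr mulr1; apply: le_trans; rewrite lerDl ltW.
have Psi_drift x y : S x -> S y -> zeta < `|u x - u y| * V x ->
    avg2 (p^~ x) (fun i => avg2 (p^~ y) (fun j => Psi (F i x) (F j y)))
    <= (1 - d) * Psi x y.
  move=> Sx Sy h; have [i hi] := steer2 x y Sx Sy h.
  pose E k j := expR (- (K * G (F k x) (F j y))).
  have E_ge0 k j : 0 <= E k j by exact: expR_ge0.
  have E_ge : 2 * expR (- (K * G x y)) <=
      avg2 (p^~ x) (fun k => avg2 (p^~ y) (E k)).
    apply: (@le_trans _ _ (p i x * avg2 (p^~ y) (E i))); last first.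
      apply: (@avg2_ge_term _ (p^~ x) (fun k =>
        avg2 (p^~ y) (E k)) i (p_ge0 Sx)).
      by move=> k; rewrite /avg2 addr_ge0 ?mulr_ge0 ?p_ge0.
    have h1 := @avg2_ge_term _ (p^~ y) (E i) i (p_ge0 Sy) (E_ge0 i).
    apply: le_trans (ler_wpM2l (p_ge0 Sx i) h1).
    have h2 : expR K * expR (- (K * G x y)) <= E i i.
      by rewrite -expRD ler_expR; move: hi; rewrite -/(G _ _) -/(G _ _); nra.
    rewrite -eK -mulrA (mulrA (p i x)); apply: ler_pM => //; first exact: ltW.
    by rewrite expr2; apply: ler_pM (p_ge i Sx) (p_ge i Sy); exact: ltW.
  have -> : avg2 (p^~ x) (fun i => avg2 (p^~ y) (fun j =>
    Psi (F i x) (F j y))) =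
      avg2 (p^~ x) (fun i => V (F i x)) + avg2 (p^~ y) (fun i => V (F i y)) +
      N * (1 - avg2 (p^~ x) (fun k => avg2 (p^~ y) (E k))).
    have hx : p true x = 1 - p false x by rewrite -(p_sum Sx); ring.
    have hy : p true y = 1 - p false y by rewrite -(p_sum Sy); ring.
    rewrite /avg2 /Psi /E hx hy; ring.
  have hVx := V_drift Sx; have hVy := V_drift Sy.
  set EE := avg2 _ _ in E_ge *.
  apply: (@le_trans _ _ (lambda * (V x + V y) + 2 * bb' + N * (1 - EE))).
    rewrite lerD2r; apply: le_trans (lerD hVx hVy) _.
    by rewrite addrACA mulrDr lerD2l mulr_natl mulr2n lerD.
  apply: (@pair_drift_arith _ lambda bb' N d R0 g0) => //.
  - exact: ltW.
  - by rewrite addr_ge0.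
  - by rewrite /R0 mulrCA divff ?mulr1// gt_eqF// subr_gt0.
  - by rewrite /N divfK// gt_eqF.
  have [hR|hR] := leP R0 (V x + V y); [by left|right].
  rewrite ler_expR lerN2 ler_pM2l//.
  have Vx : `|u x| <= kV * R0.
    apply: le_trans (u_le_V x) _; rewrite ler_wpM2l//.
    by apply: le_trans (ltW hR); rewrite lerDl.
  have h1 : `|u x - u y| <= kV * R0.
    apply: le_trans (ler_normB _ _) _.
    apply: le_trans (lerD (u_le_V x) (u_le_V y)) _.
    by rewrite -mulrDr ler_wpM2l// ltW.
  rewrite /G /k3 mulrDl mulrDl addrA lerD//; last by rewrite -mulrA ler_wpM2l.
  by apply: le_trans (t_le x) _; rewrite lerD2l -mulrA ler_wpM2l.
have decay n x y : S x -> S y -> `|iter n P phi x - iter n P phi y| <=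
    e + 2 * M * (1 - d) ^+ n * Psi x y.
  elim: n x y => [|n IH] x y Sx Sy.
    rewrite expr0 mulr1 (le_trans (ler_normB _ _))//.
    have := phiM x Sx; have := phiM y Sy; have := Psi_ge1 x y; nra.
  have dn_ge0 k : 0 <= (1 - d) ^+ k by rewrite exprn_ge0//; lra.
  have [h|h] := leP (`|u x - u y| * V x) zeta.
    apply: le_trans (phi_close n.+1 x y Sx Sy h) _.
    by rewrite lerDl; apply: mulr_ge0; [by rewrite !mulr_ge0 ?dn_ge0|exact:
      le_trans (Psi_ge1 x y)].
  rewrite iterS.
  have := @markov_op_independent _ _ S F p p_sum p_ge0 (iter n P phi) x y Sx Sy.
  move=> /le_trans; apply.
  apply: (@le_trans _ _ (avg2 (p^~ x) (fun i => avg2 (p^~ y) (fun j =>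
      e + 2 * M * (1 - d) ^+ n * Psi (F i x) (F j y))))).
    apply: ler_avg2; first exact: p_ge0.
    move=> i; apply: ler_avg2; first exact: p_ge0.
    by move=> j; apply: IH; exact: FS.
  have -> : avg2 (p^~ x) (fun i => avg2 (p^~ y) (fun j =>
      e + 2 * M * (1 - d) ^+ n * Psi (F i x) (F j y))) =
    e + 2 * M * (1 - d) ^+ n *
    avg2 (p^~ x) (fun i => avg2 (p^~ y) (fun j => Psi (F i x) (F j y))).
    have hx : p true x = 1 - p false x by rewrite -(p_sum Sx); ring.
    have hy : p true y = 1 - p false y by rewrite -(p_sum Sy); ring.
    rewrite /avg2 hx hy; ring.
  rewrite lerD2l exprSr -!mulrA; do 2?[rewrite ler_wpM2l//].
  by rewrite ler_wpM2l// Psi_drift.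
exists (1 - d), N; split => //; first by apply/andP; split; lra.
move=> n x y Sx Sy; apply: le_trans (decay n x y Sx Sy) _.
rewrite lerD2l ler_wpM2l//.
  by rewrite !mulr_ge0 ?exprn_ge0//; lra.
rewrite /Psi lerD2l; have := expR_gt0 (- (K * G x y)); nra.
Qed.

End Coupling.

(** * The two maps in the logarithmic coordinate *)

Section Logcoord.
Context {R : realType}.
Implicit Types x y z : R.

Lemma lnB_le x y : 0 < x -> 0 < y -> ln y - ln x <= (y - x) / x.
Proof.
move=> x0 y0; rewrite -ln_div ?posrE//.
have -> : y / x = 1 + (y - x) / x by field; lra.
apply: le_ln1Dx; rewrite ltr_pdivlMr //; lra.
Qed.

Lemma lnB_ge x y : 0 < x -> 0 < y -> (y - x) / y <= ln y - ln x.
Proof.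
move=> x0 y0; have := lnB_le y0 x0.
rewrite -(opprB y x) mulNr; lra.
Qed.

(* primitive of [1 / min z (1 - z)] vanishing at [1/2] *)
Definition logcoord z := if z <= 2^-1 then ln (2 * z) else - ln (2 * (1 - z)).

Lemma logcoord_left z : z <= 2^-1 -> logcoord z = ln (2 * z).
Proof. by rewrite /logcoord => ->. Qed.

Lemma logcoord_right z : 2^-1 <= z -> logcoord z = - ln (2 * (1 - z)).
Proof.
rewrite /logcoord => h; case: ifPn => // h'.
have -> : z = 2^-1 by lra.
have -> : 2 * (1 - 2^-1) = 2 * 2^-1 :> R by lra.
by rewrite divff ?ln1 ?oppr0.
Qed.

Lemma logcoord_half : logcoord 2^-1 = 0.
Proof. by rewrite logcoord_left// divff ?ln1. Qed.

Lemma logcoord_mirror z : logcoord (1 - z) = - logcoord z.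
Proof.
have [h|h] := leP z 2^-1.
  rewrite logcoord_right; last by lra.
  by rewrite logcoord_left // opprB addrC subrK.
rewrite logcoord_left; last by lra.
by rewrite logcoord_right ?opprK//; lra.
Qed.

Lemma lnM2 z : 0 < z -> ln (2 * z) = ln 2 + ln z.
Proof. by move=> z0; rewrite lnM// posrE. Qed.

(** The derivative [1 / min z (1 - z)] is at least 1. Both the monotonicity of [logcoord] and the
    comparison of the Euclidean distance with the logarithmic one rest on this inequality. *)
Lemma logcoord_sub x y : 0 < x -> x <= y -> y < 1 ->
  y - x <= logcoord y - logcoord x.
Proof.
have L a b : 0 < a -> a <= b -> b <= 2^-1 -> b - a <= logcoord b - logcoord a.
  move=> a0 ab b2; rewrite !logcoord_left; [|lra..].
  rewrite !lnM2; [|lra..].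
  have b0 : 0 < b by lra.
  have := lnB_ge a0 b0.
  have : b - a <= (b - a) / b by rewrite ler_pdivlMr//; nra.
  lra.
have Rt a b : 2^-1 <= a -> a <= b -> b < 1 -> b - a <= logcoord b - logcoord a.
  move=> a0 ab b1.
  have := L (1 - b) (1 - a); rewrite !logcoord_mirror => /(_ _ _ _); lra.
move=> x0 xy y1.
have [h|h] := leP y 2^-1; first exact: L.
have [h'|h'] := leP 2^-1 x; first exact: Rt.
have := L x 2^-1; have := Rt 2^-1 y; lra.
Qed.

Lemma logcoord_mono x y : 0 < x -> y < 1 -> x <= y -> logcoord x <= logcoord y.
Proof. by move=> x0 y1 xy; have := logcoord_sub x0 xy y1; lra. Qed.

(** Comparison through the value at [m]. The upper bound [M] lets the lemma be nested over the break
    points 1/2, [mid] and [x0]. *)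
Lemma nondecreasing_glue (h : R -> R) (m M : R) : 0 < m -> m < 1 ->
  (forall x y, 0 < x -> x <= y -> y <= m -> y < 1 -> h x <= h y) ->
  (forall x y, m <= x -> 0 < x -> x <= y -> y <= M -> y < 1 -> h x <= h y) ->
  forall x y, 0 < x -> x <= y -> y <= M -> y < 1 -> h x <= h y.
Proof.
move=> m0 m1 H1 H2 x y x0 xy yM y1.
have [ym|/ltW my] := leP y m; first exact: H1.
have [mx|/ltW xm] := leP m x; first exact: H2.
by apply: (@le_trans _ _ (h m)); [exact: H1|exact: H2].
Qed.

Lemma lerB_exchange (a b x y : R) : (b - a <= y - x) = (x - a <= y - b).
Proof. by apply/idP/idP; lra. Qed.

End Logcoord.

Section Maps.
Context {R : realType}.
Variables x0 y0 : R.
Hypothesis hA1 : condA1 x0 y0.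
Implicit Types x y z : R.

Local Notation a0 := (a0 x0 y0).
Local Notation a1 := (a1 x0 y0).
Local Notation f0 := (f0 x0 y0).
Local Notation f1 := (f1 x0 y0).
Local Notation lc := logcoord.

Let hx : 2^-1 < x0. Proof. by case: hA1 => /andP[]. Qed.
Let hx1 : x0 < 1. Proof. by case: hA1 => /andP[]. Qed.
Let hy : 2^-1 <= y0. Proof. by case: hA1 => _ /andP[]. Qed.
Let hyx : y0 < x0. Proof. by case: hA1 => _ /andP[]. Qed.

Let hx0 : 0 < x0. Proof. by apply: lt_trans hx; lra. Qed.
Let a0x0 : a0 * x0 = y0. Proof. by rewrite /Defs.a0 divfK// gt_eqF. Qed.
Let a1x0 : a1 * (1 - x0) = 1 - y0.
Proof. by rewrite /Defs.a1 divfK// gt_eqF// subr_gt0. Qed.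
Let a0_gt0 : 0 < a0.
Proof. by rewrite divr_gt0//; apply: lt_le_trans hy; lra. Qed.
Let a0_lt1 : a0 < 1. Proof. by rewrite /Defs.a0 ltr_pdivrMr ?mul1r. Qed.
Let a1_gt1 : 1 < a1.
Proof. by rewrite /Defs.a1 ltr_pdivlMr; have := hyx; have := hx1; lra. Qed.

(* the preimage of [1/2] under [f0] *)
Definition mid : R := (2 * a0)^-1.
Local Notation c := mid.

Let a0c : a0 * c = 2^-1.
Proof. by rewrite /c invfM mulrCA divff ?mulr1// gt_eqF. Qed.
Let c_gt : 2^-1 < c.
Proof. by have := a0c; have := a0_gt0; have := a0_lt1; nra. Qed.
Let c_le : c <= x0.
Proof. by have := a0c; have := a0x0; have := a0_gt0; have := hy; nra. Qed.

Let bounds_xy : [/\ 2^-1 < x0, x0 < 1, 2^-1 <= y0 & y0 < x0]. Proof. by []. Qed.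
Let bounds_a : [/\ a0 * x0 = y0, a1 * (1 - x0) = 1 - y0, 0 < a0,
  a0 < 1 & 1 < a1].
Proof. by []. Qed.

Let bounds_c : [/\ a0 * c = 2^-1, 2^-1 < c & c <= x0]. Proof. by []. Qed.

Ltac bounds := have [? ? ? ?] := bounds_xy; have [? ? ? ? ?] := bounds_a;
  have [? ? ?] := bounds_c.
Ltac mlra := bounds; lra.
Ltac mnra := bounds; nra.

Lemma f0_leE z : z <= x0 -> f0 z = a0 * z.
Proof. by rewrite /Defs.f0 => ->. Qed.

Lemma f0_geE z : x0 <= z -> f0 z = 1 - a1 * (1 - z).
Proof.
rewrite /Defs.f0; case: ifPn => h h'; last by ring.
have -> : z = x0 by mlra.
by rewrite a0x0 a1x0; ring.
Qed.

Lemma f0_mono x y : x <= y -> f0 x <= f0 y.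
Proof.
move=> xy.
have [h|h] := leP y x0; first by rewrite !f0_leE; mnra.
have [h'|h'] := leP x0 x; first by rewrite !f0_geE; mnra.
by rewrite f0_leE ?f0_geE; mnra.
Qed.

Lemma f0_gt0 x : 0 < x -> 0 < f0 x.
Proof.
move=> h; have [h'|h'] := leP x x0; first by rewrite f0_leE; mnra.
have := f0_mono (ltW h'); rewrite (f0_leE (lexx x0)) a0x0; mlra.
Qed.

Lemma f0_lt1 x : x < 1 -> f0 x < 1.
Proof.
move=> h; have [h'|h'] := leP x0 x; first by rewrite f0_geE; mnra.
have := f0_mono (ltW h'); rewrite (f0_leE (lexx x0)) a0x0; mnra.
Qed.

Lemma mid_gt_half : 2^-1 < mid. Proof. exact: c_gt. Qed.
Lemma mid_lt1 : mid < 1. Proof. exact: le_lt_trans c_le hx1. Qed.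

Local Notation A := (- ln a0).
Local Notation B := (ln a1).

Lemma lc_f0_left z : 0 < z -> z <= 2^-1 -> lc (f0 z) = lc z - A.
Proof.
move=> z0 z2; rewrite f0_leE; last mlra.
rewrite !logcoord_left; [|mnra..].
rewrite mulrCA (@lnM _ a0) ?posrE; [mlra|mlra|mnra].
Qed.

Lemma lc_f0_right z : z < 1 -> x0 <= z -> lc (f0 z) = lc z - B.
Proof.
move=> z1 zx; rewrite f0_geE//.
rewrite !logcoord_right; [|mnra..].
rewrite opprB addrCA subrr addr0.
rewrite mulrCA (@lnM _ a1) ?posrE; [mlra|mlra|mnra].
Qed.

(** On [1/2, [mid]] the points lie in the right half and their images in the left one. So [lc] has
    derivative [1 / (1 - z)] there and [lc (f0 z)] has derivative [1 / z]; the quotient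
    [(1 - z) / z] is largest at the left end [x]. *)
Lemma lc_f0_contract s x y : 0 <= s -> 2^-1 <= x -> x <= y -> y <= c ->
  1 - x <= s * x -> lc (f0 y) - lc (f0 x) <= s * (lc y - lc x).
Proof.
move=> s0 x2 xy yc hs.
have half_gt0 : 0 < 2^-1 :> R by rewrite invr_gt0.
have x_gt0 : 0 < x by exact: lt_le_trans x2.
have y_gt0 : 0 < y by exact: lt_le_trans xy.
have y1_gt0 : 0 < 1 - y by rewrite subr_gt0 (le_lt_trans yc)// (le_lt_trans
  c_le).
have x1_gt0 : 0 < 1 - x by apply: lt_le_trans y1_gt0 _; rewrite lerB.
have ay : a0 * y <= 2^-1 by rewrite -a0c ler_pM2l.
have ax : a0 * x <= 2^-1 by apply: le_trans ay; rewrite ler_pM2l.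
have yx0 : y <= x0 by exact: le_trans c_le.
rewrite (f0_leE (le_trans xy yx0)) (f0_leE yx0).
rewrite (logcoord_left ax) (logcoord_left ay).
rewrite (logcoord_right x2) (logcoord_right (le_trans x2 xy)).
have lna z : 0 < z -> ln (2 * (a0 * z)) = ln a0 + ln (2 * z).
  by move=> z0; rewrite mulrCA (@lnM _ a0) ?posrE ?a0_gt0 ?pmulr_rgt0.
rewrite !lna// (lnM2 x_gt0) (lnM2 y_gt0) (lnM2 x1_gt0) (lnM2 y1_gt0).
have h1 := lnB_le x_gt0 y_gt0.
have h2 := lnB_ge y1_gt0 x1_gt0.
have h3 : (y - x) / x <= s * ((1 - x - (1 - y)) / (1 - x)).
  have -> : 1 - x - (1 - y) = y - x by ring.
  rewrite mulrA ler_pdivrMr// mulrAC ler_pdivlMr//.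
  have : 0 <= y - x by rewrite subr_ge0.
  by move: hs; nra.
by move: (ler_wpM2l s0 h2) h1 h3; lra.
Qed.

(** Here points and images are all in the right half: the derivatives to compare are
    [a0 / (1 - a0 * z)] and [1 / (1 - z)], and the first is smaller as [a0 < 1]. *)
Lemma lc_f0_nonexp_aux x y : c <= x -> x <= y -> y <= x0 ->
  lc (f0 y) - lc (f0 x) <= lc y - lc x.
Proof.
move=> cx xy yx.
have half_gt0 : 0 < 2^-1 :> R by rewrite invr_gt0.
have y1_gt0 : 0 < 1 - y by rewrite subr_gt0 (le_lt_trans yx).
have x1_gt0 : 0 < 1 - x by apply: lt_le_trans y1_gt0 _; rewrite lerB.
have cy := le_trans cx xy.
have ax : 2^-1 <= a0 * x by rewrite -a0c ler_pM2l.
have ay : 2^-1 <= a0 * y by rewrite -a0c ler_pM2l.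
have h z : c <= z -> 0 < 1 - z -> 0 < 1 - a0 * z.
  rewrite !subr_gt0 => cz z1;
    rewrite (le_lt_trans _ z1)// ler_piMl ?(ltW a0_lt1)//.
  by rewrite (le_trans _ cz)// (le_trans (ltW half_gt0))// ltW.
have ax1 := h x cx x1_gt0; have ay1 := h y cy y1_gt0.
rewrite (f0_leE (le_trans xy yx)) (f0_leE yx).
rewrite (logcoord_right ax) (logcoord_right ay).
rewrite (logcoord_right (le_trans (ltW c_gt) cx)) (logcoord_right (le_trans
  (ltW c_gt) cy)).
rewrite (lnM2 ax1) (lnM2 ay1) (lnM2 x1_gt0) (lnM2 y1_gt0).
have : ln (1 - a0 * x) + ln (1 - y) <= ln (1 - x) + ln (1 - a0 * y).
  rewrite -!lnM ?posrE// ler_ln ?posrE ?mulr_gt0//.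
  by move: xy (ltW a0_lt1); nra.
by lra.
Qed.

(** Equivalently, the displacement [lc z - lc (f0 z)] is nondecreasing. It is constant up to 1/2 and
    from [x0] on, and the two lemmas above treat [1/2, [mid]] and [[mid], [x0]]. The order
    [mid <= x0] comes from [y0 >= 1/2]. *)
Lemma lc_f0_nonexp x y : 0 < x -> x <= y -> y < 1 ->
  lc (f0 y) - lc (f0 x) <= lc y - lc x.
Proof.
move=> x_gt0 xy y1; rewrite lerB_exchange.
pose h z := lc z - lc (f0 z).
have half_gt0 : 0 < 2^-1 :> R by rewrite invr_gt0.
have half_lt1 : 2^-1 < 1 :> R by rewrite invf_lt1// ltr1n.
have c_gt0 : 0 < c by exact: lt_trans c_gt.
have x0_gt0 : 0 < x0 by exact: lt_le_trans c_le.
have c_lt1 : c < 1 by exact: mid_lt1.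
suff : forall a b, 0 < a -> a <= b -> b <= 1 -> b < 1 -> h a <= h b.
  by move=> /(_ x y x_gt0 xy (ltW y1) y1).
apply: (@nondecreasing_glue _ h x0 1) => //; last first.
  move=> a b xa a_gt0 ab _ b1; rewrite /h !lc_f0_right ?subKr//.
  - exact: le_trans ab.
  - exact: le_lt_trans b1.
apply: (@nondecreasing_glue _ h c x0) => //; last first.
  by move=> a b ca a_gt0 ab bx _; rewrite /h -lerB_exchange; exact:
    lc_f0_nonexp_aux.
apply: (@nondecreasing_glue _ h 2^-1 c) => //; last first.
  move=> a b a2 a_gt0 ab bc _; rewrite /h -lerB_exchange -[leRHS]mul1r.
  by apply: lc_f0_contract => //; rewrite mul1r; move: a2; lra.
move=> a b a_gt0 ab b2 _; rewrite /h !lc_f0_left ?subKr//.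
- exact: lt_le_trans ab.
- exact: le_trans b2.
Qed.

Lemma lc_f0_mono x y : 0 < x -> x <= y -> y < 1 -> lc (f0 x) <= lc (f0 y).
Proof.
move=> x_gt0 xy y1; apply: logcoord_mono; last exact: f0_mono.
- exact: f0_gt0.
- exact: f0_lt1.
Qed.

Lemma lc_f0_mid : lc (f0 c) = 0.
Proof. by rewrite f0_leE// a0c logcoord_half. Qed.

Lemma A_gt0 : 0 < A.
Proof. by rewrite oppr_gt0; apply: ln_lt0; rewrite a0_gt0. Qed.

(** In the coordinate, [f0] maps the interval from 0 to [lc c] onto the one from [- A] to 0. It
    shortens it strictly: the factor is 1 at the point 1/2, but less than 1 to the right of the
    midpoint [m]. This strictness is what leaves room for a window. *)
Lemma A_lt_mid : A < lc c.
Proof.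
have h : 2^-1 <= (2^-1 + c) / 2 by mlra.
set m := (2^-1 + c) / 2 in h *.
have mc : m < c by rewrite /m; mlra.
have m2 : 2^-1 < m by rewrite /m; mlra.
have := @lc_f0_contract ((1 - m) / m) m c.
rewrite divfK; last by rewrite gt_eqF; mlra.
have := mid_lt1 => ?.
have s0 : 0 <= (1 - m) / m by apply: divr_ge0; mlra.
have s1 : (1 - m) / m < 1 by rewrite ltr_pdivrMr; mlra.
move=> /(_ s0 h (ltW mc) (lexx _) (lexx _)) h1.
have m_gt0 : m > 0 by mlra.
have h2 : lc m < lc c by have := @logcoord_sub _ m c; mlra.
have h3 : (1 - m) / m * (lc c - lc m) < lc c - lc m by rewrite gtr_pMl//
  subr_gt0.
have := @lc_f0_nonexp 2^-1 m; rewrite (@lc_f0_left 2^-1)//.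
move: h1; rewrite lc_f0_mid logcoord_half; mlra.
Qed.

(** The nondecreasing displacement [lc z - lc (f0 z)] starts with the value [A] and ends with the
    value [B]. *)
Lemma lc_f0_bounds z : 0 < z -> z < 1 -> lc z - B <= lc (f0 z) <= lc z - A.
Proof.
move=> z0 z1; apply/andP; split.
- have [h|h] := leP x0 z; first by rewrite lc_f0_right.
  have := @lc_f0_nonexp z x0; rewrite (@lc_f0_right x0)//; mlra.
- have [h|h] := leP z 2^-1; first by rewrite lc_f0_left.
  have := @lc_f0_nonexp 2^-1 z; rewrite (@lc_f0_left 2^-1)//; mlra.
Qed.

End Maps.

(** * Steering into the window and contraction there *)

Section Steering.
Context {R : realType}.
Variables x0 y0 : R.
Hypothesis hA1 : condA1 x0 y0.

Local Notation lc := logcoord.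
Local Notation A := (- ln (a0 x0 y0)).
Local Notation B := (ln (a1 x0 y0)).
Local Notation c := (mid x0 y0).
Local Notation S := (fun z : R => 0 < z < 1).

Definition branch (i : bool) : R -> R := if i then f1 x0 y0 else f0 x0 y0.

Lemma mirror_in (z : R) : S z -> S (1 - z).
Proof. by move=> /andP[z0 z1]; apply/andP; split; lra. Qed.

Lemma branch_true z : branch true z = 1 - branch false (1 - z).
Proof. by []. Qed.

Lemma lc_branch_true z : lc (branch true z) = - lc (branch false (1 - z)).
Proof. by rewrite branch_true logcoord_mirror. Qed.

Lemma branch_in i z : S z -> S (branch i z).
Proof.
have h w : S w -> S (branch false w).
  move=> /andP[w0 w1]; apply/andP; split; [exact: f0_gt0|exact: f0_lt1].
by case: i => [/mirror_in/h/mirror_in|/h].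
Qed.

Lemma lc_lt_inv z w : S z -> S w -> lc z < lc w -> z < w.
Proof.
move=> /andP[z0 z1] /andP[w0 w1]; rewrite ltNge => h; rewrite ltNge.
by apply: contra h => h; exact: logcoord_mono.
Qed.

Lemma norm_lc_sub z w : S z -> S w -> `|z - w| <= `|lc z - lc w|.
Proof.
move=> /andP[z0 z1] /andP[w0 w1].
have H a b : 0 < a -> b < 1 -> a <= b -> `|a - b| <= `|lc a - lc b|.
  move=> a0 b1 ab; have := logcoord_sub a0 ab b1.
  by rewrite !(distrC _ b) !(distrC _ (lc b)) => h; rewrite !ger0_norm//; lra.
have [h|h] := leP z w; first exact: H.
by rewrite distrC (distrC (lc z)); apply: H => //; exact: ltW.
Qed.

Lemma lc_branch_nonexp i z w : S z -> S w ->
  `|lc (branch i z) - lc (branch i w)| <= `|lc z - lc w|.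
Proof.
have H a b : S a -> S b -> a <= b ->
    `|lc (branch false a) - lc (branch false b)| <= `|lc a - lc b|.
  move=> /andP[a0 a1] /andP[b0 b1] ab.
  rewrite distrC (distrC (lc a)) !ger0_norm ?subr_ge0//.
  - exact: lc_f0_nonexp.
  - exact: logcoord_mono.
  - exact: lc_f0_mono.
have H0 a b : S a -> S b ->
    `|lc (branch false a) - lc (branch false b)| <= `|lc a - lc b|.
  move=> Sa Sb; have [ab|ab] := leP a b; first exact: H.
  by rewrite distrC (distrC (lc a)); apply: H => //; exact: ltW.
move=> Sz Sw; case: i; last exact: H0.
rewrite !lc_branch_true.
have := H0 _ _ (mirror_in Sz) (mirror_in Sw).
by rewrite !logcoord_mirror -!opprD !normrN.
Qed.

Lemma lc_branch_step i z : S z -> `|lc (branch i z) - lc z| <= B.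
Proof.
have H a : S a -> `|lc (branch false a) - lc a| <= B.
  move=> /andP[a0 a1]; have /andP[h1 h2] := lc_f0_bounds hA1 a0 a1.
  have := A_gt0 hA1; rewrite /branch => h3.
  rewrite distrC ger0_norm; lra.
move=> Sz; case: i; last exact: H.
have := H _ (mirror_in Sz).
by rewrite lc_branch_true logcoord_mirror -opprD normrN opprK addrC.
Qed.

(** So small that a point with coordinate in [0, 2e[ is sent by [f0] to a coordinate in
    [-A, -A + 2e], whose absolute value lies between 2e and [lc c - 2e]. *)
Definition step_eps : R := Num.min A (lc c - A) / 5.
Local Notation e := step_eps.

Lemma step_eps_bounds : [/\ 0 < e, 5 * e <= A & 5 * e <= lc c - A].
Proof.
have := A_gt0 hA1; have := A_lt_mid hA1 => h1 h2; rewrite /step_eps; split.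
- by rewrite divr_gt0// lt_min h2 subr_gt0.
- by rewrite mulrC divfK// ge_min lexx.
- by rewrite mulrC divfK// ge_min lexx orbT.
Qed.

(** It keeps away from 0, where the contraction factor tends to 1, and from [lc c], where the
    stretch on which [f0] contracts ends. *)
Definition window (z : R) : bool := 2 * e <= `|lc z| < lc c - 2 * e.

(** In the outer region a good move lowers [|lc z|] by at least [A], hence the quotient by 1; from
    near 0 one move is enough. The summand 3 covers the passage from the outer region to the other
    two cases. *)
Definition steps_to_window (z : R) : R :=
  if lc c - 2 * e <= `|lc z| then `|lc z| / A + 3
  else if `|lc z| < 2 * e then 1 else 0.
Local Notation t := steps_to_window.

Lemma steps_to_window_ge0 z : 0 <= t z.
Proof.
have A0 := A_gt0 hA1; rewrite /t; case: ifP => _; last by case: ifP.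
by rewrite addr_ge0// divr_ge0// ltW.
Qed.

Lemma steps_to_window_le z : t z <= 3 + A^-1 * `|lc z|.
Proof.
have A0 := A_gt0 hA1; rewrite /t mulrC.
have : 0 <= `|lc z| / A by rewrite divr_ge0// ltW.
by move=> ?; case: ifP => _; [lra|case: ifP => _; lra].
Qed.

Lemma steps_to_window_mirror z : t (1 - z) = t z.
Proof. by rewrite /t logcoord_mirror normrN. Qed.

Lemma window_mirror z : window (1 - z) = window z.
Proof. by rewrite /window logcoord_mirror normrN. Qed.

Lemma half_in : S 2^-1. Proof. by apply/andP; split; lra. Qed.
Lemma mid_in : S c.
Proof.
by have := mid_lt1 hA1; have := mid_gt_half hA1; move=> *; apply/andP; split;
  lra.
Qed.

(** Near 0, [f0] jumps by about [- A] into the left half of the window. Far out it lowers [lc] by at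
    least [A], and it cannot overshoot below [- 2e], because [f0] sends [mid] to coordinate 0 and
    does not expand. *)
Lemma steer_right z : S z -> 0 <= lc z -> ~~ window z ->
  t (branch false z) <= t z - 1.
Proof.
have [e0 eA ec] := step_eps_bounds; have A0 := A_gt0 hA1.
move=> Sz lz; have [z0 z1] := andP Sz.
have /andP[b1 b2] := lc_f0_bounds hA1 z0 z1.
have [m0 m1] := andP mid_in.
rewrite -/(branch false z) in b1 b2.
rewrite /window negb_and -ltNge -leNgt => /orP[hs|hs].
  rewrite (ger0_norm lz) in hs.
  have h2 : lc (branch false z) <= - A + 2 * e /\ - A <= lc (branch false z).
    have z2 : 2^-1 <= z.
      rewrite leNgt; apply/negP => h.
      have := logcoord_sub z0 (ltW h); rewrite logcoord_half; lra.
    have := lc_f0_nonexp hA1 _ z2 z1; have := lc_f0_mono hA1 _ z2 z1.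
    rewrite (lc_f0_left hA1)// logcoord_half -/(branch false z) => h3 h4.
    have := h3 _; have := h4 _; lra.
  have h3 : `|lc (branch false z)| = - lc (branch false z).
    by rewrite ler0_norm//; lra.
  rewrite {2}/t (ger0_norm lz) ifF ?hs; last by lra.
  rewrite /t h3 ifF; last by lra.
  by rewrite ifF; lra.
rewrite (ger0_norm lz) in hs.
have h1 : - (2 * e) <= lc (branch false z).
  have [h|h] := leP c z.
    have := lc_f0_mono hA1 m0 h z1; rewrite (lc_f0_mid hA1) -/(branch false z);
      lra.
  have := lc_f0_nonexp hA1 z0 (ltW h) m1;
    rewrite (lc_f0_mid hA1) -/(branch false z); lra.
rewrite {2}/t (ger0_norm lz) hs.
have lzA : 0 <= lc z / A by rewrite divr_ge0// ltW.
rewrite {1}/t; case: ifPn => [h|_]; last by case: ifP => _; lra.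
have h2 : `|lc (branch false z)| <= lc z - A.
  move: h; rewrite ler_norml ler_normr => /orP[h|h]; apply/andP; split; lra.
have : `|lc (branch false z)| / A <= (lc z - A) / A by rewrite ler_pM2r
  ?invr_gt0.
by rewrite mulrBl divff ?gt_eqF//; lra.
Qed.

Lemma steer_to_window z : S z -> ~ window z -> exists i,
  t (branch i z) <= t z - 1.
Proof.
move=> Sz /negP Wz; have [h|h] := leP 0 (lc z).
  by exists false; exact: steer_right.
exists true; rewrite branch_true steps_to_window_mirror
  -(steps_to_window_mirror z).
apply: steer_right; [exact: mirror_in| |by rewrite window_mirror].
rewrite logcoord_mirror; lra.
Qed.

Definition window_edge : R := 1 - expR (- e) / 2.
Local Notation w := window_edge.
(** [(1 - w) / w] is the factor of [lc_f0_contract] on [[w], [mid]], where [w] is the point of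
    coordinate [e]. *)
Definition contraction_gain : R := 1 - (1 - w) / w.
Local Notation sigma := contraction_gain.

Lemma window_edge_bounds : 2^-1 < w < 1.
Proof.
have [e0 _ _] := step_eps_bounds; rewrite /w.
have := expR_gt0 (- e); have : expR (- e) < 1 by rewrite expR_lt1 oppr_lt0.
by move=> *; apply/andP; split; lra.
Qed.

Lemma lc_window_edge : lc w = e.
Proof.
have [h1 h2] := andP window_edge_bounds.
rewrite logcoord_right ?ltW// /w opprB addrC subrK mulrCA divff ?mulr1//.
by rewrite expRK opprK.
Qed.

Lemma contraction_gain_bounds : 0 < sigma <= 1.
Proof.
have [h1 h2] := andP window_edge_bounds; rewrite /sigma.
have : (1 - w) / w < 1 by rewrite ltr_pdivrMr; lra.
have : 0 <= (1 - w) / w by rewrite divr_ge0//; lra.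
by move=> *; apply/andP; split; lra.
Qed.

Lemma window_contraction_edge z y : w <= z -> z <= y -> y <= c ->
  lc (branch false y) - lc (branch false z) <= (1 - sigma) * (lc y - lc z).
Proof.
have [h1 h2] := andP window_edge_bounds => wz zy yc.
have sE : 1 - sigma = (1 - w) / w by rewrite /sigma; lra.
have s0 : 0 <= (1 - w) / w by rewrite divr_ge0//; lra.
rewrite sE; apply: lc_f0_contract => //; first lra.
apply: (@le_trans _ _ ((1 - w) / w * w)); first by rewrite divfK ?gt_eqF; lra.
by rewrite ler_wpM2l.
Qed.

(** A window point has room at least [e] on either side inside [[w], [mid]]. If [y] lies outside
    this interval, only the part of the segment inside is sure to contract, by at least [sigma * e],
    while the rest does not expand; hence the minimum with [e]. *)
Lemma window_contraction_right z y : S z -> 0 <= lc z -> window z -> S y ->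
  `|lc (branch false z) - lc (branch false y)| <=
  `|lc z - lc y| - sigma * Num.min `|lc z - lc y| e.
Proof.
have [e0 eA ec] := step_eps_bounds.
have [s0 s1] := andP contraction_gain_bounds.
have [w1 w2] := andP window_edge_bounds.
have Sw : S w by apply/andP; split; lra.
have [w_gt0 w_lt1] := andP Sw.
move=> Sz lz; rewrite /window (ger0_norm lz) => /andP[lz1 lz2] Sy.
have [z_gt0 z_lt1] := andP Sz; have [y_gt0 y_lt1] := andP Sy.
have [m0 m1] := andP mid_in.
have wz : w < z by apply: lc_lt_inv => //; rewrite lc_window_edge; lra.
have zc : z < c by apply: lc_lt_inv => //; [exact: mid_in|lra].
have E a b : a <= b -> 0 < a -> b < 1 ->
    `|lc b - lc a| = lc b - lc a /\
    `|lc (branch false b) - lc (branch false a)| =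
    lc (branch false b) - lc (branch false a).
  move=> ab a0 b1; split; rewrite ger0_norm// subr_ge0.
  - exact: logcoord_mono.
  - exact: lc_f0_mono.
have minl r : Num.min r e <= r by rewrite ge_min lexx.
have minr r : Num.min r e <= e by rewrite ge_min lexx orbT.
have minsl r := ler_wpM2l (ltW s0) (minl r).
have minsr r := ler_wpM2l (ltW s0) (minr r).
have [zy|yz] := leP z y.
  rewrite distrC (distrC (lc z)); have [-> ->] := E _ _ zy z_gt0 y_lt1.
  have [yc|cy] := leP y c.
    have := window_contraction_edge (ltW wz) zy yc.
    have := minsl (lc y - lc z); lra.
  have := window_contraction_edge (ltW wz) (ltW zc) (lexx _).
  have := lc_f0_nonexp hA1 m0 (ltW cy) y_lt1; rewrite -!/(branch false _).
  have := minsr (lc y - lc z).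
  have : sigma * e <= sigma * (lc c - lc z) by rewrite ler_wpM2l ?(ltW s0)//;
    lra.
  lra.
have [-> ->] := E _ _ (ltW yz) y_gt0 z_lt1.
have [wy|yw] := leP w y.
  have := window_contraction_edge wy (ltW yz) (ltW zc).
  have := minsl (lc z - lc y); lra.
have := window_contraction_edge (lexx w) (ltW wz) (ltW zc).
have := lc_f0_nonexp hA1 y_gt0 (ltW yw) w_lt1; rewrite -!/(branch false _).
have := minsr (lc z - lc y).
have : sigma * e <= sigma * (lc z - lc w).
  by rewrite ler_wpM2l ?(ltW s0)// lc_window_edge; lra.
lra.
Qed.

Lemma window_contraction z : S z -> window z -> exists i, forall y, S y ->
  `|lc (branch i z) - lc (branch i y)| <=
  `|lc z - lc y| - sigma * Num.min `|lc z - lc y| e.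
Proof.
move=> Sz Wz; have [h|h] := leP 0 (lc z).
  by exists false => y Sy; exact: window_contraction_right.
exists true => y Sy; rewrite !lc_branch_true.
have := @window_contraction_right (1 - z) (1 - y) (mirror_in Sz).
rewrite window_mirror !logcoord_mirror => /(_ _ Wz (mirror_in Sy)).
rewrite oppr_ge0 => /(_ (ltW h)).
by rewrite -!opprD !normrN.
Qed.

End Steering.

(** * Dini moduli and drift *)

Section DiniModulus.
Context {R : realType}.
Variables p0 p1 : R -> R.
Hypothesis hp : positive_probabilities p0 p1.
Hypothesis hA2 : condA2 p0 p1.

(** At nonnegative arguments [modulus] lies between 0 and 1, so that [fine] loses nothing there. *)
Definition real_modulus (s : R) : R := fine (modulus p0 p1 s).
Local Notation b := real_modulus.

Definition prob (i : bool) : R -> R := if i then p1 else p0.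

Lemma prob_sum x : 0 <= x <= 1 -> prob false x + prob true x = 1.
Proof. by move=> x01; have [|_ _] := hp (x := x); rewrite ?in_itv. Qed.

Lemma prob_gt0 i x : 0 <= x <= 1 -> 0 < prob i x.
Proof. by move=> x01; have [|? ? _] := hp (x := x); rewrite ?in_itv//; case:
  i. Qed.

Lemma prob_lt1 i x : 0 <= x <= 1 -> prob i x < 1.
Proof.
move=> x01; have := prob_sum x01; have := prob_gt0 false x01.
have := prob_gt0 true x01; case: i; lra.
Qed.

Lemma osc_prob_ge i x y s : 0 < x < 1 -> 0 <= y <= 1 -> `|x - y| <= s ->
  (`|prob i x - prob i y|%:E <= osc (prob i) s)%E.
Proof.
move=> x01 y01 xy; apply: ereal_sup_ubound; exists x, (y - x).
by rewrite subrKC in_itv distrC !in_itv/= y01.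
Qed.

Lemma osc_prob_le1 i s : (osc (prob i) s <= 1)%E.
Proof.
apply: ge_ereal_sup => _ [x [h [x01 _ xh ->]]]; rewrite lee_fin.
rewrite !in_itv/= in x01 xh.
have x01' : 0 <= x <= 1 by case/andP: x01 => *; apply/andP; split; lra.
have := prob_gt0 i x01'; have := prob_lt1 i x01'.
have := prob_gt0 i xh; have := prob_lt1 i xh.
by move=> *; rewrite ler_norml; apply/andP; split; lra.
Qed.

Lemma osc_prob_ge0 i s : 0 <= s -> (0 <= osc (prob i) s)%E.
Proof.
move=> s0; have := @osc_prob_ge i 2^-1 2^-1 s.
rewrite !subrr normr0; apply => //; apply/andP; split; lra.
Qed.

Lemma osc_le_modulus i s : (osc (prob i) s <= modulus p0 p1 s)%E.
Proof. by rewrite /modulus le_max; case: i; rewrite lexx ?orbT. Qed.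

Lemma modulus_le1 s : (modulus p0 p1 s <= 1)%E.
Proof. by rewrite /modulus ge_max (osc_prob_le1 false) (osc_prob_le1 true). Qed.

Lemma modulus_ge0 s : 0 <= s -> (0 <= modulus p0 p1 s)%E.
Proof. by move=> s0; exact:
  le_trans (osc_prob_ge0 false s0) (osc_le_modulus false s). Qed.

Lemma real_modulusE s : 0 <= s -> (b s)%:E = modulus p0 p1 s.
Proof.
move=> s0; rewrite fineK// ge0_fin_numE ?modulus_ge0//.
by apply: le_lt_trans (modulus_le1 s) _; rewrite ltry.
Qed.

Lemma real_modulus_ge0 s : 0 <= s -> 0 <= b s.
Proof. by move=> s0; rewrite -lee_fin real_modulusE// modulus_ge0. Qed.

Lemma real_modulus_le1 s : 0 <= s -> b s <= 1.
Proof. by move=> s0; rewrite -lee_fin real_modulusE// modulus_le1. Qed.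

Lemma real_modulus_mono s s' : 0 <= s <= s' -> b s <= b s'.
Proof.
move=> /andP[s0 ss]; rewrite -lee_fin !real_modulusE//; last exact: le_trans ss.
have H (i : bool) : (osc (prob i) s <= osc (prob i) s')%E.
  apply: le_ereal_sup => _ [x [h [? hs ? ->]]]; exists x, h; split => //.
  exact: le_trans hs ss.
rewrite /modulus ge_max; apply/andP; split.
- exact: le_trans (H false) (osc_le_modulus false s').
- exact: le_trans (H true) (osc_le_modulus true s').
Qed.

Lemma prob_modulus i x y s : 0 < x < 1 -> 0 <= y <= 1 -> `|x - y| <= s ->
  `|prob i x - prob i y| <= b s.
Proof.
move=> x01 y01 xy; rewrite -lee_fin real_modulusE; last exact: le_trans xy.
exact: le_trans (osc_prob_ge i x01 y01 xy) (osc_le_modulus i s).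
Qed.

Lemma real_modulus_dini (t : R) : 0 < t < 1 ->
  exists M : R, forall n, \sum_(k < n) b (t ^+ k) <= M.
Proof.
move=> /andP[t0 t1].
have t0' : 0 <= t < 1 by rewrite ltW.
have := hA2 ler01 t0'.
set Sm := (\sum_(0 <= n <oo) _)%E => Sfin.
have tk k : 0 <= 1 * t ^+ k by rewrite mul1r exprn_ge0// ltW.
have S0 : (0 <= Sm)%E by apply: nneseries_ge0 => k _ _; exact: modulus_ge0.
exists (fine Sm) => n; rewrite -lee_fin fineK ?ge0_fin_numE//.
rewrite -sumEFin; apply: le_trans (nneseries_lim_ge n _).
  rewrite big_mkord le_eqVlt; apply/orP; left; apply/eqP; apply: eq_bigr => k _.
  by rewrite real_modulusE ?mul1r// exprn_ge0// ltW.
by move=> k _ _; exact: modulus_ge0.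
Qed.

(** The one-term case of [dini_tail]. *)
Lemma real_modulus_small (e : R) : 0 < e -> exists2 r : R, 0 < r & b r <= e.
Proof.
move=> e0; have h : 0 < (2^-1 : R) < 1 by apply/andP; split; lra.
have [r r0 /(_ 1%N)] := @dini_tail _ b real_modulus_dini 2^-1 e h e0.
by rewrite big_ord_recl big_ord0 expr0 mulr1 addr0; exists r.
Qed.

Lemma prob_continuous i : {within `[0, 1], continuous (prob i)}.
Proof.
(* [osc] wants one of the two points in ]0, 1[. The neighbour [y] is taken for it, so that [x] may
   be an end point. *)
have H x : 0 <= x <= 1 -> forall e, 0 < e -> exists2 r : R, 0 < r & forall y,
  0 < y < 1 ->
    `|x - y| <= r -> `|prob i x - prob i y| <= e.
  move=> x01 e e0; have [r r0 br] := real_modulus_small e0.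
  exists r => // y y01 xy; rewrite distrC; apply: le_trans br.
  by apply: prob_modulus => //; rewrite distrC.
apply/continuous_within_itvP => //; split.
- move=> x; rewrite in_itv/= => x01; apply/cvgrPdist_le => e e0.
  have x01' : 0 <= x <= 1 by case/andP: x01 => *; apply/andP; split; lra.
  have [r r0 hr] := H x x01' e e0.
  have h1 : \forall y \near x, y \in `]0, 1[%R by apply: near_in_itvoo;
    rewrite in_itv.
  near=> y; apply: hr; first by have : y \in `]0, 1[%R by [near: y];
    rewrite in_itv.
  by near: y; apply: cvgr_dist_le => //; exact: cvg_id.
- apply/cvgrPdist_le => e e0.
  have [|r r0 hr] := H 0 _ e e0; first by rewrite lexx ler01.
  near=> y; apply: hr.
    apply/andP; split; first by near: y; exact: nbhs_right_gt.
    by near: y; exact: nbhs_right_lt.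
  rewrite sub0r normrN ger0_norm; first by near: y; exact: nbhs_right_le.
  by near: y; exact: nbhs_right_ge.
- apply/cvgrPdist_le => e e0.
  have [|r r0 hr] := H 1 _ e e0; first by rewrite lexx ler01.
  near=> y; apply: hr.
    apply/andP; split; first by near: y; exact: nbhs_left_gt.
    by near: y; exact: nbhs_left_lt.
  rewrite ger0_norm; last by rewrite subr_ge0; near: y; exact: nbhs_left_le.
  rewrite lerBlDr -lerBlDl; near: y; apply: nbhs_left_ge; rewrite ltrBlDr; lra.
Unshelve. all: by end_near.
Qed.

Lemma prob_lower_bound : exists2 pm : R, 0 < pm &
  forall i x, 0 < x < 1 -> pm <= prob i x.
Proof.
have H i : exists2 pm : R, 0 < pm & forall x, 0 < x < 1 -> pm <= prob i x.
  have [c c01 hc] := EVT_min ler01 (@prob_continuous i).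
  rewrite in_itv/= in c01.
  exists (prob i c); first exact: prob_gt0.
  by move=> x /andP[x0 x1]; apply: hc; rewrite in_itv/= !ltW.
have [pm0 h0 H0] := H false; have [pm1 h1 H1] := H true.
exists (Num.min pm0 pm1); first by rewrite lt_min h0.
by move=> [] x x01; rewrite ge_min ?H0 ?H1 ?orbT.
Qed.

End DiniModulus.

(** * Drift and Lyapunov function of the system *)

Section System.
Context {R : realType}.
Variables (x0 y0 : R) (p0 p1 : R -> R).
Hypothesis hp : positive_probabilities p0 p1.
Hypothesis hA1 : condA1 x0 y0.
Hypothesis hA2 : condA2 p0 p1.
Hypothesis hA4 : condA4 x0 y0 p0 p1.

Local Notation lc := logcoord.
Local Notation A := (- ln (a0 x0 y0)).
Local Notation B := (ln (a1 x0 y0)).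
Local Notation c := (mid x0 y0).
Local Notation S := (fun z : R => 0 < z < 1).
Local Notation F := (branch x0 y0).
Local Notation p := (prob p0 p1).

Let B_gt0 : 0 < B.
Proof.
have h : 0 < (2^-1 : R) < 1 by apply/andP; split; lra.
have [h0 h1] := andP h.
have := lc_f0_bounds hA1 h0 h1; have := A_gt0 hA1; move=> ? /andP[]; lra.
Qed.

Lemma far_right (r : R) : 0 < r -> exists2 L : R, 0 <= L &
  forall x, S x -> L <= lc x ->
  [/\ 1 - x <= r, `|lc (F false x)| = lc x - B & `|lc (F true x)| = lc x + A].
Proof.
move=> r0; have A0 := A_gt0 hA1; have B0 := B_gt0.
(* The summands ensure in turn that [x] exceeds [x0], that [lc x - B] is nonnegative and that
   [1 - x <= r]; the 1 makes the comparisons strict. *)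
exists (`|lc x0| + B + `|ln (2 * r)| + 1).
  by rewrite !addr_ge0// ltW.
move=> x Sx hL.
have hx0 : S x0.
  by case: hA1 => /andP[? ?] _; apply/andP; split; lra.
have n1 := ler_norm (lc x0); have n2 := ler_norm (- ln (2 * r));
  rewrite normrN in n2.
have n3 := normr_ge0 (lc x0); have n4 := normr_ge0 (ln (2 * r)).
have xx0 : x0 < x by apply: lc_lt_inv => //; lra.
have [x_gt0 x_lt1] := andP Sx.
have x2 : 2^-1 < x.
  by case: hA1 => /andP[? ?] _; lra.
split.
- move: hL; rewrite (@logcoord_right _ x) ?(ltW x2)//.
  move=> hL; have : ln (2 * (1 - x)) < ln (2 * r) by lra.
  rewrite ltr_ln ?posrE; lra.
- rewrite (lc_f0_right hA1 x_lt1 (ltW xx0)) ger0_norm//; lra.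
- rewrite lc_branch_true (lc_f0_left hA1); [|lra..].
  rewrite logcoord_mirror normrN ltr0_norm; lra.
Qed.

(** Near 1 the moves shift [|lc x|] by [- B] and [A], so with the probabilities frozen at 1 the mean
    shift is [- Lambda1]. Near 0 the mirrored computation gives [- Lambda0]. *)
Lemma drift_to_middle : exists L cc : R, [/\ 0 <= L, 0 < cc &
  forall x, S x -> L <= `|lc x| ->
    avg2 (p^~ x) (fun i => `|lc (F i x)|) <= `|lc x| - cc].
Proof.
have A0 := A_gt0 hA1; have B0 := B_gt0.
pose m := Num.min (Lambda0 x0 y0 p0 p1) (Lambda1 x0 y0 p0 p1).
have m0 : 0 < m by rewrite lt_min; case: hA4 => -> ->.
have m_le0 : m <= p0 0 * - A + p1 0 * B by rewrite opprK ge_min lexx.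
have m_le1 : m <= p0 1 * B + p1 1 * - A by rewrite opprK ge_min lexx orbT.
(* Replacing [p i x] by its value at the end point changes the drift by at most [e * (A + B)], half
   of [m]. *)
pose e := m / (2 * (A + B)).
have e0 : 0 < e by rewrite divr_gt0// mulr_gt0// addr_gt0.
have eE : e * (A + B) = m / 2 by rewrite /e; field; lra.
have [r r0 br] := real_modulus_small hp hA2 e0.
have [L L_ge0 hL] := far_right r0.
exists L, (m / 2); split => //; first by rewrite divr_gt0.
move=> x Sx; have [x_gt0 x_lt1] := andP Sx.
have i0 : 0 <= (0 : R) <= 1 by rewrite lexx ler01.
have i1 : 0 <= (1 : R) <= 1 by rewrite lexx ler01.
have [h|h] := leP 0 (lc x).
  rewrite ger0_norm// => /(hL x Sx)[xr hf ht].
  have close i : `|p i x - p i 1| <= e.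
    apply: le_trans br; apply: prob_modulus => //.
    by rewrite distrC ger0_norm//; lra.
  have := close true; have := close false; rewrite /avg2 hf ht /=.
  have x01 : 0 <= x <= 1 by apply/andP; split; lra.
  have := prob_sum hp x01; rewrite /= => ps.
  rewrite !ler_norml => /andP[f1 f2] /andP[t1 t2].
  nra.
rewrite ltr0_norm// -logcoord_mirror => /(hL _ (mirror_in Sx))[xr hf ht].
rewrite lc_branch_true in ht; rewrite subKr normrN in ht.
have hf' : `|lc (F true x)| = lc (1 - x) - B.
  by rewrite lc_branch_true normrN.
have close i : `|p i x - p i 0| <= e.
  apply: le_trans br; apply: prob_modulus => //.
  by rewrite subr0 ger0_norm//; lra.
have := close true; have := close false; rewrite /avg2 hf' ht /=.
have x01 : 0 <= x <= 1 by apply/andP; split; lra.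
have := prob_sum hp x01; rewrite /= => ps.
rewrite !ler_norml => /andP[f1 f2] /andP[t1 t2].
nra.
Qed.

Lemma measurable_logcoord : measurable_fun setT (lc : R -> R).
Proof.
apply: measurable_fun_ifT.
- exact: measurable_fun_ler.
- by apply: measurableT_comp; [exact: measurable_ln|exact: measurable_funM].
- apply: measurableT_comp => //; apply: measurableT_comp; first exact:
  measurable_ln.
  by apply: measurable_funM => //; exact: measurable_funB.
Qed.

Lemma measurable_lyapunov a N K :
  measurable_fun setT (lyapunov lc (steps_to_window x0 y0) a N K).
Proof.
have mu : measurable_fun setT (fun x : R => `|lc x|).
  by apply: measurableT_comp => //; exact: measurable_logcoord.
have mt : measurable_fun setT (steps_to_window x0 y0).
  apply: measurable_fun_ifT; first exact: measurable_fun_ler.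
    by apply: measurable_funD => //; exact: measurable_funM.
  by apply: measurable_fun_ifT; [exact:
    (measurable_fun_ltr mu (measurable_cst _))|exact: measurable_cst|exact:
      measurable_cst].
have mexp := @measurable_expR R.
apply: (measurableT_comp mexp).
apply: measurable_funM => //; apply: measurable_funD => //.
apply: measurable_funM => //; apply: measurable_funB => //.
apply: (measurableT_comp mexp).
by apply: measurableT_comp => //; exact: measurable_funM.
Qed.

Lemma system_lyapunov : exists (V : R -> R) (lambda bb C kV : R),
  [/\ measurable_fun setT V, forall x, 1 <= V x, 0 < lambda < 1 &
      forall x, `|lc x| <= kV * V x] /\
  [/\ forall x, S x -> avg2 (p^~ x) (fun i => V (F i x)) <= lambda * V x + bb,
      forall x, S x -> avg2 (p^~ x) (fun i => V (F i x) ^+ 2) <=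
                       lambda * V x ^+ 2 + bb,
      forall i x, S x -> V (F i x) <= C * V x &
      forall (phi : R -> R) (M : R), (forall x, S x -> `|phi x| <= M) ->
        (forall e : R, 0 < e -> exists2 eta : R, 0 < eta &
          forall x y, S x -> S y -> `|x - y| <= eta -> `|phi x - phi y| <= e) ->
        forall e : R, 0 < e -> exists l N : R, [/\ 0 <= l < 1, 0 <= N &
          forall n x y, S x -> S y ->
          `|iter n (markov_op F p) phi x - iter n (markov_op F p) phi y| <=
          e + 2 * M * l ^+ n * (V x + V y + N)]].
Proof.
have [L [cc [L_ge0 cc_gt0 drift]]] := drift_to_middle.
have [pm pm_gt0 p_ge] := prob_lower_bound hp hA2.
have [e_gt0 _ _] := step_eps_bounds hA1.
have S01 x : S x -> 0 <= x <= 1 by move=> /andP[? ?]; rewrite !ltW.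
have p_sum x : S x -> p false x + p true x = 1.
  by move=> Sx; apply: prob_sum => //; exact: S01.
have p_ge0 x : S x -> forall i, 0 <= p i x.
  by move=> Sx i; rewrite ltW//; apply: prob_gt0 => //; exact: S01.
(* One threshold for two purposes: the drift holds beyond it and the window lies below it. *)
pose L' := L + lc c.
have c_ge0 : 0 <= lc c by have := A_lt_mid hA1; have := A_gt0 hA1; lra.
have L'_ge0 : 0 <= L' by rewrite addr_ge0.
have drift' x : S x -> L' <= `|lc x| ->
    avg2 (p^~ x) (fun i => `|lc (F i x)|) <= `|lc x| - cc.
  by move=> Sx hL; apply: drift => //; rewrite /L' in hL; lra.
have W_bnd x : window x0 y0 x -> `|lc x| <= L'.
  by move=> /andP[_ h]; rewrite /L'; lra.
have k2_ge0 : 0 <= A^-1 by rewrite invr_ge0 ltW// A_gt0.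
have t_ge0 := steps_to_window_ge0 hA1.
have t_le := steps_to_window_le hA1.
have FS i x : S x -> S (F i x) by move=> Sx; exact: branch_in.
have steer x : S x -> ~ window x0 y0 x -> exists i,
    steps_to_window x0 y0 (F i x) <= steps_to_window x0 y0 x - 1.
  by move=> Sx; exact: steer_to_window.
have contr x : S x -> window x0 y0 x -> exists i, forall y, S y ->
    `|lc (F i x) - lc (F i y)| <= `|lc x - lc y| -
    contraction_gain x0 y0 * Num.min `|lc x - lc y| (step_eps x0 y0).
  by move=> Sx; exact: window_contraction.
have nonexp := lc_branch_nonexp hA1.
have [a [N [K [lambda [bb [C [RJ [[a_gt0 N_ge0 K_gt0 l01]
  [V1 V2 V3 V4 V5]]]]]]]]] :=
  lyapunov_exists (S := S) (J := window x0 y0) p_sum pm_gt0 p_ge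
    (lc_branch_step hA1) L'_ge0 cc_gt0 drift' t_ge0
    k2_ge0 t_le steer W_bnd
    nonexp (contraction_gain_bounds hA1)
    contr half_in.
set V := lyapunov _ _ _ _ _ in V1 V2 V3 V4 V5.
have w_ge0 x : 0 <= N * (1 - expR (- (K * steps_to_window x0 y0 x))).
  rewrite mulr_ge0// subr_ge0 expR_le1 oppr_le0 mulr_ge0//; exact: ltW.
have V_ge1 x : 1 <= V x.
  by rewrite -expR0 ler_expR mulr_ge0 ?(ltW a_gt0)// addr_ge0.
have V_ge x : `|lc x| <= a^-1 * V x.
  rewrite mulrC ler_pdivlMr// mulrC; have := expR_ge1Dx (a * `|lc x|).
  have : expR (a * `|lc x|) <= V x by rewrite ler_expR ler_pM2l// lerDl.
  lra.
exists V, lambda, bb, C, a^-1; split; split => //; first exact: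
  measurable_lyapunov.
move=> phi M phiM phi_uc e e0.
(* Uniform continuity carries over to the logarithmic distance because that distance dominates the
   Euclidean one. *)
have phi_uc' e' : 0 < e' -> exists2 eta : R, 0 < eta & forall x y, S x -> S y ->
    `|lc x - lc y| <= eta -> `|phi x - phi y| <= e'.
  move=> /phi_uc[eta eta0 h]; exists eta => // x y Sx Sy hxy.
  by apply: h => //; apply: le_trans hxy; exact: norm_lc_sub.
have p_lip x y : S x -> S y ->
    `|p false x - p false y| <= real_modulus p0 p1 `|lc x - lc y|.
  by move=> Sx Sy; apply: prob_modulus => //; [exact: S01|exact: norm_lc_sub].
have [zeta zeta0 close] := iter_markov_op_equicontinuous (S := S) FS p_sum p_ge0
  (real_modulus_ge0 hp) (real_modulus_le1 hp) (real_modulus_mono hp)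
  (real_modulus_dini hp hA2) p_lip nonexp e_gt0 l01 V_ge1 V5
  phiM phi_uc' e0.
have [s0 _] := andP (contraction_gain_bounds hA1).
exact: (coupling_decay (S := S) (J := window x0 y0) FS p_sum pm_gt0 p_ge
  nonexp (lc_branch_step hA1) t_ge0 k2_ge0 t_le
  steer W_bnd e_gt0 s0 contr
  l01 V_ge1 V1 V4 V_ge phiM (ltW e0) zeta0 close).
Qed.

End System.

(** * Strong law for orthogonal random variables *)

Section Expectation.
Context {R : realType} {d : measure_display} {Omega : measurableType d}.
Variable P : probability Omega R.
Implicit Types f g : Omega -> R.

Definition integ f := P.-integrable setT (EFin \o f).

Lemma integ_measurable f : integ f -> measurable_fun setT f.
Proof. by move=> /measurable_int/measurable_EFinP. Qed.

Lemma integ_le f g : measurable_fun setT f -> (forall w, `|f w| <= g w) ->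
  integ g -> integ f.
Proof.
move=> mf fg; apply: le_integrable => //; first exact/measurable_EFinP.
by move=> w _ /=; rewrite lee_fin (le_trans (fg w))// ler_norm.
Qed.

Lemma integD f g : integ f -> integ g -> integ (fun w => f w + g w).
Proof.
move=> hf hg; have := integrableD measurableT hf hg.
by apply: eq_integrable.
Qed.

Lemma integZ (k : R) f : integ f -> integ (fun w => k * f w).
Proof.
move=> hf; have := integrableZl measurableT k hf.
by apply: eq_integrable.
Qed.

Lemma integB f g : integ f -> integ g -> integ (fun w => f w - g w).
Proof.
move=> hf hg; have := integrableB measurableT hf hg.
by apply: eq_integrable.
Qed.

Lemma integ_sum n (f : nat -> Omega -> R) : (forall k, integ (f k)) ->
  integ (fun w => \sum_(k < n) f k w).
Proof.
move=> hf; elim: n => [|n IH].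
  have -> : (fun w => \sum_(k < 0) f k w) = cst 0 by apply/funext => w;
    rewrite big_ord0.
  exact: finite_measure_integrable_cst.
have -> : (fun w => \sum_(k < n.+1) f k w) = (fun w =>
  \sum_(k < n) f k w + f n w).
  by apply/funext => w; rewrite big_ord_recr.
exact: integD.
Qed.

Lemma Rintegral_sum n (f : nat -> Omega -> R) : (forall k, integ (f k)) ->
  \int[P]_w (\sum_(k < n) f k w) = \sum_(k < n) \int[P]_w f k w.
Proof.
move=> hf; elim: n => [|n IH].
  rewrite big_ord0 -[RHS](Rintegral_set0 P (cst 0)).
  have -> : (fun w => \sum_(k < 0) f k w) = cst 0 by apply/funext => w;
    rewrite big_ord0.
  by rewrite Rintegral_cst// mul0r Rintegral_set0.
have -> : (fun w => \sum_(k < n.+1) f k w) = (fun w =>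
  \sum_(k < n) f k w + f n w).
  by apply/funext => w; rewrite big_ord_recr.
rewrite RintegralD//; [|exact: (integ_sum n hf)|exact: hf].
by rewrite big_ord_recr IH.
Qed.

(** By monotone convergence the series of the [A j] has a finite integral, so it converges almost
    everywhere and its terms tend to 0. *)
Lemma ae_cvg0_summable (A : nat -> Omega -> R) (c : nat -> R) (M : R) :
  (forall j w, 0 <= A j w) -> (forall j, integ (A j)) ->
  (forall j, \int[P]_w A j w <= c j) -> (forall n, \sum_(j < n) c j <= M) ->
  {ae P, forall w, A j w @[j --> \oo] --> 0}.
Proof.
move=> A0 intA Ac cM.
have mA j := integ_measurable (intA j).
pose Sm w := (\sum_(j <oo) (A j w)%:E)%E.
have mSm : measurable_fun setT Sm.
  by apply: ge0_emeasurable_sum => [j w _ _|j _];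
    [rewrite lee_fin|exact/measurable_EFinP].
have Sm0 w : (0 <= Sm w)%E by apply: nneseries_ge0 => j _ _; rewrite lee_fin.
have intS : (\int[P]_w Sm w <= M%:E)%E.
  rewrite integral_nneseries//; last 2 first.
  - by move=> j; exact/measurable_EFinP.
  - by move=> j w _; rewrite lee_fin.
  apply: lime_le.
    by apply: is_cvg_nneseries => j _ _; apply: integral_ge0 => w _;
      rewrite lee_fin.
  near=> n; rewrite big_mkord.
  apply: (@le_trans _ _ (\sum_(j < n) (c j)%:E)%E);
    last by rewrite sumEFin lee_fin.
  apply: lee_sum => j _; rewrite -[leLHS]fineK ?lee_fin; first exact: Ac.
  exact: (integrable_fin_num measurableT (intA j)).
have iS : P.-integrable setT Sm.
  apply/integrableP; split => //.
  under eq_integral do rewrite gee0_abs//.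
  by apply: le_lt_trans intS _; rewrite ltry.
apply: filterS (integrable_ae measurableT iS) => w /(_ I) Sfin.
apply: cvg_series_cvg_0; apply: nondecreasing_is_cvgn.
  by apply: nondecreasing_series => j _ _; exact: A0.
exists (fine (Sm w)) => _ [n _ <-].
rewrite -lee_fin fineK// /series/= -sumEFin.
by apply: nneseries_lim_ge => j _ _; rewrite lee_fin.
Unshelve. all: by end_near.
Qed.

End Expectation.

Section StrongLaw.
Context {R : realType} {d : measure_display} {Omega : measurableType d}.
Variable P : probability Omega R.

(** Cauchy-Schwarz against the constant 1. *)
Lemma sqr_sum_le (a : nat -> R) m n : (m <= n)%N ->
  (\sum_(m <= k < n) a k) ^+ 2 <= (n - m)%:R * \sum_(m <= k < n) a k ^+ 2.
Proof.
elim: n => [|n IH]; first by rewrite leqn0 => /eqP ->;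
  rewrite !big_geq// expr0n mulr0.
rewrite leq_eqVlt => /orP[/eqP <-|mn].
  by rewrite !big_geq// expr0n mulr0.
rewrite ltnS in mn; rewrite !big_nat_recr//= subSn// -natr1.
have := IH mn; set s := \sum_(_ <= _ < _) _; set q := \sum_(_ <= _ < _) _.
set N : R := (n - m)%:R => hs.
have N0 : 0 <= N by exact: ler0n.
have [N_eq0|N_gt0] := eqVneq N 0.
  have s0 : s = 0 by apply/eqP; rewrite -(@sqrf_eq0 R) eq_le sqr_ge0 andbT;
    move: hs; rewrite N_eq0 mul0r.
  have q0 : 0 <= q by apply: sumr_ge0 => k _; exact: sqr_ge0.
  rewrite s0 N_eq0 !add0r mul1r; lra.
have N1 : 0 < N by rewrite lt_def N_gt0.
have h : 2 * (s * a n) <= q + N * a n ^+ 2.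
  rewrite -(ler_pM2l N1).
  have : 0 <= (s - N * a n) ^+ 2 by exact: sqr_ge0.
  have -> : (s - N * a n) ^+ 2 = s ^+ 2 - 2 * N * (s * a n) + N * (N * a n ^+
    2) by ring.
  nra.
have -> : (s + a n) ^+ 2 = s ^+ 2 + 2 * (s * a n) + a n ^+ 2 by ring.
nra.
Qed.

Lemma square_bracket n : exists j, (j ^ 2 <= n < j.+1 ^ 2)%N.
Proof.
elim: n => [|n [j /andP[h1 h2]]]; first by exists 0%N.
move: h2; rewrite leq_eqVlt => /orP[/eqP h|h]; last by exists j; rewrite h leqW.
by exists j.+1; rewrite h leqnn ltn_exp2r// ltnSn.
Qed.

(* square means are controlled along the squares [n = j^2], and by the crude
   bound of [sqr_sum_le] between two consecutive squares *)
Lemma strong_law_orthogonal (D : nat -> Omega -> R) (C : R) :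
  (forall k, integ P (fun w => D k w ^+ 2)) ->
  (forall k, measurable_fun setT (D k)) ->
  (forall k, \int[P]_w (D k w ^+ 2) <= C) ->
  (forall j k, (j < k)%N -> \int[P]_w (D j w * D k w) = 0) ->
  {ae P, forall w, (\sum_(k < n) D k w) / n%:R @[n --> \oo] --> 0}.
Proof.
move=> intD2 mD DC Dorth.
have C0 : 0 <= C by apply: le_trans (DC 0%N); apply: Rintegral_ge0 => w _;
  exact: sqr_ge0.
have intDD j k : integ P (fun w => D j w * D k w).
  apply: integ_le (integD (intD2 j) (intD2 k)); first exact: measurable_funM.
  move=> w; rewrite ler_norml.
  have := sqr_ge0 (D j w + D k w); have := sqr_ge0 (D j w - D k w).
  have := sqr_ge0 (D j w); have := sqr_ge0 (D k w).
  by move=> *; apply/andP; split; nra.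
pose S n w := \sum_(k < n) D k w.
have SS n w : S n.+1 w = S n w + D n w by rewrite /S big_ord_recr.
have intSD n : integ P (fun w =>
  S n w * D n w) /\ \int[P]_w (S n w * D n w) = 0.
  have -> : (fun w => S n w * D n w) = (fun w => \sum_(k < n) (D k w * D n w)).
    by apply/funext => w; rewrite /S mulr_suml.
  have h k : integ P (fun w => D k w * D n w) by exact: intDD.
  split; first exact: (integ_sum n h).
  rewrite (Rintegral_sum n h).
  by apply: big1 => k _; exact: Dorth.
have S2 n : integ P (fun w => S n w ^+ 2) /\ \int[P]_w (S n w ^+ 2) <= n%:R * C.
  elim: n => [|n [IH1 IH2]].
    have -> : (fun w => S 0%N w ^+ 2) = cst 0.
      by apply/funext => w; rewrite /S big_ord0 expr0n.
    split; first exact: finite_measure_integrable_cst.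
    by rewrite Rintegral_cst// !mul0r.
  have [i1 i2] := intSD n.
  have i3 := integZ 2 i1.
  have -> : (fun w => S n.+1 w ^+ 2) =
      (fun w => (S n w ^+ 2 + D n w ^+ 2) + 2 * (S n w * D n w)).
    by apply/funext => w; rewrite SS; ring.
  split; first by do 2?apply: integD.
  rewrite (RintegralD measurableT (integD IH1 (intD2 n)) i3).
  rewrite (RintegralD measurableT IH1 (intD2 n)) (RintegralZl _ measurableT i1).
  rewrite i2 mulr0 addr0 -natr1 mulrDl mul1r.
  exact: lerD.
pose Q j w := \sum_(k < j.+2 ^ 2 - j.+1 ^ 2) D (j.+1 ^ 2 + k)%N w ^+ 2.
have Dj2 j k : integ P (fun w => D (j.+1 ^ 2 + k)%N w ^+ 2) by exact: intD2.
have Qint j : integ P (Q j) by exact: (integ_sum _ (Dj2 j)).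
pose N j : R := (j.+1%:R) ^+ 4.
have N0 j : 0 < N j by rewrite exprn_gt0.
pose m j : R := (j.+2 ^ 2 - j.+1 ^ 2)%:R.
(* Up to a factor 2, [A j] dominates the square of [S n / n] for every [n] from [j.+1 ^ 2] up to the
   next square. *)
pose A j w := (N j)^-1 * (S (j.+1 ^ 2)%N w ^+ 2 + m j * Q j w).
have Aint j : integ P (A j).
  by apply: integZ; apply: integD; [case: (S2 (j.+1 ^ 2)%N)|exact: integZ].
have Q_ge0 j w : 0 <= Q j w by apply: sumr_ge0 => k _; exact: sqr_ge0.
have A0 j w : 0 <= A j w.
  by rewrite mulr_ge0 ?invr_ge0 ?(ltW (N0 j))// addr_ge0 ?sqr_ge0// mulr_ge0.
have mE j : m j = 2 * j%:R + 3.
  rewrite /m natrB; last by rewrite leq_exp2r.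
  by rewrite !natrX -!natr1; ring.
have QC j : \int[P]_w Q j w <= m j * C.
  rewrite (Rintegral_sum _ (Dj2 j)).
  apply: (@le_trans _ _ (\sum_(k < j.+2 ^ 2 - j.+1 ^ 2) C)); first exact:
    ler_sum.
  by rewrite sumr_const card_ord -mulr_natl.
(* The integral of [A j] is of order [C / j^2]; this form of the bound telescopes, and 20 is what
   [j = 0] requires. *)
pose c j : R := 20 * C * (j.+1%:R * j.+2%:R)^-1.
have Ac j : \int[P]_w A j w <= c j.
  have [i1 i2] := S2 (j.+1 ^ 2)%N.
  have i3 := integZ (m j) (Qint j).
  rewrite (RintegralZl _ measurableT (integD i1 i3)).
  rewrite (RintegralD measurableT i1 i3) (RintegralZl _ measurableT (Qint j)).
  rewrite mulrC ler_pdivrMr//.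
  have j0 : (0 : R) <= j%:R by exact: ler0n.
  apply: (@le_trans _ _ ((j.+1 ^ 2)%:R * C + m j * (m j * C))).
    by rewrite lerD// ler_wpM2l// mE; lra.
  have x1 : j.+1%:R = j%:R + 1 :> R by rewrite natr1.
  have x2 : j.+2%:R = j%:R + 2 :> R by rewrite -natrD addn2.
  rewrite mE /c /N natrX x1 x2; set x : R := j%:R in j0 *.
  have -> : 20 * C * ((x + 1) * (x + 2))^-1 * (x + 1) ^+ 4 =
    C * (20 * (x + 1) ^+ 3 / (x + 2)) by field; lra.
  have -> : (x + 1) ^+ 2 * C + (2 * x + 3) * ((2 * x + 3) * C) =
    C * ((x + 1) ^+ 2 + (2 * x + 3) ^+ 2) by ring.
  rewrite ler_wpM2l// ler_pdivlMr; last lra.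
  have := mulr_ge0 j0 j0; have := mulr_ge0 (mulr_ge0 j0 j0) j0; nra.
have cM n : \sum_(j < n) c j <= 20 * C.
  suff -> : \sum_(j < n) c j = 20 * C * (1 - (n.+1%:R)^-1).
    by rewrite ler_piMr ?mulr_ge0// gerBl invr_ge0.
  elim: n => [|n IH]; first by rewrite big_ord0 invr1 subrr mulr0.
  rewrite big_ord_recr /= IH /c -mulrDr; congr (_ * _).
  have x1 : n.+1%:R = n%:R + 1 :> R by rewrite natr1.
  have x2 : n.+2%:R = n%:R + 2 :> R by rewrite -natrD addn2.
  have n0 : (0 : R) <= n%:R by exact: ler0n.
  by rewrite x1 x2; field; apply/andP; split; rewrite gt_eqF//; lra.
apply: filterS (ae_cvg0_summable A0 Aint Ac cM) => w Acvg.
apply/cvgrPdist_le => e e0.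
have e2 : 0 < e ^+ 2 / 2 by rewrite divr_gt0// exprn_gt0.
have /cvgrPdist_le/(_ _ e2)[J _ hJ] := Acvg.
exists (J.+1 ^ 2)%N => // n /= hn.
rewrite sub0r normrN.
have [[|j] /andP[h1 h2]] := square_bracket n.
  by move: (leq_ltn_trans hn h2); rewrite ltn_exp2r//.
have Jj : (J <= j)%N by have := leq_ltn_trans hn h2; rewrite ltn_exp2r// !ltnS.
have := hJ j Jj; rewrite sub0r normrN ger0_norm// => hA.
have n_gt0 : (0 : R) < n%:R by rewrite ltr0n; apply: leq_trans h1.
rewrite -(@ler_sqr R) ?nnegrE ?(ltW e0)//.
rewrite real_normK ?num_real// expr_div_n ler_pdivrMr ?exprn_gt0//.
have hS : S n w = S (j.+1 ^ 2)%N w + \sum_(j.+1 ^ 2 <= k < n) D k w.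
  by rewrite /S -!(big_mkord xpredT (D^~ w)) (@big_cat_nat _ _ _ (j.+1 ^ 2)%N).
have hQ : (\sum_(j.+1 ^ 2 <= k < n) D k w) ^+ 2 <= m j * Q j w.
  apply: le_trans (sqr_sum_le (D^~ w) h1) _.
  apply: ler_pM => //; first by apply: sumr_ge0 => k _; exact: sqr_ge0.
    by rewrite ler_nat leq_sub2r// ltnW.
  rewrite /Q -(big_mkord xpredT (fun k => D (j.+1 ^ 2 + k)%N w ^+ 2)).
  have h3 : (n <= j.+2 ^ 2)%N by exact: ltnW.
  have h4 : (j.+1 ^ 2 <= j.+2 ^ 2)%N by rewrite leq_exp2r.
  have -> : \sum_(0 <= k < j.+2 ^ 2 - j.+1 ^ 2) D (j.+1 ^ 2 + k)%N w ^+ 2 =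
      \sum_(j.+1 ^ 2 <= k < j.+2 ^ 2) D k w ^+ 2.
    by rewrite -[X in _ = \sum_(X <= _ < _) _](add0n (j.+1 ^ 2)%N) big_addn;
      apply: eq_bigr => k _; rewrite addnC.
  rewrite [leRHS](@big_cat_nat _ _ _ n)//= lerDl.
  by apply: sumr_ge0 => k _; exact: sqr_ge0.
have hNn : N j <= n%:R ^+ 2.
  have -> : N j = ((j.+1 ^ 2)%:R : R) ^+ 2 by rewrite /N natrX -exprM.
  by rewrite ler_sqr ?nnegrE ?ler0n// ler_nat.
rewrite -/(S n w) hS.
have hAN : S (j.+1 ^ 2)%N w ^+ 2 + m j * Q j w = N j * A j w.
  by rewrite /A mulrA divff ?mul1r// gt_eqF.
set s1 := S _ w in hAN *; set s2 := \sum_(_ <= _ < _) _ in hQ *.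
have : (s1 + s2) ^+ 2 <= 2 * s1 ^+ 2 + 2 * s2 ^+ 2.
  by have := sqr_ge0 (s1 - s2); nra.
have : N j * A j w <= n%:R ^+ 2 * (e ^+ 2 / 2).
  by apply: ler_pM => //; exact: ltW.
nra.
Qed.

End StrongLaw.

(** * Markov chains *)

Section WeightedTransfer.
Context {R : realType} {d : measure_display} {Omega : measurableType d}.
Variable P : probability Omega R.

Import HBNNSimple.

(** The integral of [h] against the sum of the images under [Z i] of the measures of density [a i].
    Two images describe a transition; setting one weight to 0 leaves a single weighted variable. *)
Definition weighted_integral (a Z : bool -> Omega -> R) (h : R -> R) : \bar R :=
  (\int[P]_w (avg2 (a^~ w) (fun i => h (Z i w)))%:E)%E.

Section Weights.
Variables a Z : bool -> Omega -> R.
Hypothesis ma : forall i, measurable_fun setT (a i).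
Hypothesis a_ge0 : forall i w, 0 <= a i w.
Hypothesis mZ : forall i, measurable_fun setT (Z i).

Lemma measurable_weighted (h : R -> R) : measurable_fun setT h ->
  measurable_fun setT (fun w => avg2 (a^~ w) (fun i => h (Z i w))).
Proof.
by move=> mh; apply: measurable_funD; apply: measurable_funM => //; exact:
  measurableT_comp.
Qed.

Lemma weighted_ge0 (h : R -> R) w : (forall z, 0 <= h z) ->
  0 <= avg2 (a^~ w) (fun i => h (Z i w)).
Proof. by move=> h0; rewrite addr_ge0// mulr_ge0. Qed.

Lemma weighted_integral_sum n (c : 'I_n -> R) (h : 'I_n -> R -> R) :
  (forall i, 0 <= c i) -> (forall i, measurable_fun setT (h i)) ->
  (forall i z, 0 <= h i z) ->
  weighted_integral a Z (fun z => \sum_(i < n) c i * h i z) =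
  (\sum_(i < n) (c i)%:E * weighted_integral a Z (h i))%E.
Proof.
move=> c0 mh h0; rewrite /weighted_integral.
under [RHS]eq_bigr => i _.
  rewrite -ge0_integralZl; [over|by []|..].
  - exact/measurable_EFinP/measurable_weighted.
  - by move=> w _; rewrite lee_fin weighted_ge0.
  - by rewrite lee_fin.
rewrite -ge0_integral_sum//; last 2 first.
- move=> i; apply: measurable_funeM; exact/measurable_EFinP/measurable_weighted.
- by move=> i w _; rewrite -EFinM lee_fin mulr_ge0 ?weighted_ge0.
apply: eq_integral => w _; rewrite -[RHS]/(\sum_(i < n) ((c i)%:E * _)%E)%E.
under [RHS]eq_bigr => i _ do rewrite -EFinM.
rewrite sumEFin; congr (_%:E); rewrite /avg2 !mulr_sumr -big_split/=.
by apply: eq_bigr => i _; ring.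
Qed.

Lemma weighted_integral_cvg (g : {nnsfun R >-> R}^nat) (h : R -> R) :
  measurable_fun setT h -> nondecreasing_seq (g : (R -> R)^nat) ->
  (forall z, g n z @[n --> \oo] --> h z) ->
  weighted_integral a Z (g n) @[n --> \oo] --> weighted_integral a Z h.
Proof.
move=> mh nd gh.
have H w : (avg2 (a^~ w) (fun i => h (Z i w)))%:E =
    limn (fun n => (avg2 (a^~ w) (fun i => g n (Z i w)))%:E).
  apply/esym/cvg_lim => //; apply: cvg_EFin; first exact: nearW.
  by rewrite /=; apply: cvgD; apply: cvgMr; exact: gh.
rewrite /weighted_integral.
under [X in _ --> X]eq_integral => w _ do rewrite H.
apply: cvg_monotone_convergence => //.
- by move=> n; exact/measurable_EFinP/measurable_weighted.
- by move=> n w _; rewrite lee_fin weighted_ge0.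
- move=> w _ m n mn; rewrite lee_fin; apply: ler_avg2 => // i.
  exact/lefP/nd.
Qed.

End Weights.

(** Equality on indicators passes to simple functions by linearity, and to nonnegative measurable
    ones by monotone convergence along [nnsfun_approx]. *)
Lemma weighted_transfer (a Z b Y : bool -> Omega -> R) :
  (forall i, measurable_fun setT (a i)) -> (forall i w, 0 <= a i w) ->
  (forall i, measurable_fun setT (Z i)) ->
  (forall i, measurable_fun setT (b i)) -> (forall i w, 0 <= b i w) ->
  (forall i, measurable_fun setT (Y i)) ->
  (forall B : set R, measurable B ->
    weighted_integral a Z \1_B = weighted_integral b Y \1_B) ->
  forall h : R -> R, measurable_fun setT h -> (forall z, 0 <= h z) ->
  weighted_integral a Z h = weighted_integral b Y h.
Proof.
move=> ma a0 mZ mb b0 mY ab h mh h0.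
have mh' : measurable_fun setT (EFin \o h) by exact/measurable_EFinP.
pose g := nnsfun_approx measurableT mh'.
have gh z : g n z @[n --> \oo] --> h z.
  have := @cvg_nnsfun_approx _ _ _ _ measurableT _ mh' (fun x _ => h0 x) z I.
  by move=> /fine_cvgP[].
have nd : nondecreasing_seq (g : (R -> R)^nat) by exact: nd_nnsfun_approx.
have ca := weighted_integral_cvg ma a0 mZ mh nd gh.
have cb := weighted_integral_cvg mb b0 mY mh nd gh.
suff E n : weighted_integral a Z (g n) = weighted_integral b Y (g n).
  have := cvg_lim (@ereal_hausdorff R) ca; rewrite (funext E) => <-.
  exact: (cvg_lim (@ereal_hausdorff R) cb).
have -> : (g n : R -> R) = (fun z => \sum_(i < #|` fset_set (range (g n)) |)
    (fset_set (range (g n)))`_i *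
    \1_(g n @^-1` [set (fset_set (range (g n)))`_i]) z).
  by apply/funext => z; exact: fimfunEord.
have c0 (i : 'I_(#|` fset_set (range (g n)) |)) :
  0 <= (fset_set (range (g n)))`_i.
  have : (fset_set (range (g n)))`_i \in fset_set (range (g n)) by rewrite
    mem_nth.
  by rewrite in_fset_set// inE => -[z _ <-].
have m1 (i : 'I_(#|` fset_set (range (g n)) |)) :
    measurable (g n @^-1` [set (fset_set (range (g n)))`_i]).
  exact: measurable_sfunP.
rewrite !weighted_integral_sum//; [|by move=> i; exact: measurable_indic..].
by apply: eq_bigr => i _; rewrite ab.
Qed.

End WeightedTransfer.

Section Chain.
Context {R : realType} {d : measure_display} {Omega : measurableType d}.
Variable P : probability Omega R.
Variables (X : nat -> {RV P >-> R}) (F q : bool -> R -> R).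
Hypothesis mF : forall i, measurable_fun setT (F i).
Hypothesis mq : forall i, measurable_fun setT (q i).
Hypothesis q_ge0 : forall i x, 0 <= q i x.
Hypothesis chain : forall i k (A B : set R), (i <= k)%N ->
  measurable A -> measurable B ->
  P (X i @^-1` A `&` X k.+1 @^-1` B) =
  (\int[P]_(w in X i @^-1` A)
     (avg2 (q^~ (X k w)) (fun j => \1_B (F j (X k w))))%:E)%E.

Implicit Types (A B : set R) (g h : R -> R).

Local Notation Q := (markov_op F q).

Let mX k : measurable_fun setT (X k). Proof. exact: measurable_funP. Qed.

Lemma measurable_markov_op h : measurable_fun setT h ->
  measurable_fun setT (Q h).
Proof.
by move=> mh; apply: measurable_funD; apply: measurable_funM => //; exact:
  measurableT_comp.
Qed.

Lemma markov_op_ge0 h : (forall x, 0 <= h x) -> forall x, 0 <= Q h x.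
Proof. by move=> h0 x; rewrite addr_ge0// mulr_ge0. Qed.

Lemma chain_integral_set i k A h : (i <= k)%N -> measurable A ->
  measurable_fun setT h -> (forall x, 0 <= h x) ->
  (\int[P]_w (\1_A (X i w) * h (X k.+1 w))%:E)%E =
  (\int[P]_w (\1_A (X i w) * Q h (X k w))%:E)%E.
Proof.
move=> ik mA mh h0.
have mAX : measurable_fun setT (fun w => \1_A (X i w) : R).
  by apply: measurableT_comp => //; exact: measurable_indic.
(* [a] spreads the mass of the event over the two images [F j (X k w)], [b] puts all of it on
   [X k.+1 w]; the chain property is their equality on indicators. *)
pose a j w := \1_A (X i w) * q j (X k w).
pose b (j : bool) w := if j then 0 else \1_A (X i w) : R.
have := @weighted_transfer _ _ _ P a (fun j w => F j (X k w)) b (fun j w =>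
  X k.+1 w).
have ma j : measurable_fun setT (a j).
  by apply: measurable_funM => //; exact: measurableT_comp.
have a0 j w : 0 <= a j w by rewrite mulr_ge0.
have mZ j : measurable_fun setT (fun w => F j (X k w)) by exact:
  measurableT_comp.
have mb j : measurable_fun setT (b j) by case: j => //; exact: measurable_cst.
have b0 j w : 0 <= b j w by case: j => /=.
move=> /(_ ma a0 mZ mb b0 (fun=> mX k.+1)) H.
have Eb g w : avg2 (b^~ w) (fun=> g (X k.+1 w)) = \1_A (X i w) * g (X k.+1 w).
  by rewrite /avg2 /b mul0r addr0.
have Ea g w : avg2 (a^~ w) (fun j =>
  g (F j (X k w))) = \1_A (X i w) * Q g (X k w).
  by rewrite /markov_op /avg2 /a; ring.
have {}H : forall h, measurable_fun setT h -> (forall z, 0 <= h z) ->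
    weighted_integral P a (fun j w =>
      F j (X k w)) h = weighted_integral P b (fun=> X k.+1) h.
  apply: H => B mB; rewrite /weighted_integral.
  under eq_integral do rewrite Ea; under [RHS]eq_integral do rewrite Eb.
  have mAX' : measurable (X i @^-1` A) by rewrite -[X in measurable X]setTI;
    exact: mX.
  have mBX' : measurable (X k.+1 @^-1` B) by rewrite -[X in measurable X]setTI;
    exact: mX.
  transitivity (P (X i @^-1` A `&` X k.+1 @^-1` B)).
    rewrite chain// [RHS]integral_mkcond; apply: eq_integral => w _.
    rewrite patchE; case: ifPn => [|].
      by rewrite inE/= => Aw; rewrite indicE mem_set// mul1r.
    by rewrite notin_setE/= => Aw; rewrite indicE memNset// mul0r.
  rewrite -[X in P X]setIT -integral_indic//; last exact: measurableI.
  by apply: eq_integral => w _; rewrite indicI /= !indicE.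
have := H h mh h0; rewrite /weighted_integral.
under eq_integral do rewrite Ea; under [in X in _ = X ->
  _]eq_integral do rewrite Eb.
by [].
Qed.

(** A second use of the transfer principle. Now [h] is fixed inside the weights, and the indicator
    of the past variable is replaced by [g]. *)
Lemma chain_integral i k g h : (i <= k)%N ->
  measurable_fun setT g -> (forall x, 0 <= g x) ->
  measurable_fun setT h -> (forall x, 0 <= h x) ->
  (\int[P]_w (g (X i w) * h (X k.+1 w))%:E)%E =
  (\int[P]_w (g (X i w) * Q h (X k w))%:E)%E.
Proof.
move=> ik mg g0 mh h0.
pose a (j : bool) w := if j then 0 else h (X k.+1 w).
pose b (j : bool) w := if j then 0 else Q h (X k w).
have := @weighted_transfer _ _ _ P a (fun j w => X i w) b (fun j w => X i w).
have mQ := measurable_markov_op mh.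
have ma j : measurable_fun setT (a j).
  by case: j => /=; [exact: measurable_cst|exact: measurableT_comp].
have mb j : measurable_fun setT (b j).
  by case: j => /=; [exact: measurable_cst|exact: measurableT_comp].
have a0 j w : 0 <= a j w by case: j => /=.
have b0 j w : 0 <= b j w by case: j => //=; exact: markov_op_ge0.
move=> /(_ ma a0 (fun=> mX i) mb b0 (fun=> mX i)).
have Ea f w : avg2 (a^~ w) (fun=> f (X i w)) = f (X i w) * h (X k.+1 w).
  by rewrite /avg2 /a mul0r addr0 mulrC.
have Eb f w : avg2 (b^~ w) (fun=> f (X i w)) = f (X i w) * Q h (X k w).
  by rewrite /avg2 /b mul0r addr0 mulrC.
move=> H.
have {}H : weighted_integral P a (fun=> X i) g = weighted_integral P b (fun=>
  X i) g.
  apply: H => // B mB; rewrite /weighted_integral.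
  under eq_integral do rewrite Ea; under [RHS]eq_integral do rewrite Eb.
  exact: chain_integral_set.
move: H; rewrite /weighted_integral.
under eq_integral do rewrite Ea; under [in X in _ = X ->
  _]eq_integral do rewrite Eb.
by [].
Qed.

Section Dominated.
Variables (G : R -> R) (C0 : R) (S : set R).
Hypothesis XS : forall k w, S (X k w).
Hypothesis mG : measurable_fun setT G.
Hypothesis G_ge0 : forall x, 0 <= G x.
Hypothesis G_L2 : forall k, integ P (fun w => G (X k w) ^+ 2).
Hypothesis QG : forall x, S x -> Q G x <= C0 * G x.

Let mcomp h k : measurable_fun setT h -> measurable_fun setT (fun w =>
  h (X k w)).
Proof. by move=> mh; exact: measurableT_comp. Qed.

Lemma markov_op_dominated h M x : (forall y, `|h y| <= M * G y) -> S x ->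
  0 <= M ->
  `|Q h x| <= M * C0 * G x.
Proof.
move=> hM Sx M0; apply: le_trans (ler_norm_avg2 _ (fun i => q_ge0 i x)) _.
apply: (@le_trans _ _ (M * Q G x)); last by rewrite -mulrA ler_wpM2l// QG.
by rewrite -avg2Ml; apply: ler_avg2.
Qed.

Lemma integ_mul_dominated g h i k (M : R) :
  measurable_fun setT g -> measurable_fun setT h ->
  (forall w, `|g (X i w)| <= M * G (X i w)) ->
  (forall w, `|h (X k w)| <= M * G (X k w)) ->
  integ P (fun w => g (X i w) * h (X k w)).
Proof.
move=> mg mh gM hM.
apply: integ_le (integZ (M ^+ 2) (integD (G_L2 i) (G_L2 k))).
  by apply: measurable_funM; exact: mcomp.
move=> w; rewrite normrM.
apply: (@le_trans _ _ ((M * G (X i w)) * (M * G (X k w)))); first exact: ler_pM.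
have := sqr_ge0 (G (X i w) - G (X k w)); have := G_ge0 (X i w).
have := G_ge0 (X k w); have := sqr_ge0 M => ? ? ? ?.
have -> : M * G (X i w) * (M * G (X k w)) = M ^+ 2 * (G (X i w) * G (X k w)) by
  ring.
by rewrite ler_wpM2l//; nra.
Qed.

(** Adding [M * G] makes [g] and [h] nonnegative and at most [2 * M * G]. Expanding the product
    gives four nonnegative cases, all integrable since [G (X k w)] is square integrable. *)
Lemma chain_Rintegral i k g h (M : R) : (i <= k)%N ->
  measurable_fun setT g -> measurable_fun setT h ->
  (forall x, `|g x| <= M * G x) -> (forall x, `|h x| <= M * G x) ->
  \int[P]_w (g (X i w) * h (X k.+1 w)) = \int[P]_w (g (X i w) * Q h (X k w)).
Proof.
move=> ik mg mh gM hM.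
have [M_lt0|M0] := ltP M 0.
  have g0 x : g x = 0.
    apply/eqP; rewrite -normr_le0 (le_trans (gM x))//.
    by have := G_ge0 x; nra.
  by under eq_Rintegral do rewrite g0 mul0r;
    under [RHS]eq_Rintegral do rewrite g0 mul0r.
have [C_lt0|C0_ge0] := ltP C0 0.
  have G0 k' w : G (X k' w) = 0.
    have := QG (XS k' w); have := markov_op_ge0 G_ge0 (X k' w).
    by have := G_ge0 (X k' w); nra.
  have g0 w : g (X i w) = 0.
    by apply/eqP; rewrite -normr_le0 (le_trans (gM _))// G0 mulr0.
  by under eq_Rintegral do rewrite g0 mul0r;
    under [RHS]eq_Rintegral do rewrite g0 mul0r.
have pos g1 h1 M1 : measurable_fun setT g1 -> measurable_fun setT h1 ->
    0 <= M1 ->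
    (forall x, 0 <= g1 x <= M1 * G x) -> (forall x, 0 <= h1 x <= M1 * G x) ->
    [/\ integ P (fun w => g1 (X i w) * h1 (X k.+1 w)),
        integ P (fun w => g1 (X i w) * Q h1 (X k w)) &
        \int[P]_w (g1 (X i w) * h1 (X k.+1 w)) =
        \int[P]_w (g1 (X i w) * Q h1 (X k w))].
  move=> mg1 mh1 M1_ge0 g1M h1M.
  have g1_ge0 x : 0 <= g1 x by case/andP: (g1M x).
  have h1_ge0 x : 0 <= h1 x by case/andP: (h1M x).
  have g1M' x : `|g1 x| <= M1 * G x by rewrite ger0_norm//; case/andP: (g1M x).
  have h1M' x : `|h1 x| <= M1 * G x by rewrite ger0_norm//; case/andP: (h1M x).
  split.
  - exact: integ_mul_dominated.
  - apply: (@integ_mul_dominated g1 (Q h1) i k (M1 + M1 * C0)) => //.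
    + exact: measurable_markov_op.
    + move=> w; apply: le_trans (g1M' _) _.
      by rewrite ler_wpM2r// lerDl mulr_ge0.
    + move=> w; apply: le_trans (markov_op_dominated h1M' (XS k w) M1_ge0) _.
      by rewrite ler_wpM2r// lerDr.
  - by rewrite /Rintegral chain_integral.
pose g' x := g x + M * G x; pose h' x := h x + M * G x.
have mMG : measurable_fun setT (fun x => M * G x) by exact: measurable_funM.
have mg' : measurable_fun setT g' by exact: measurable_funD.
have mh' : measurable_fun setT h' by exact: measurable_funD.
have M2 : 0 <= 2 * M by lra.
have bnd f : (forall x, `|f x| <= M * G x) -> forall x,
  0 <= f x + M * G x <= 2 * M * G x.
  by move=> fM x; have := fM x; rewrite ler_norml => /andP[? ?]; apply/andP;
    split; lra.
have bndG x : 0 <= M * G x <= 2 * M * G x.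
  by have := mulr_ge0 M0 (G_ge0 x); move=> ?; apply/andP; split; lra.
have [i1 j1 e1] := pos g' h' (2 * M) mg' mh' M2 (bnd _ gM) (bnd _ hM).
have [i2 j2 e2] := pos g' (fun x => M * G x) (2 * M) mg' mMG M2 (bnd _ gM) bndG.
have [i3 j3 e3] := pos (fun x => M * G x) h' (2 * M) mMG mh' M2 bndG (bnd _ hM).
have [i4 j4 e4] := pos (fun x => M * G x) (fun x =>
  M * G x) (2 * M) mMG mMG M2 bndG bndG.
have El : (fun w => g (X i w) * h (X k.+1 w)) = (fun w =>
    (g' (X i w) * h' (X k.+1 w) - g' (X i w) * (M * G (X k.+1 w))) -
    (M * G (X i w) * h' (X k.+1 w) - M * G (X i w) * (M * G (X k.+1 w)))).
  by apply/funext => w; rewrite /g' /h'; ring.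
have Er : (fun w => g (X i w) * Q h (X k w)) = (fun w =>
    (g' (X i w) * Q h' (X k w) - g' (X i w) * Q (fun x => M * G x) (X k w)) -
    (M * G (X i w) * Q h' (X k w) - M * G (X i w) * Q (fun x =>
      M * G x) (X k w))).
  apply/funext => w; rewrite /g' /h' /markov_op /avg2; ring.
rewrite El Er.
rewrite (RintegralB measurableT (integB i1 i2) (integB i3 i4)).
rewrite (RintegralB measurableT (integB j1 j2) (integB j3 j4)).
rewrite (RintegralB measurableT i1 i2) (RintegralB measurableT i3 i4).
rewrite (RintegralB measurableT j1 j2) (RintegralB measurableT j3 j4).
by rewrite e1 e2 e3 e4.
Qed.

(* [h (X_(k+1)) - Q h (X_k)] are orthogonal martingale differences *)
Lemma chain_strong_law h (M m2 : R) : measurable_fun setT h ->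
  (forall x, `|h x| <= M * G x) -> (forall x, `|Q h x| <= M * G x) ->
  (forall k, \int[P]_w (G (X k w) ^+ 2) <= m2) ->
  {ae P, forall w,
    (\sum_(k < n) (h (X k.+1 w) - Q h (X k w))) / n%:R @[n --> \oo] --> 0}.
Proof.
move=> mh hM QhM Gm2.
have mQ := measurable_markov_op mh.
pose D k w := h (X k.+1 w) - Q h (X k w).
have mD k : measurable_fun setT (D k).
  by apply: measurable_funB; exact: mcomp.
have D2 k w : D k w ^+ 2 <= 2 * M ^+ 2 * (G (X k.+1 w) ^+ 2 + G (X k w) ^+ 2).
  have h1 : h (X k.+1 w) ^+ 2 <= (M * G (X k.+1 w)) ^+ 2.
    rewrite -(real_normK (num_real (h _))) lerXn2r ?nnegrE//.
    exact: le_trans (normr_ge0 _) (hM _).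
  have h2 : Q h (X k w) ^+ 2 <= (M * G (X k w)) ^+ 2.
    rewrite -(real_normK (num_real (Q h _))) lerXn2r ?nnegrE//.
    exact: le_trans (normr_ge0 _) (QhM _).
  have := sqr_ge0 (h (X k.+1 w) + Q h (X k w)).
  rewrite /D; nra.
have iGG k := integD (G_L2 k.+1) (G_L2 k).
have iB k := integZ (2 * M ^+ 2) (iGG k).
have iD2 k : integ P (fun w => D k w ^+ 2).
  apply: integ_le (iB k) => //; first exact: measurable_funX.
  by move=> w; rewrite ger0_norm ?sqr_ge0// D2.
apply: (@strong_law_orthogonal _ _ _ P D (2 * M ^+ 2 * (m2 + m2))) => //.
- move=> k; apply: (@le_trans _ _ (\int[P]_w (2 * M ^+ 2 * (G (X k.+1 w) ^+ 2 +
  G (X k w) ^+ 2)))).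
    by apply: le_Rintegral => //; [exact: iD2|exact: iB].
  rewrite (RintegralZl _ measurableT (iGG k)) (RintegralD measurableT (G_L2 _)
    (G_L2 _)).
  by apply: ler_wpM2l; [rewrite mulr_ge0 ?sqr_ge0|exact: lerD].
move=> j k jk.
(* [D j] is a function of [X j.+1] minus one of [X j], and [j < k] puts both indices among those at
   most [k]. *)
have orth g i : (i <= k)%N -> measurable_fun setT g -> (forall x,
  `|g x| <= M * G x) ->
    integ P (fun w => g (X i w) * D k w) /\ \int[P]_w (g (X i w) * D k w) = 0.
  move=> ik mg gM.
  have i1 : integ P (fun w => g (X i w) * h (X k.+1 w)) by exact:
    (@integ_mul_dominated g h i k.+1 M).
  have i2 : integ P (fun w => g (X i w) * Q h (X k w)) by exact:
    (@integ_mul_dominated g (Q h) i k M).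
  have -> : (fun w => g (X i w) * D k w) =
      (fun w => g (X i w) * h (X k.+1 w) - g (X i w) * Q h (X k w)).
    by apply/funext => w; rewrite /D mulrBr.
  split; first exact: integB.
  by rewrite (RintegralB measurableT i1 i2) (chain_Rintegral ik mg mh gM hM)
    subrr.
have [i1 e1] := orth h j.+1 jk mh hM.
have [i2 e2] := orth (Q h) j (ltnW jk) mQ QhM.
have -> : (fun w => D j w * D k w) = (fun w =>
  h (X j.+1 w) * D k w - Q h (X j w) * D k w).
  by apply/funext => w; rewrite {1}/D mulrBl.
by rewrite (RintegralB measurableT i1 i2) e1 e2 subrr.
Qed.

End Dominated.

End Chain.

(** * Cesaro averages along one trajectory *)

Section CesaroLimit.
Context {R : realType}.

Lemma cvg0_div_nat (a : nat -> R) (K : R) : (forall n, `|a n| <= K) ->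
  a n / n%:R @[n --> \oo] --> 0.
Proof.
move=> aK; apply/cvgrPdist_le => e e0; near=> n.
have n1 : (0 : R) < n%:R by rewrite ltr0n; near: n; exact: nbhs_infty_gt.
rewrite sub0r normrN normrM (ger0_norm (_ : 0 <= n%:R^-1)) ?invr_ge0//.
rewrite ler_pdivrMr//; apply: le_trans (aK n) _.
rewrite mulrC -ler_pdivrMr//; near: n; exact: nbhs_infty_ger.
Unshelve. all: by end_near.
Qed.

(** A deterministic statement: [v], [u] and [phi m] stand for the values of [V], [P V] and [P^m phi]
    along a fixed trajectory, and [c] for the mean. *)
Lemma cesaro_limit (v u : nat -> R) (phi : nat -> nat -> R) (lambda bb M c :
  R) :
  0 < lambda < 1 -> (forall k, 0 <= v k) ->
  (forall k, u k <= lambda * v k + bb) ->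
  (\sum_(k < n) (v k.+1 - u k)) / n%:R @[n --> \oo] --> 0 ->
  (forall m k, `|phi m k| <= M) ->
  (forall m, (\sum_(k < n) (phi m k.+1 - phi m.+1 k)) / n%:R @[n --> \oo] -->
    0) ->
  (forall e, 0 < e -> exists m, forall k, `|phi m k - c| <= e * v k) ->
  (\sum_(k < n) phi 0%N k.+1) / n%:R @[n --> \oo] --> c.
Proof.
move=> /andP[l0 l1] v0 uv uv_cvg phiM phi_cvg phi_c.
(* For large [n] the average [s] of [v] satisfies [s <= lambda * s + 1 + |bb| + v 0], the 1 being
   the allowed deviation in [uv_cvg]; this is solved for [s]. *)
pose Cv := (1 + `|bb| + v 0%N) / (1 - lambda).
have Cv_gt0 : 0 < Cv.
  by rewrite divr_gt0 ?subr_gt0// ltr_pwDl// ltr_pwDl.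
have avg_v : \forall n \near \oo, \sum_(k < n) v k.+1 <= Cv * n%:R.
  have /cvgrPdist_le/(_ _ ltr01) H := uv_cvg.
  near=> n.
  have n1 : (0 : R) < n%:R by rewrite ltr0n; near: n; exact: nbhs_infty_gt.
  have : `|0 - (\sum_(k < n) (v k.+1 - u k)) / n%:R| <= 1 by near: n; exact: H.
  rewrite sub0r normrN normrM (ger0_norm (_ : 0 <= n%:R^-1)) ?invr_ge0//.
  rewrite ler_pdivrMr// mul1r => /(le_trans (ler_norm _)).
  rewrite sumrB => h1.
  have h2 : \sum_(k < n) u k <= lambda * (v 0%N + \sum_(k < n) v k.+1) + `|bb|
    * n%:R.
    apply: (@le_trans _ _ (\sum_(k < n) (lambda * v k + `|bb|))).
      apply: ler_sum => k _; apply: le_trans (uv k) _.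
      by rewrite lerD2l ler_norm.
    rewrite big_split/= -mulr_sumr sumr_const card_ord mulr_natr lerD2r.
    rewrite ler_wpM2l ?(ltW l0)//.
    have : v 0%N + \sum_(k < n) v k.+1 = \sum_(k < n.+1) v k by rewrite
      big_ord_recl.
    by rewrite big_ord_recr /= => ->; rewrite lerDl.
  have n1' : (1 : R) <= n%:R by rewrite ler1n -(ltr0n R).
  rewrite /Cv mulrAC ler_pdivlMr ?subr_gt0//.
  have := v0 0%N; have := normr_ge0 bb; nra.
have phi_m m : (\sum_(k < n) (phi 0%N k.+1 - phi m k.+1)) / n%:R @[n -->
  \oo] --> 0.
  elim: m => [|m IH].
    under eq_cvg => n do [under eq_bigr do rewrite subrr; rewrite big1// mul0r].
    exact: cvg_cst.
  (* Passing from [phi m.+1 k] to [phi m.+1 k.+1] telescopes and leaves a boundary term that is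
     bounded, hence negligible after division by [n]. *)
  have -> : (fun n => (\sum_(k < n) (phi 0%N k.+1 - phi m.+1 k.+1)) / n%:R) =
      (fun n => ((\sum_(k < n) (phi 0%N k.+1 - phi m k.+1)) / n%:R +
       (\sum_(k < n) (phi m k.+1 - phi m.+1 k)) / n%:R) +
      (phi m.+1 0%N - phi m.+1 n) / n%:R).
    apply/funext => n; rewrite -!mulrDl; congr (_ / _).
    have : phi m.+1 0%N + \sum_(k < n) phi m.+1 k.+1 = \sum_(k < n.+1) phi m.+1
      k.
      by rewrite big_ord_recl.
    rewrite big_ord_recr /= !sumrB => h; lra.
  have h : (phi m.+1 0%N - phi m.+1 n) / n%:R @[n --> \oo] --> 0.
    apply: (@cvg0_div_nat _ (M + M)) => n.
    by apply: le_trans (ler_normB _ _) _; exact: lerD.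
  have := cvgD (cvgD IH (phi_cvg m)) h; rewrite !addr0; exact.
apply/cvgrPdist_le => e e0.
have e2 : 0 < e / (2 * Cv) by rewrite divr_gt0// mulr_gt0.
have [m hm] := phi_c _ e2.
have e3 : 0 < e / 2 by rewrite divr_gt0.
have /cvgrPdist_le/(_ _ e3) H := phi_m m.
near=> n.
have n1 : (0 : R) < n%:R by rewrite ltr0n; near: n; exact: nbhs_infty_gt.
have : `|0 - (\sum_(k < n) (phi 0%N k.+1 - phi m k.+1)) / n%:R| <= e / 2.
  by near: n; exact: H.
have : \sum_(k < n) v k.+1 <= Cv * n%:R by near: n; exact: avg_v.
set Sv := \sum_(k < n) v k.+1 => hv.
rewrite sub0r normrN => h1.
have -> : c - (\sum_(k < n) phi 0%N k.+1) / n%:R =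
   - ((\sum_(k < n) (phi 0%N k.+1 - phi m k.+1)) / n%:R) -
   (\sum_(k < n) (phi m k.+1 - c)) / n%:R.
  rewrite !sumrB sumr_const card_ord -mulr_natr; field.
  by rewrite gt_eqF.
apply: le_trans (ler_normB _ _) _; rewrite normrN.
have -> : e = e / 2 + e / 2 by lra.
apply: lerD => //; rewrite normrM (ger0_norm (_ : 0 <= n%:R^-1)) ?invr_ge0//.
rewrite ler_pdivrMr//; apply: le_trans (ler_norm_sum _ _ _) _.
apply: (@le_trans _ _ (\sum_(k < n) e / (2 * Cv) * v k.+1)).
  by apply: ler_sum => k _; exact: hm.
rewrite -mulr_sumr -/Sv.
apply: (@le_trans _ _ (e / (2 * Cv) * (Cv * n%:R)));
  first by rewrite ler_wpM2l// ltW.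
rewrite le_eqVlt; apply/orP; left; apply/eqP; field.
by rewrite gt_eqF.
Unshelve. all: by end_near.
Qed.

End CesaroLimit.

(** * The system of two maps *)

Section Merging.
Context {R : realType}.

Lemma uniform_continuity_itv (phi : R -> R) (a b e : R) : 0 < e ->
  (forall x, a <= x <= b -> {for x, continuous phi}) ->
  exists2 eta : R, 0 < eta & forall x y, a <= x <= b -> a <= y <= b ->
    `|x - y| <= eta -> `|phi x - phi y| <= e.
Proof.
move=> e0 cphi.
have := (compact_near_coveringP `[a, b]%classic).1 (@segment_compact R a b).
move=> /(_ R (0^'+)%classic (fun eta x => forall y, a <= y <= b ->
  `|x - y| <= eta ->
  `|phi x - phi y| <= e) _).
case.
- move=> x; rewrite /= in_itv/= => xab.
  have e2 : 0 < e / 2 by rewrite divr_gt0.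
  have := cphi x xab => /cvgrPdist_le/(_ _ e2).
  move=> /nbhs_ballP[r/= r0 hr].
  have hr' z : `|x - z| < r -> `|phi x - phi z| <= e / 2 by move=> xz; exact:
    hr.
  have r2 : 0 < r / 2 by rewrite divr_gt0.
  exists (ball x (r / 2), [set eta : R | 0 < eta < r / 2]) => /=.
    split; first exact: nbhsx_ballx.
    near=> s; apply/andP; split; first by near: s; exact: nbhs_right_gt.
    by near: s; exact: nbhs_right_lt.
  move=> [x' eta] /= [xx' /andP[eta0 etar]] y yab x'y.
  rewrite /ball/= in xx'.
  have h1 : `|phi x - phi x'| <= e / 2 by apply: hr'; lra.
  have h2 : `|phi x - phi y| <= e / 2.
    by apply: hr'; have := ler_distD x' x y; lra.
  by have := ler_distD (phi x) (phi x') (phi y);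
    rewrite (distrC (phi x') (phi x)); lra.
- move=> r /= r0 hr; exists (r / 2); first by rewrite divr_gt0.
  move=> x y xab yab xy.
  have := hr (r / 2); rewrite /= sub0r normrN gtr0_norm ?divr_gt0//.
  have r2 : r / 2 < r by lra.
  move=> /(_ r2 isT) h; apply: h => //.
Unshelve. all: by end_near.
Qed.

Lemma clamp_lipschitz (a b x y : R) : a <= b ->
  `|Num.max a (Num.min x b) - Num.max a (Num.min y b)| <= `|x - y|.
Proof.
move=> ab; wlog xy : x y / x <= y.
  by move=> H; have [/H//|/ltW/H] := leP x y; rewrite distrC (distrC x).
rewrite (distrC x) (ger0_norm (_ : 0 <= y - x)) ?subr_ge0//.
have [xb|bx] := leP x b; have [yb|yb] := leP y b;
  have [ax|xa] := leP a x; have [ay|ya] := leP a y;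
  rewrite ?(max_r ab) ler_norml; apply/andP; split; lra.
Qed.

Lemma logcoord_bounded_away (x r : R) : 0 < x < 1 -> `|logcoord x| <= r ->
  expR (- r) / 2 <= x <= 1 - expR (- r) / 2.
Proof.
move=> /andP[x0 x1]; rewrite ler_norml => /andP[h1 h2].
have r0 : 0 <= r by lra.
have er : expR (- r) <= 1 by rewrite expR_le1 oppr_le0.
have [h|h] := leP x 2^-1.
  move: h1; rewrite logcoord_left// => h1.
  have : expR (- r) <= 2 * x by rewrite -(@lnK _ (2 * x)) ?posrE ?ler_expR//;
    lra.
  by move=> ?; apply/andP; split; lra.
move: h2; rewrite logcoord_right ?(ltW h)// => h2.
have : expR (- r) <= 2 * (1 - x).
  by rewrite -(@lnK _ (2 * (1 - x))) ?posrE ?ler_expR//; lra.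
by move=> ?; apply/andP; split; lra.
Qed.

Section Comparison.
Variables (S : R -> Prop) (F : bool -> R -> R) (p : bool -> R -> R).
Variables (V : R -> R) (lambda bb : R).
Hypothesis FS : forall i x, S x -> S (F i x).
Hypothesis p_sum : forall x, S x -> p false x + p true x = 1.
Hypothesis p_ge0 : forall x, S x -> forall i, 0 <= p i x.
Hypothesis lambda_bnd : 0 < lambda < 1.
Hypothesis V_drift : forall x, S x ->
  avg2 (p^~ x) (fun i => V (F i x)) <= lambda * V x + bb.

(** The bracket is the result of [m] iterations of [v := lambda * v + |bb|] from [V x], whose fixed
    point is [|bb| / (1 - lambda)]. *)
Lemma iter_markov_op_lyapunov (f g : R -> R) (kappa : R) : 0 <= kappa ->
  (forall x, S x -> `|f x - g x| <= kappa * V x) -> forall m x, S x ->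
  `|iter m (markov_op F p) f x - iter m (markov_op F p) g x| <=
  kappa * (lambda ^+ m * V x + `|bb| / (1 - lambda) * (1 - lambda ^+ m)).
Proof.
have [l0 l1] := andP lambda_bnd.
move=> k0 fg; elim=> [|m IH] x Sx.
  by rewrite expr0 mul1r subrr mulr0 addr0; exact: fg.
rewrite !iterS; set Pf := iter m _ f; set Pg := iter m _ g.
have -> : markov_op F p Pf x - markov_op F p Pg x =
    avg2 (p^~ x) (fun i => Pf (F i x) - Pg (F i x)) by rewrite avg2B.
apply: le_trans (ler_norm_avg2 _ (p_ge0 Sx)) _.
set b' := `|bb| / (1 - lambda).
apply: (@le_trans _ _ (avg2 (p^~ x) (fun i =>
    kappa * (lambda ^+ m * V (F i x) + b' * (1 - lambda ^+ m))))).
  by apply: ler_avg2 => [|i]; [exact: p_ge0|exact/IH/FS].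
rewrite avg2Ml avg2D avg2Ml (@avg2_const _ (p^~ x) _ (p_sum Sx)).
rewrite ler_wpM2l//.
have lm : 0 <= lambda ^+ m by rewrite exprn_ge0// ltW.
apply: (@le_trans _ _ (lambda ^+ m * (lambda * V x + `|bb|) + b' * (1 - lambda
  ^+ m))).
  rewrite lerD2r ler_wpM2l//; apply: le_trans (V_drift Sx) _.
  by rewrite lerD2l ler_norm.
have hb : b' * (1 - lambda) = `|bb| by rewrite /b' divfK// gt_eqF// subr_gt0.
rewrite exprSr; nra.
Qed.

End Comparison.

Section System.
Variables (x0 y0 : R) (p0 p1 : R -> R).
Hypothesis hp : positive_probabilities p0 p1.
Hypothesis hA1 : condA1 x0 y0.
Hypothesis hA2 : condA2 p0 p1.
Hypothesis hA4 : condA4 x0 y0 p0 p1.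

Local Notation S := (fun z : R => 0 < z < 1).
Local Notation F := (branch x0 y0).
Local Notation p := (prob p0 p1).

(** [system_lyapunov] asks for uniform continuity. So [phi] is composed with a clamp to a compact
    interval containing all points with [V x <= R0]; elsewhere the change is at most [2 * M], hence
    at most [kappa * V x], a bound that survives the iteration. *)
Lemma system_merging : exists (V : R -> R) (lambda bb C : R),
  [/\ measurable_fun setT V, forall x, 1 <= V x & 0 < lambda < 1] /\
  [/\ forall x, S x -> avg2 (p^~ x) (fun i => V (F i x)) <= lambda * V x + bb,
      forall x, S x -> avg2 (p^~ x) (fun i => V (F i x) ^+ 2) <=
                       lambda * V x ^+ 2 + bb,
      forall i x, S x -> V (F i x) <= C * V x &
      forall (phi : R -> R) (M : R), (forall x, S x -> `|phi x| <= M) ->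
        (forall x, S x -> {for x, continuous phi}) ->
        forall e : R, 0 < e -> exists m, forall x y, S x -> S y ->
          `|iter m (markov_op F p) phi x - iter m (markov_op F p) phi y| <=
          e * (V x + V y)].
Proof.
have [V [lambda [bb [C [kV [[mV V_ge1 l01 lcV] [V1 V2 VC merge]]]]]]] :=
  system_lyapunov hp hA1 hA2 hA4.
exists V, lambda, bb, C; split; split => // phi M phiM cphi e e0.
have [l0 l1] := andP l01.
have S01 x : S x -> 0 <= x <= 1 by move=> /andP[? ?]; rewrite !ltW.
have p_sum x : S x -> p false x + p true x = 1.
  by move=> Sx; apply: prob_sum => //; exact: S01.
have p_ge0 x : S x -> forall i, 0 <= p i x.
  by move=> Sx i; rewrite ltW//; apply: prob_gt0 => //; exact: S01.
have FS i x : S x -> S (F i x) by move=> Sx; exact: branch_in.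
have M_ge0 : 0 <= M by exact: le_trans (normr_ge0 _) (phiM _ half_in).
pose b' := `|bb| / (1 - lambda).
have b'_ge0 : 0 <= b' by rewrite divr_ge0// subr_ge0 ltW.
(* Chosen for [kappa * (1 + b') <= e / 3], the share of each of the two replacements of [phi] by
   [psi]; [M + 1] keeps it positive when [M] is 0. *)
pose R0 := 6 * (M + 1) * (1 + b') / e.
have R0_gt0 : 0 < R0 by rewrite divr_gt0// !mulr_gt0//; lra.
pose kappa := 2 * M / R0.
have kappa_ge0 : 0 <= kappa by apply: divr_ge0; [exact: mulr_ge0|exact: ltW].
have kappa_le : kappa * (1 + b') <= e / 3.
  rewrite /kappa mulrAC ler_pdivrMr// /R0.
  have -> : e / 3 * (6 * (M + 1) * (1 + b') / e) = 2 * (M + 1) * (1 + b').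
    by field; rewrite gt_eqF.
  nra.
pose r := `|kV| * R0.
pose dl := expR (- r) / 2.
have r_ge0 : 0 <= r by apply: mulr_ge0; [exact: normr_ge0|exact: ltW].
have dl_gt0 : 0 < dl by rewrite divr_gt0 ?expR_gt0.
have dl_le : dl <= 2^-1.
  have : expR (- r) <= 1 by rewrite expR_le1 oppr_le0.
  by rewrite /dl; lra.
pose clamp (x : R) : R := Num.max dl (Num.min x (1 - dl)).
have clamp_in x : dl <= clamp x <= 1 - dl.
  by rewrite /clamp le_max lexx/= ge_max ge_min lexx orbT andbT; lra.
have clamp_S x : S (clamp x).
  by have /andP[? ?] := clamp_in x; apply/andP; split; lra.
have clamp_id x : dl <= x <= 1 - dl -> clamp x = x.
  by move=> /andP[h1 h2]; rewrite /clamp min_l// max_r.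
have clamp_lip x y : `|clamp x - clamp y| <= `|x - y|.
  by apply: clamp_lipschitz; lra.
pose psi x := phi (clamp x).
have psiM x : S x -> `|psi x| <= M by move=> _; exact: phiM.
have psi_uc e' : 0 < e' -> exists2 eta : R, 0 < eta & forall x y, S x -> S y ->
    `|x - y| <= eta -> `|psi x - psi y| <= e'.
  move=> e'0; have [eta eta0 h] :=
    @uniform_continuity_itv phi dl (1 - dl) e' e'0
    (fun x hx => cphi x ltac:(by case/andP: hx => *; apply/andP; split; lra)).
  exists eta => // x y _ _ xy; apply: h => //.
  exact: le_trans (clamp_lip x y) xy.
have phi_psi x : S x -> `|phi x - psi x| <= kappa * V x.
  move=> Sx; have [h|h] := leP (V x) R0.
    rewrite /psi clamp_id.
      rewrite subrr normr0; apply: mulr_ge0 => //.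
      by apply: le_trans (V_ge1 x); exact: ler01.
    apply: logcoord_bounded_away => //; apply: le_trans (lcV x) _.
    apply: (@le_trans _ _ (`|kV| * V x)).
      by rewrite ler_wpM2r ?ler_norm//; exact: le_trans (V_ge1 x).
    by rewrite /r ler_wpM2l.
  apply: le_trans (ler_normB _ _) _.
  apply: (@le_trans _ _ (2 * M)); first by have := phiM x Sx; have :=
    psiM x Sx; lra.
  by rewrite /kappa mulrAC ler_pdivlMr// ler_wpM2l ?mulr_ge0// ltW.
have e3 : 0 < e / 3 by rewrite divr_gt0.
have [l [N [/andP[l_ge0 l_lt1] N_ge0 hmerge]]] := merge psi M psiM psi_uc _ e3.
have [m hm] : exists m, 2 * M * l ^+ m * (1 + N) <= e / 3.
  have M1 : 0 < M + 1 by rewrite ltr_wpDl.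
  have N1 : 0 < 1 + N by rewrite ltr_pwDl.
  have K0 : 0 < 2 * (M + 1) * (1 + N) by rewrite !mulr_gt0.
  have e4 : 0 < e / 3 / (2 * (M + 1) * (1 + N)) by rewrite divr_gt0.
  have lnorm : `|l| < 1 by rewrite ger0_norm.
  have /cvgrPdist_le/(_ _ e4)[m _ /(_ m (leqnn m))] := cvg_expr lnorm.
  rewrite sub0r normrN ger0_norm ?exprn_ge0//= ler_pdivlMr// => h.
  exists m; apply: le_trans h.
  have := exprn_ge0 m l_ge0; set q := l ^+ m => q0.
  have -> : q * (2 * (M + 1) * (1 + N)) = 2 * M * q * (1 + N) + 2 * (q * (1 +
    N)) by ring.
  by rewrite lerDl !mulr_ge0// ltW.
exists m => x y Sx Sy.
have comp z : S z -> `|iter m (markov_op F p) phi z - iter m (markov_op F p)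
  psi z| <= e / 3 * V z.
  move=> Sz; have := iter_markov_op_lyapunov FS p_sum p_ge0 l01 V1 kappa_ge0
    phi_psi m Sz.
  move=> /le_trans; apply; rewrite -/b'.
  apply: (@le_trans _ _ (kappa * ((1 + b') * V z))).
    rewrite ler_wpM2l//.
    have lm0 : 0 <= lambda ^+ m by rewrite exprn_ge0// ltW.
    have lm1 : lambda ^+ m <= 1 by rewrite exprn_ile1// ltW.
    rewrite mulrDl mul1r lerD ?ler_piMl ?(le_trans ler01)// ler_wpM2l//.
    by apply: le_trans (V_ge1 z); rewrite gerBl.
  by rewrite mulrA ler_wpM2r//; exact: le_trans (V_ge1 z).
have := hmerge m x y Sx Sy.
have := comp x Sx; have := comp y Sy.
set Px := iter m _ phi x; set Py := iter m _ phi y.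
set Qx := iter m _ psi x; set Qy := iter m _ psi y => h1 h2 h3.
have h4 : `|Px - Py| <= `|Px - Qx| + `|Qx - Qy| + `|Py - Qy|.
  have -> : Px - Py = (Px - Qx) + (Qx - Qy) - (Py - Qy) by ring.
  by apply: le_trans (ler_normB _ _) _; rewrite lerD2r ler_normD.
apply: le_trans h4 _.
have Vx := V_ge1 x; have Vy := V_ge1 y.
have Ml_ge0 : 0 <= 2 * M * l ^+ m by rewrite !mulr_ge0// exprn_ge0.
have : 2 * M * l ^+ m * (V x + V y + N) <= e / 3 * (V x + V y).
  apply: (@le_trans _ _ (2 * M * l ^+ m * ((1 + N) * (V x + V y)))).
    rewrite ler_wpM2l// mulrDl mul1r lerD2l ler_peMr//.
    by rewrite -[leLHS]addr0 lerD// (le_trans ler01).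
  by rewrite mulrA ler_wpM2r// addr_ge0 ?(le_trans ler01).
have : e / 3 <= e / 3 * (V x + V y) by rewrite ler_peMr ?(ltW e3)//
  -[leLHS]addr0 lerD// (le_trans ler01).
lra.
Qed.

End System.

End Merging.

(** * Iterates of the operator and the stationary measure *)

Section SystemChain.
Context {R : realType}.
Variables (x0 y0 : R) (p0 p1 : R -> R).
Hypothesis hp : positive_probabilities p0 p1.
Hypothesis hA1 : condA1 x0 y0.
Hypothesis hA2 : condA2 p0 p1.

Local Notation I01 := (`]0, 1[%classic : set R).
Local Notation F := (branch x0 y0).
Local Notation p := (prob p0 p1).

(* the probabilities are only meaningful, and only measurable, on ]0, 1[ *)
Definition prob_in (i : bool) : R -> R := p i \_ I01.
Local Notation q := prob_in.

Lemma I01P (x : R) : I01 x <-> 0 < x < 1.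
Proof. by rewrite /= in_itv/=. Qed.

Lemma prob_inE i x : 0 < x < 1 -> q i x = p i x.
Proof. by move=> x01; rewrite /prob_in patchE mem_set//; apply/I01P. Qed.

Lemma prob_in_out i x : ~ (0 < x < 1) -> q i x = 0.
Proof. by move=> x01; rewrite /prob_in patchE memNset//; apply:
  contra_not x01 => /I01P. Qed.

Lemma prob_in_ge0 i x : 0 <= q i x.
Proof.
have [x01|x01] := boolP (0 < x < 1); last by rewrite prob_in_out//; exact/negP.
rewrite prob_inE//; apply/ltW/prob_gt0 => //.
by case/andP: x01 => ? ?; rewrite !ltW.
Qed.

Lemma measurable_prob_in i : measurable_fun setT (q i).
Proof.
have mI : measurable I01 by exact: measurable_itv.
apply: (measurable_restrictT (p i) mI).1.
apply: open_continuous_measurable_fun; first by apply: interval_open.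
have cp : {within `[0, 1], continuous (p i)} by exact: prob_continuous.
have [h _ _] := (continuous_within_itvP (p i) ltr01).1 cp.
by move=> x; rewrite inE => xI; exact: h.
Qed.

Lemma measurable_branch i : measurable_fun setT (F i).
Proof.
have mf0 : measurable_fun setT (f0 x0 y0).
  apply: measurable_fun_ifT; first exact: measurable_fun_ler.
    exact: measurable_funM.
  apply: measurable_funD => //; apply: measurable_funM => //.
  exact: measurable_funB.
case: i => //; rewrite /branch /f1.
apply: measurable_funB => //; apply: (measurableT_comp mf0).
exact: measurable_funB.
Qed.

Lemma markov_op_prob_in (psi : R -> R) x : 0 < x < 1 ->
  markov_op F q psi x = markov_op F p psi x.
Proof. by move=> x01; rewrite /markov_op /avg2 !prob_inE. Qed.

Lemma markov_op_out (psi : R -> R) x : ~ (0 < x < 1) -> markov_op F q psi x = 0.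
Proof. by move=> x01; rewrite /markov_op /avg2 !prob_in_out// !mul0r addr0. Qed.

Lemma iter_markov_op_prob_in (psi : R -> R) m x : 0 < x < 1 ->
  iter m (markov_op F q) psi x = iter m (markov_op F p) psi x.
Proof.
elim: m x => //= m IH x x01; rewrite markov_op_prob_in// /markov_op /avg2.
by rewrite !IH//; exact: branch_in.
Qed.

(** Off ]0, 1[ the weights vanish and the operator returns 0; the range [0, M] contains this
    value. *)
Lemma iter_markov_op_bounds (psi : R -> R) (M : R) m x :
  (forall y, 0 <= psi y <= M) -> 0 <= iter m (markov_op F q) psi x <= M.
Proof.
move=> psiM; have M0 : 0 <= M.
  by have /andP[h1 h2] := psiM 0; exact: le_trans h2.
elim: m x => [|m IH] x; first exact: psiM.
rewrite iterS; have [x01|/negP x01] := boolP (0 < x < 1); last first.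
  by rewrite markov_op_out// lexx.
apply/andP; split.
  have IH0 i : 0 <= iter m (markov_op F q) psi (F i x) by case/andP:
    (IH (F i x)).
  by rewrite addr_ge0// mulr_ge0// prob_in_ge0.
have qs : q false x + q true x = 1.
  by rewrite !prob_inE//; apply: prob_sum => //; case/andP: x01 => ? ?;
    rewrite !ltW.
rewrite -[leRHS](@avg2_const _ (q^~ x) _ qs); apply: ler_avg2.
  by move=> i; exact: prob_in_ge0.
by move=> i; case/andP: (IH (F i x)).
Qed.

Lemma measurable_iter_markov_op (psi : R -> R) m : measurable_fun setT psi ->
  measurable_fun setT (iter m (markov_op F q) psi).
Proof.
move=> mpsi; elim: m => //= m IH.
by apply: measurable_markov_op => //; [exact: measurable_branch|exact:
  measurable_prob_in].
Qed.

Section Chain.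
Context {d : measure_display} {Omega : measurableType d}.
Variable P : probability Omega R.
Variables (mu : {measure set R -> \bar R}) (X : nat -> {RV P >-> R}).
Hypothesis hX : markov_chain I01 (transition x0 y0 p0 p1) mu X.

Lemma markov_chain_in k w : 0 < X k w < 1.
Proof. by case: hX => h _ _; apply/I01P; exact: h. Qed.

Lemma markov_chain_rectangles i k (A B : set R) : (i <= k)%N ->
  measurable A -> measurable B ->
  P (X i @^-1` A `&` X k.+1 @^-1` B) =
  (\int[P]_(w in X i @^-1` A)
     (avg2 (q^~ (X k w)) (fun j => \1_B (F j (X k w))))%:E)%E.
Proof.
move=> ik mA mB; case: hX => _ _ hM.
rewrite hM//; last by apply: sub_gen_smallest; exists i, A.
apply: eq_integral => w _; rewrite /transition /avg2 EFinD !EFinM.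
by rewrite !prob_inE ?markov_chain_in// !diracE.
Qed.

Lemma initial_integral (h : R -> R) : measurable_fun setT h ->
  (forall x, 0 <= h x) ->
  (\int[P]_w (h (X 0%N w))%:E)%E = (\int[mu]_y (h y)%:E)%E.
Proof.
move=> mh h0; case: hX => _ hmu _.
have := @ge0_integral_pushforward _ _ _ _ R (X 0%N) (measurable_funP (X 0%N)) P
  setT
  (EFin \o h) measurableT.
rewrite preimage_setT => <-; last 2 first.
- exact/measurable_EFinP.
- by move=> y _; rewrite lee_fin.
by apply: eq_measure_integral => A mA _; exact: hmu.
Qed.

End Chain.

Section Invariant.
Variable mu : probability R R.
Hypothesis hmu : mu I01 = 1%E.
Hypothesis hstat : makes_chain_stationary I01 (transition x0 y0 p0 p1) mu.

Lemma markov_op_invariant (h : R -> R) : measurable_fun setT h ->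
  (forall x, 0 <= h x) ->
  (\int[mu]_y (markov_op F q h y)%:E)%E = (\int[mu]_y (h y)%:E)%E.
Proof.
move=> mh h0; case: hstat => d [T [P [X [hX hs]]]].
have mQ := measurable_markov_op measurable_branch measurable_prob_in mh.
have Q0 x : 0 <= markov_op F q h x by apply: markov_op_ge0 => // *; exact:
  prob_in_ge0.
rewrite -(initial_integral hX mQ Q0).
have := @chain_integral _ _ _ P X F q measurable_branch measurable_prob_in
  prob_in_ge0
  (markov_chain_rectangles hX) 0%N 0%N (cst 1) h (leqnn _).
move=> /(_ (measurable_cst _) (fun=> ler01) mh h0).
under eq_integral do rewrite /= mul1r.
under [in X in _ = X -> _]eq_integral do rewrite /= mul1r.
move=> <-.
have := @ge0_integral_pushforward _ _ _ _ R (X 1%N) (measurable_funP (X 1%N)) P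
  setT
  (EFin \o h) measurableT.
rewrite preimage_setT => <-; last 2 first.
- exact/measurable_EFinP.
- by move=> y _; rewrite lee_fin.
apply: eq_measure_integral => A mA _.
(* Stationarity at shift 1 for one coordinate: [X 1] and [X 0] have the same law. *)
have := hs 1%N 1%N (fun=> A) (fun=> mA).
have E (f : nat -> T -> R) : \bigcap_(i in `I_1) f i @^-1` A = f 0%N @^-1` A.
  apply/seteqP; split => w /=; first by move=> /(_ 0%N); exact.
  by move=> h' [|].
rewrite (E (fun i => X (1 + i)%N)) (E (fun i => X i)) addn0 => hA.
transitivity (P (X 0%N @^-1` A)); first exact: hA.
by case: hX => _ ->.
Qed.

Lemma iter_markov_op_invariant (h : R -> R) (M : R) m : measurable_fun setT h ->
  (forall x, 0 <= h x <= M) ->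
  (\int[mu]_y (iter m (markov_op F q) h y)%:E)%E = (\int[mu]_y (h y)%:E)%E.
Proof.
move=> mh hM; elim: m => // m IH.
rewrite -IH iterS markov_op_invariant//; first exact: measurable_iter_markov_op.
by move=> x; case/andP: (iter_markov_op_bounds m x hM).
Qed.

Lemma integ_bounded (h : R -> R) (M : R) : measurable_fun setT h ->
  (forall x, `|h x| <= M) -> integ mu h.
Proof.
move=> mh hM; apply: (@integ_le _ _ _ mu h (cst M)) => //.
exact: finite_measure_integrable_cst.
Qed.

(** [V] is finite, so its sublevel sets exhaust ]0, 1[, and continuity from below applies;
    integrability of [V] does not enter. *)
Lemma sublevel_tight (V : R -> R) (e : R) : measurable_fun setT V -> 0 < e ->
  exists2 A : set R, measurable A & (exists n : nat, forall x, A x ->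
    0 < x < 1 /\ V x <= n%:R) /\
    fine (mu (~` A)) <= e.
Proof.
move=> mV e0.
pose A n : set R := I01 `&` [set x | V x <= n%:R].
have mA n : measurable (A n).
  apply: measurableI; first exact: measurable_itv.
  have := measurable_fun_le measurableT mV (measurable_cst (n%:R : R)).
  by rewrite setTI.
have UA : \bigcup_n A n = I01.
  apply/seteqP; split => [x [n _ []]//|x x01].
  have [n hn] : exists n : nat, V x <= n%:R.
    by exists (Num.bound `|V x|); apply/ltW/(le_lt_trans (ler_norm _)); exact:
      archi_boundP.
  by exists n.
have nd : nondecreasing_seq A.
  move=> m n mn; apply/subsetPset => x [x01 hx]; split => //=.
  by apply: le_trans hx _; rewrite ler_nat.
have cv : mu (A n) @[n --> \oo] --> 1%E.
  rewrite -hmu -UA; apply: nondecreasing_cvg_mu => //.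
  by rewrite UA; exact: measurable_itv.
have fA n : mu (A n) \is a fin_num by exact: fin_num_measure.
have cv' : fine (mu (A n)) @[n --> \oo] --> (1 : R).
  by move/fine_cvgP : cv => [].
have /cvgrPdist_le/(_ _ e0)[n _ /(_ n (leqnn n))/= hn] := cv'.
exists (A n) => //; split.
  by exists n => x [/I01P].
rewrite probability_setC// fineB//.
by have := ler_norm (1 - fine (mu (A n))); move=> /le_trans; apply.
Qed.

(** By invariance the mean of [phi] is that of its [m]-th iterate, so merging can be integrated in
    [y]. As [V] is not known to be integrable, the estimate is used on a set where [V y <= n], and
    the trivial bound on the small remainder. *)
Lemma markov_op_to_mean (V phi : R -> R) (M : R) : measurable_fun setT V ->
  (forall x, 1 <= V x) -> measurable_fun setT phi -> (forall x,
    0 <= phi x <= M) ->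
  (forall e : R, 0 < e -> exists m, forall x y, 0 < x < 1 -> 0 < y < 1 ->
    `|iter m (markov_op F p) phi x - iter m (markov_op F p) phi y| <=
    e * (V x + V y)) ->
  forall e : R, 0 < e -> exists m, forall x, 0 < x < 1 ->
  `|iter m (markov_op F q) phi x - \int[mu]_y phi y| <= e * V x.
Proof.
move=> mV V_ge1 mphi phiM merge e e0.
have M0 : 0 <= M by have /andP[h1 h2] := phiM 0; exact: le_trans h2.
have e2 : 0 < e / (2 * (2 * M + 1)) by rewrite divr_gt0// mulr_gt0//; lra.
have [A mA [[n hA] muA]] := sublevel_tight mV e2.
have n0 : (0 : R) <= n%:R by exact: ler0n.
(* [n] is fixed before [m]: since [V x >= 1], this choice bounds [e1 * (V x + n)] by
   [e / 2 * V x]. *)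
have e3 : 0 < e / (2 * (1 + n%:R)) by rewrite divr_gt0// mulr_gt0//; lra.
have [m hm] := merge _ e3; exists m => x x01.
set Q := iter m _ phi.
have mQ : measurable_fun setT Q by exact: measurable_iter_markov_op.
have QM y : 0 <= Q y <= M by exact: iter_markov_op_bounds.
have iQ : integ mu Q.
  by apply: (@integ_bounded Q M) => // y; have /andP[? ?] := QM y;
    rewrite ger0_norm.
have -> : \int[mu]_y phi y = \int[mu]_y Q y.
  by rewrite /Rintegral /Q (iter_markov_op_invariant _ mphi phiM).
have mu1 : fine (mu setT) = 1 by rewrite probability_setT.
have icst (a : R) : integ mu (fun=> a) by exact: finite_measure_integrable_cst.
have cstE (a : R) : \int[mu]_y a = a by rewrite Rintegral_cst// mu1 mulr1.
have -> : Q x - \int[mu]_y Q y = \int[mu]_y (Q x - Q y).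
  by rewrite (RintegralB measurableT (icst _) iQ) cstE.
have iD : integ mu (fun y => Q x - Q y) by exact: integB.
apply: le_trans (le_normr_Rintegral measurableT iD) _.
have iA : integ mu (\1_(~` A) : R -> R).
  by apply: integrable_indic => //; exact: measurableC.
pose e1 := e / (2 * (1 + n%:R)).
have iB : integ mu (fun y => e1 * (V x + n%:R) + 2 * M * \1_(~` A) y).
  by apply: integD => //; exact: integZ.
apply: (@le_trans _ _ (\int[mu]_y (e1 * (V x + n%:R) + 2 * M * \1_(~` A) y))).
  apply: le_Rintegral => //.
    exact: integrable_norm iD.
  move=> y _; have [Ay|Ay] := pselect (A y).
    have [y01 Vy] := hA y Ay.
    rewrite indicE memNset; last by move=> /(_ Ay).
    rewrite mulr0 addr0 /Q !iter_markov_op_prob_in//.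
    apply: le_trans (hm x y x01 y01) _.
    by rewrite ler_wpM2l ?(ltW e3)// lerD2l.
  rewrite indicE mem_set// mulr1.
  have /andP[? ?] := QM x; have /andP[? ?] := QM y.
  have : 0 <= e1 * (V x + n%:R).
    rewrite mulr_ge0 ?(ltW e3)// addr_ge0//; exact: le_trans (V_ge1 x).
  by move=> ?; rewrite ler_norml; apply/andP; split; lra.
rewrite (RintegralD measurableT (icst _) (integZ _ iA)) cstE (RintegralZl _
  measurableT iA).
have -> : \int[mu]_y \1_(~` A) y = fine (mu (~` A)).
  by rewrite /Rintegral integral_indic//= ?setIT//; exact: measurableC.
have h1 : 2 * M * fine (mu (~` A)) <= e / 2.
  apply: (@le_trans _ _ (2 * M * (e / (2 * (2 * M + 1))))).
    by rewrite ler_wpM2l// mulr_ge0.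
  have -> : 2 * M * (e / (2 * (2 * M + 1))) = e / 2 * (2 * M / (2 * M + 1)).
    by field; rewrite gt_eqF//; lra.
  rewrite ler_piMr ?divr_ge0 ?(ltW e0)// ler_pdivrMr; lra.
have h2 : e1 * (V x + n%:R) <= e / 2 * V x.
  have -> : e / 2 * V x = e1 * ((1 + n%:R) * V x).
    by rewrite /e1; field; rewrite gt_eqF//; lra.
  rewrite ler_wpM2l ?(ltW e3)//; have := V_ge1 x; nra.
have : e / 2 <= e / 2 * V x by rewrite ler_peMr//; lra.
lra.
Qed.

End Invariant.

End SystemChain.

Section Moments.
Context {R : realType}.
Variables (x0 y0 : R) (p0 p1 : R -> R).
Hypothesis hp : positive_probabilities p0 p1.
Hypothesis hA2 : condA2 p0 p1.
Context {d : measure_display} {Omega : measurableType d}.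
Variable P : probability Omega R.
Variables (x : R) (X : nat -> {RV P >-> R}).
Hypothesis hX : markov_chain `]0, 1[%classic (transition x0 y0 p0 p1) \d_x X.
Variables (H : R -> R) (lambda bb : R).
Hypothesis mH : measurable_fun setT H.
Hypothesis H_ge0 : forall y, 0 <= H y.
Hypothesis lambda_bnd : 0 < lambda < 1.
Hypothesis H_drift : forall y, 0 < y < 1 ->
  markov_op (branch x0 y0) (prob_in p0 p1) H y <= lambda * H y + bb.

Local Notation Q := (markov_op (branch x0 y0) (prob_in p0 p1)).

(** The chain starts at the point [x], and the map [v := lambda * v + |bb|] takes
    [H x + |bb| / (1 - lambda)] to a value no larger, so the bound is inherited at each step. *)
Lemma moment_bound k : integ P (fun w => H (X k w)) /\
  \int[P]_w H (X k w) <= H x + `|bb| / (1 - lambda).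
Proof.
have [l0 l1] := andP lambda_bnd.
have b_ge0 : 0 <= `|bb| / (1 - lambda) by rewrite divr_ge0// subr_ge0 ltW.
have mHX j : measurable_fun setT (fun w => H (X j w)).
  by apply: measurableT_comp => //; exact: measurable_funP.
have intP j r : (\int[P]_w (H (X j w))%:E = r%:E)%E ->
    integ P (fun w => H (X j w)) /\ \int[P]_w H (X j w) = r.
  move=> h; split; last by rewrite /Rintegral h.
  apply/integrableP; split; first exact/measurable_EFinP.
  under eq_integral do rewrite /= ger0_norm//.
  by rewrite h ltry.
elim: k => [|k [IH1 IH2]].
  have [|h1 ->] := intP 0%N (H x); last by split => //; rewrite lerDl.
  rewrite (initial_integral hX mH H_ge0) integral_dirac//;
    last exact/measurable_EFinP.
  by rewrite diracT mul1e.
have mQ : measurable_fun setT (fun w => Q H (X k w)).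
  apply: measurableT_comp; last exact: measurable_funP.
  apply: measurable_markov_op => //; first exact: measurable_branch.
  exact: measurable_prob_in.
have Q0 w : 0 <= Q H (X k w).
  by apply: markov_op_ge0 => // *; exact: prob_in_ge0.
have QH w : Q H (X k w) <= lambda * H (X k w) + `|bb|.
  apply: le_trans (H_drift (markov_chain_in hX k w)) _.
  by rewrite lerD2l ler_norm.
have icst : integ P (fun=> `|bb|) by exact: finite_measure_integrable_cst.
have iB := integD (integZ lambda IH1) icst.
have iQ : integ P (fun w => Q H (X k w)).
  by apply: integ_le iB => // w; rewrite ger0_norm.
have E : (\int[P]_w (H (X k.+1 w))%:E = (\int[P]_w Q H (X k w))%:E)%E.
  rewrite /Rintegral fineK; last exact: (integrable_fin_num measurableT iQ).
  have := @chain_integral _ _ _ P X (branch x0 y0) (prob_in p0 p1)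
    (measurable_branch _ _) (measurable_prob_in hp hA2) (prob_in_ge0 hp)
    (markov_chain_rectangles hX) k k (cst 1) H (leqnn _).
  move=> /(_ (measurable_cst _) (fun=> ler01) mH H_ge0) h.
  transitivity (\int[P]_w (cst 1 (X k w) * H (X k.+1 w))%:E)%E.
    by apply: eq_integral => w _; rewrite mul1r.
  by rewrite h; apply: eq_integral => w _; rewrite mul1r.
have [i1 e1] := intP _ _ E; split => //; rewrite e1.
apply: (@le_trans _ _ (\int[P]_w (lambda * H (X k w) + `|bb|))).
  by apply: le_Rintegral => // w _; exact: QH.
rewrite (RintegralD measurableT (integZ lambda IH1) icst) (RintegralZl _
  measurableT IH1).
have -> : \int[P]_w `|bb| = `|bb|.
  by rewrite Rintegral_cst// (_ : fine _ = 1) ?mulr1//= probability_setT.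
have := ler_wpM2l (ltW l0) IH2.
have : `|bb| / (1 - lambda) * (1 - lambda) = `|bb| by rewrite divfK// gt_eqF//
  subr_gt0.
have := H_ge0 x; nra.
Qed.

End Moments.

Section Conclusion.
Context {R : realType}.
Variables (x0 y0 : R) (p0 p1 : R -> R).
Hypothesis hp : positive_probabilities p0 p1.
Hypothesis hA1 : condA1 x0 y0.
Hypothesis hA2 : condA2 p0 p1.
Hypothesis hA4 : condA4 x0 y0 p0 p1.
Variable mu : probability R R.
Hypothesis hmu : mu `]0, 1[%classic = 1%E.
Hypothesis hstat :
  makes_chain_stationary `]0, 1[%classic (transition x0 y0 p0 p1) mu.
Context {d : measure_display} {Omega : measurableType d}.
Variable P : probability Omega R.
Variables (x : R) (X : nat -> {RV P >-> R}).
Hypothesis hX : markov_chain `]0, 1[%classic (transition x0 y0 p0 p1) \d_x X.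

Local Notation I01 := (`]0, 1[%classic : set R).
Local Notation F := (branch x0 y0).
Local Notation q := (prob_in p0 p1).
Local Notation Q := (markov_op F q).

Lemma strong_law_nonneg (phi : R -> R) (M : R) : measurable_fun setT phi ->
  (forall y, 0 <= phi y <= M) -> (forall y, 0 < y < 1 -> {for y,
    continuous phi}) ->
  {ae P, forall w, (\sum_(k < n) phi (X k.+1 w)) / n%:R @[n --> \oo]
                   --> \int[mu]_y phi y}.
Proof.
move=> mphi phiM cphi.
have [V [lambda [bb [C [[mV V_ge1 l01] [V1 V2 VC merge]]]]]] :=
  system_merging hp hA1 hA2 hA4.
have M_ge0 : 0 <= M by have /andP[h1 h2] := phiM 0; exact: le_trans h2.
have phiM' y : 0 < y < 1 -> `|phi y| <= M.
  by move=> _; have /andP[? ?] := phiM y; rewrite ger0_norm.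
have mean := markov_op_to_mean hp hA1 hA2 hmu hstat mV V_ge1 mphi phiM
  (merge phi M phiM' cphi).
have V_ge0 y : 0 <= V y by exact: le_trans (V_ge1 y).
have mF i := measurable_branch x0 y0 i.
have mq := measurable_prob_in hp hA2.
have q_ge0 := prob_in_ge0 hp.
have XS := markov_chain_in hX.
have mV2 : measurable_fun setT (fun y => V y ^+ 2) by exact: measurable_funX.
have V2_ge0 y : 0 <= V y ^+ 2 by exact: sqr_ge0.
have V2' y : 0 < y < 1 -> Q (fun y => V y ^+ 2) y <= lambda * V y ^+ 2 + bb.
  by move=> y01; rewrite markov_op_prob_in//; exact: V2.
(* The strong law asks for second moments, hence the separate drift inequality for [V ^+ 2]. *)
have mom := moment_bound hp hA2 hX mV2 V2_ge0 l01 V2'.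
have QVb y : Q V y <= `|C| * V y.
  have [y01|/negP y01] := boolP (0 < y < 1);
    last by rewrite markov_op_out// mulr_ge0.
  have y01' : 0 <= y <= 1 by case/andP: y01 => *; rewrite !ltW.
  rewrite markov_op_prob_in// -[leRHS](@avg2_const _ ((prob p0 p1)^~ y) _
    (prob_sum hp y01')).
  apply: ler_avg2 => i; first by rewrite ltW// prob_gt0.
  by apply: le_trans (VC i y y01) _; rewrite ler_wpM2r// ler_norm.
(* A common factor: [K * V] dominates [V], [Q V] and all iterates of [phi]. *)
pose K := 1 + `|C| + M.
have K1 : 1 <= K by rewrite /K -addrA lerDl addr_ge0.
have KC : `|C| <= K by rewrite /K; have := normr_ge0 C; lra.
have KM : M <= K by rewrite /K; have := normr_ge0 C; lra.
have KV y a : 0 <= a <= M -> `|a| <= K * V y.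
  move=> /andP[a0 aM]; rewrite ger0_norm//; apply: le_trans aM _.
  by apply: le_trans KM _; rewrite ler_peMr//; lra.
have law (h : R -> R) : measurable_fun setT h ->
    (forall y, `|h y| <= K * V y) -> (forall y, `|Q h y| <= K * V y) ->
    {ae P, forall w,
      (\sum_(k < n) (h (X k.+1 w) - Q h (X k w))) / n%:R @[n --> \oo] --> 0}.
  move=> mh hK QhK.
  apply: (@chain_strong_law _ _ _ P X F q mF mq q_ge0 (markov_chain_rectangles
    hX)
    V `|C| (fun y => 0 < y < 1) XS mV V_ge0 (fun k => (mom k).1) (fun y _ =>
      QVb y)
    h K _ mh hK QhK (fun k => (mom k).2)).
have lawV := law V mV.
have {}lawV : {ae P, forall w,
    (\sum_(k < n) (V (X k.+1 w) - Q V (X k w))) / n%:R @[n --> \oo] --> 0}.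
  apply: lawV => y; first by rewrite ger0_norm// ler_peMl.
  rewrite ger0_norm; last exact: (markov_op_ge0 F q_ge0 V_ge0).
  by apply: le_trans (QVb y) _; rewrite ler_wpM2r.
(* The law is needed for all [m] on one event of probability 1, since the [m] used in the end
   depends on the accuracy. *)
have lawphi : {ae P, forall w, forall m,
    (\sum_(k < n) (iter m Q phi (X k.+1 w) - iter m.+1 Q phi (X k w))) / n%:R
      @[n --> \oo] --> 0}.
  apply: ae_foralln => m; rewrite iterS; apply: law.
  - exact: (measurable_iter_markov_op x0 y0 hp hA2).
  - by move=> y; apply: KV; exact: (iter_markov_op_bounds x0 y0 hp m y phiM).
  - by move=> y; apply: KV; exact: (iter_markov_op_bounds x0 y0 hp m.+1 y phiM).
apply: filterS2 lawV lawphi => w hV hphi.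
apply: (@cesaro_limit _ (fun k => V (X k w)) (fun k => Q V (X k w))
  (fun m k => iter m Q phi (X k w)) lambda bb M _ l01) => //.
- by move=> k; rewrite markov_op_prob_in//; exact: V1.
- move=> m k; have /andP[? ?] := iter_markov_op_bounds x0 y0 hp m (X k w) phiM.
  by rewrite ger0_norm.
- by move=> e e0; have [m hm] := mean e e0; exists m => k; exact: hm.
Qed.

End Conclusion.

Theorem theorem3 (R : realType) (x0 y0 : R) (p0 p1 : R -> R)
    (hp : positive_probabilities p0 p1)
    (hA1 : condA1 x0 y0) (hA2 : condA2 p0 p1) (hA3 : condA3 p0 p1)
    (hA4 : condA4 x0 y0 p0 p1)
    (mu_star : probability R R)
    (hmu : mu_star `]0, 1[%classic = 1%E)
    (hstat : makes_chain_stationary `]0, 1[%classic (transition x0 y0 p0 p1) mu_star)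
    (x : R) (hx : x \in `]0, 1[)
    (d : measure_display) (Omega : measurableType d) (P : probability Omega R)
    (X : nat -> {RV P >-> R})
    (hX : markov_chain `]0, 1[%classic (transition x0 y0 p0 p1) \d_x X)
    (phi : R -> R) (phi_cont : {within `]0, 1[%classic, continuous phi})
    (phi_bnd : [bounded phi y | y in `]0, 1[%classic]) :
  {ae P, forall w,
    (\sum_(1 <= k < n.+1) phi (X k w)) / n%:R @[n --> \oo]
      --> \int[mu_star]_(y in `]0, 1[%classic) phi y}.
Proof.
have [M M_ge0 phiM] : exists2 M, 0 <= M & forall y, 0 < y < 1 -> `|phi y| <= M.
  have [M [_ hM]] := phi_bnd; exists (`|M| + 1); first by rewrite addr_ge0.
  move=> y y01; apply: (hM (`|M| + 1)); last exact/I01P.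
  by have := ler_norm M; lra.
have mI : measurable (`]0, 1[%classic : set R) by exact: measurable_itv.
have oI : open (`]0, 1[%classic : set R) by apply: interval_open.
have cphi y : 0 < y < 1 -> {for y, continuous phi}.
  move=> y01; move: phi_cont; rewrite continuous_open_subspace// => h.
  by apply: h; rewrite inE; apply/I01P.
(* The shift makes [psi] nonnegative, and the extension by 0 makes it bounded and measurable on all
   of R. Since the stationary measure gives mass 1 to ]0, 1[, the mean moves by exactly [M]. *)
pose psi := (fun y => phi y + M) \_ (`]0, 1[%classic : set R).
have psiE y : 0 < y < 1 -> psi y = phi y + M.
  by move=> y01; rewrite /psi patchE mem_set//; apply/I01P.
have mphi : measurable_fun (`]0, 1[%classic : set R) phi.
  exact: subspace_continuous_measurable_fun.
have mpsi : measurable_fun setT psi.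
  apply: (measurable_restrictT _ mI).1; exact: measurable_funD.
have psiM y : 0 <= psi y <= 2 * M.
  have [y01|/negP y01] := boolP (0 < y < 1).
    by rewrite psiE//; have := phiM y y01; rewrite ler_norml => /andP[? ?];
      apply/andP; split; lra.
  rewrite /psi patchE memNset; last by move=> /I01P.
  by rewrite lexx mulr_ge0.
have cpsi y : 0 < y < 1 -> {for y, continuous psi}.
  move=> y01; have h : {for y, continuous (fun z => phi z + M)}.
    by apply: continuousD; [exact: cphi|exact: cst_continuous].
  rewrite /prop_for /continuous_at psiE//; apply: cvg_trans h.
  apply: near_eq_cvg; near=> z.
  have zI : z \in `]0, 1[%R by near: z; apply: near_in_itvoo; rewrite in_itv.
  by rewrite psiE//; move: zI; rewrite in_itv.
have iphi : mu_star.-integrable `]0, 1[%classic (EFin \o phi).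
  apply: (@le_integrable _ _ _ _ _ mI _ (EFin \o cst M)).
  - exact/measurable_EFinP.
  - by move=> y /I01P y01; rewrite /= lee_fin (le_trans (phiM y y01))//
    ler_norm.
  - exact: finite_measure_integrable_cst.
have meanE : \int[mu_star]_y psi y = \int[mu_star]_(y in `]0,
  1[%classic) phi y + M.
  rewrite -Rintegral_mkcond RintegralD//; last exact:
    finite_measure_integrable_cst.
  by rewrite Rintegral_cst// (_ : fine _ = 1) ?mulr1//; exact:
    (congr1 fine hmu).
have := strong_law_nonneg hp hA1 hA2 hA4 hmu hstat hX mpsi psiM cpsi.
apply: filterS => w; rewrite meanE => hw.
have {}hw : (\sum_(k < n) psi (X k.+1 w)) / n%:R - M @[n --> \oo]
    --> \int[mu_star]_(y in `]0, 1[%classic) phi y.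
  have := cvgB hw (cvg_cst M); rewrite addrK; exact.
(* Only eventual equality: at [n = 0], where the quotients are 0, the two sequences differ by
   [M]. *)
apply: cvg_trans hw; apply: near_eq_cvg; near=> n.
have n0 : (n%:R : R) != 0 by rewrite pnatr_eq0 -lt0n; near: n; exact:
  nbhs_infty_gt.
rewrite big_add1 big_mkord.
under eq_bigr do rewrite psiE ?(markov_chain_in hX)//.
by rewrite big_split/= sumr_const card_ord -mulr_natr; field.
Unshelve. all: by end_near.
Qed.
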